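(* For every integer $n\ge 2$, the Hausdorff dimension of the set $$D(\varphi_n)=\{x\in G(n)/\Gamma(n): x_t\to\infty \text{ as } t\to\infty\}$$ satisfies $$\dim_H D(\varphi_n)=\dim G(n)-\tfrac12 .$$ (Here $\dim G(n)=3n$.)
   Context: $G=\mathrm{SL}(2,\mathbb{R})$ and $\Gamma=\mathrm{SL}(2,\mathbb{Z})$. $G(n)=G\times\dots\times G$ and $\Gamma(n)=\Gamma\times\dots\times\Gamma$ ($n$ factors each), so $G(n)/\Gamma(n)=(G/\Gamma)^n$. Let $g_t=\begin{pmatrix}e^{t/2}&0\\0&e^{-t/2}\end{pmatrix}$ and $\varphi_n:\mathbb{R}\to G(n)$, $\varphi_n(t)=(g_t,\dots,g_t)$. The flow is the action of this one-parameter subgroup on $G(n)/\Gamma(n)$ by left multiplication, and for $x\in G(n)/\Gamma(n)$ we write $x_t=\varphi_n(t)x$. The notation $x_t\to\infty$ as $t\to\infty$ means that the forward trajectory $(x_t)_{t\ge0}$ is divergent: for every compact $K\subset G(n)/\Gamma(n)$ there is a time $T$ such that $x_t\notin K$ for all $t>T$. The Hausdorff dimension $\dim_H$ of a subset of $G(n)/\Gamma(n)$ is taken with respect to any metric on $G(n)/\Gamma(n)$ induced by a right invariant (Riemannian) metric on $G(n)$; the choice is irrelevant since Hausdorff dimension depends only on the Lipschitz class of the metric. *)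

(* Defs.v *)
From HB Require Import structures.
From mathcomp Require Import all_boot all_order all_algebra.
From mathcomp Require Import generic_quotient.
From mathcomp Require Import all_classical all_reals all_analysis.

Set Implicit Arguments.
Unset Strict Implicit.
Unset Printing Implicit Defensive.

Import Order.TTheory GRing.Theory Num.Theory.
Import numFieldNormedType.Exports.

Local Open Scope classical_set_scope.
Local Open Scope ring_scope.
Local Open Scope quotient_scope.

Record SL2 (R : realType) : Type :=
  MkSL2 { slmx :> 'M[R]_2; slmxP : \det slmx == 1 }.

HB.instance Definition _ (R : realType) := [isSub for @slmx R].
HB.instance Definition _ (R : realType) := [Choice of SL2 R by <:].

Section SL2Group.
Variable R : realType.
Implicit Types A B C : SL2 R.

Fact sl2_one_subproof : \det (1%:M : 'M[R]_2) == 1.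
Proof. by rewrite det1. Qed.
Definition sl2_one : SL2 R := MkSL2 sl2_one_subproof.

Fact sl2_mul_subproof A B : \det (slmx A *m slmx B) == 1.
Proof. by rewrite det_mulmx (eqP (slmxP A)) (eqP (slmxP B)) mulr1. Qed.
Definition sl2_mul A B : SL2 R := MkSL2 (sl2_mul_subproof A B).

Fact sl2_inv_subproof A : \det (invmx (slmx A)) == 1.
Proof. by rewrite det_inv (eqP (slmxP A)) invr1. Qed.
Definition sl2_inv A : SL2 R := MkSL2 (sl2_inv_subproof A).

Lemma slmx_unit A : slmx A \in unitmx.
Proof. by rewrite unitmxE (eqP (slmxP A)) unitr1. Qed.

Fact sl2_mulA : associative sl2_mul.
Proof. by move=> A B C; apply: val_inj; rewrite /= mulmxA. Qed.
Fact sl2_mul1 : left_id sl2_one sl2_mul.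
Proof. by move=> A; apply: val_inj; rewrite /= mul1mx. Qed.
Fact sl2_mulr1 : right_id sl2_one sl2_mul.
Proof. by move=> A; apply: val_inj; rewrite /= mulmx1. Qed.
Fact sl2_mulV : left_inverse sl2_one sl2_inv sl2_mul.
Proof. by move=> A; apply: val_inj; rewrite /= mulVmx// slmx_unit. Qed.
Fact sl2_mulrV : right_inverse sl2_one sl2_inv sl2_mul.
Proof. by move=> A; apply: val_inj; rewrite /= mulmxV// slmx_unit. Qed.

End SL2Group.

HB.instance Definition _ (R : realType) := isGroup.Build (SL2 R)
  (@sl2_mulA R) (@sl2_mul1 R) (@sl2_mulr1 R) (@sl2_mulV R) (@sl2_mulrV R).

HB.instance Definition _ (R : realType) :=
  Topological.copy (SL2 R) (initial_topology (@slmx R)).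

Definition Gn (R : realType) (n : nat) : Type := {ffun 'I_n -> SL2 R}.

HB.instance Definition _ (R : realType) (n : nat) := Group.on (Gn R n).

(* {ffun _} carries no topology in the library: transport the product one *)
Definition Gn_prod (R : realType) (n : nat) (g : Gn R n) :
  prod_topology (fun _ : 'I_n => SL2 R) := fun i => g i.

HB.instance Definition _ (R : realType) (n : nat) :=
  Topological.copy (Gn R n) (initial_topology (@Gn_prod R n)).

Definition Gamma (R : realType) (n : nat) : {pred Gn R n} :=
  [pred g : Gn R n |
    [forall i : 'I_n, forall a, forall b, slmx (g i) a b \is a Num.int]].
Arguments Gamma : clear implicits.

Section Quotient.
Variables (R : realType) (n : nat).
Implicit Types g h k : Gn R n.

Lemma GammaP g :
  reflect (forall i a b, slmx (g i) a b \is a Num.int) (g \in Gamma R n).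
Proof.
apply: (iffP forallP) => [H i a b|H i].
  by have /forallP/(_ a)/forallP/(_ b) := H i.
by apply/forallP => a; apply/forallP => b; exact: H.
Qed.

Lemma Gamma1 : 1%g \in Gamma R n.
Proof. by apply/GammaP => i a b; rewrite ffunE /= mxE rpred_nat. Qed.

Lemma GammaM g h : g \in Gamma R n -> h \in Gamma R n -> (g * h)%g \in Gamma R n.
Proof.
move=> /GammaP Hg /GammaP Hh; apply/GammaP => i a b.
by rewrite ffunE /= mxE rpred_sum// => k _; rewrite rpredM.
Qed.

Lemma GammaV g : g \in Gamma R n -> (g^-1)%g \in Gamma R n.
Proof.
move=> /GammaP Hg; apply/GammaP => i a b.
rewrite ffunE /= /invmx slmx_unit (eqP (slmxP (g i))) invr1 scale1r.
rewrite /adjugate mxE /cofactor rpredM ?rpredX ?rpredN ?rpred1//.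
rewrite /determinant rpred_sum// => s _; rewrite rpredM ?rpredX ?rpredN ?rpred1//.
by apply: rpred_prod => j _; rewrite !mxE.
Qed.

Definition Gamma_rel : rel (Gn R n) := fun g h => (g^-1 * h)%g \in Gamma R n.

Lemma Gamma_rel_refl : reflexive Gamma_rel.
Proof. by move=> g; rewrite /Gamma_rel mulVg Gamma1. Qed.

Lemma Gamma_rel_sym : symmetric Gamma_rel.
Proof.
suff H g h : Gamma_rel g h -> Gamma_rel h g by move=> g h; apply/idP/idP; exact: H.
by move=> /GammaV; rewrite invgM invgK.
Qed.

Lemma Gamma_rel_trans : transitive Gamma_rel.
Proof.
move=> h g k gh hk; have := GammaM gh hk.
by rewrite /Gamma_rel mulgA -(mulgA g^-1%g) mulgV mulg1.
Qed.

Canonical Gamma_equiv :=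
  EquivRel Gamma_rel Gamma_rel_refl Gamma_rel_sym Gamma_rel_trans.

(* the space of cosets g Gamma(n), with the quotient topology *)
Definition GGamma : Type := quotient_topology {eq_quot Gamma_equiv}.

HB.instance Definition _ := Topological.on GGamma.
HB.instance Definition _ := Quotient.on GGamma.

Definition coset_pi : Gn R n -> GGamma := \pi_GGamma.

Lemma coset_piP g h : reflect (coset_pi g = coset_pi h) (Gamma_rel g h).
Proof. exact: (iffP (eqmodP Gamma_equiv g h)). Qed.

End Quotient.
Arguments GGamma : clear implicits.
Arguments Gamma_rel {R n}.

Section Flow.
Variable R : realType.

Definition diag_flow_mx (t : R) : 'M[R]_2 :=
  diag_mx (\row_(j < 2) (if j == 0 then expR (t / 2) else expR (- t / 2))).

Fact diag_flow_subproof (t : R) : \det (diag_flow_mx t) == 1.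
Proof.
rewrite det_diag !big_ord_recl big_ord0 !mxE/= mulr1 -expRD.
by rewrite mulNr subrr expR0.
Qed.
Definition diag_flow (t : R) : SL2 R := MkSL2 (diag_flow_subproof t).

Variable n : nat.

Definition phi (t : R) : Gn R n := [ffun=> diag_flow t].

Definition flow (t : R) (x : GGamma R n) : GGamma R n :=
  coset_pi (phi t * repr x)%g.

(* [flow] does not depend on the coset representative chosen by [repr] *)
Lemma flow_pi (t : R) (g : Gn R n) : flow t (coset_pi g) = coset_pi (phi t * g)%g.
Proof.
apply/coset_piP; rewrite /Gamma_rel invgM -mulgA (mulgA (phi t)^-1%g) mulVg mul1g.
by apply/coset_piP; rewrite /coset_pi reprK.
Qed.

Definition tends_to_infinity (x : GGamma R n) : Prop :=
  forall K : set (GGamma R n), compact K ->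
    exists T : R, forall t : R, T < t -> ~ K (flow t x).

Definition divergent_set : set (GGamma R n) := [set x | tends_to_infinity x].

End Flow.
Arguments divergent_set : clear implicits.

Section Riemannian.
Variables (R : realType) (n : nat).

Definition ambient : Type := {ffun 'I_n -> 'M[R]_2}.
HB.instance Definition _ := GRing.Lmodule.on ambient.

(* The tangent space to G(n) at g, inside the ambient space of n-tuples of
   matrices: the differential of \det at A with \det A = 1 is
   V |-> \tr (V *m A^-1). *)
Definition tangent (g : Gn R n) : set ambient :=
  [set v | forall i, \tr (v i *m slmx (g i)^-1%g) = 0].

(* differential of the right translation by h *)
Definition translate_vec (v : ambient) (h : Gn R n) : ambient :=
  [ffun i => v i *m slmx (h i)].

(* [rho g] is only constrained on the tangent space at g. Smoothness of rho in g
   follows from right invariance. *)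
Record right_invariant_riemannian (rho : Gn R n -> ambient -> ambient -> R) :
    Prop := {
  riem_sym : forall g v w, tangent g v -> tangent g w -> rho g v w = rho g w v;
  riem_linear : forall g (a : R) u v w, tangent g u -> tangent g v ->
    tangent g w -> rho g (a *: u + v) w = a * rho g u w + rho g v w;
  riem_pos : forall g v, tangent g v -> v != 0 -> 0 < rho g v v;
  riem_right_inv : forall g h v w, tangent g v -> tangent g w ->
    rho (g * h)%g (translate_vec v h) (translate_vec w h) = rho g v w }.

Definition coord (c : R -> Gn R n) (i : 'I_n) : R -> 'M[R]_2 :=
  fun s => slmx (c s i).

Definition velocity (c : R -> Gn R n) (s : R) : ambient :=
  [ffun i => derive1 (coord c i) s].

Definition C1_curve (c : R -> Gn R n) : Prop :=
  forall i, (forall s : R, derivable (coord c i) s 1) /\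
            continuous (derive1 (coord c i)).

Local Open Scope ereal_scope.

Definition curve_length (rho : Gn R n -> ambient -> ambient -> R)
    (c : R -> Gn R n) : \bar R :=
  \int[lebesgue_measure]_(s in `[0%R, 1%R])
    (Num.sqrt (rho (c s) (velocity c s) (velocity c s)))%:E.

(* Infimum over C^1 curves; C^1 curves can be reparametrized to stop at their
   ends, so piecewise C^1 curves would give the same value, and so would curves
   defined on `[0, 1] only. *)
Definition riem_dist (rho : Gn R n -> ambient -> ambient -> R)
    (g h : Gn R n) : \bar R :=
  ereal_inf [set curve_length rho c |
    c in [set c | [/\ C1_curve c, c 0%R = g & c 1%R = h]]].

Definition quotient_dist (rho : Gn R n -> ambient -> ambient -> R)
    (x y : GGamma R n) : \bar R :=
  ereal_inf [set riem_dist rho p.1 p.2 |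
    p in [set p : Gn R n * Gn R n | coset_pi p.1 = x /\ coset_pi p.2 = y]].

End Riemannian.

Section Hausdorff.
Variables (R : realType) (T : Type) (d : T -> T -> \bar R).
Local Open Scope ereal_scope.

Definition diameter (U : set T) : \bar R :=
  ereal_sup [set d p.1 p.2 | p in U `*` U].

(* the empty set weighs 0, also for s = 0 (where 0 `^ 0 = 1) *)
Definition hausdorff_weight (s : R) (U : set T) : \bar R :=
  if U == set0 then 0 else diameter U `^ s.

Definition delta_cover (delta : R) (A : set T) (U : nat -> set T) : Prop :=
  A `<=` \bigcup_i U i /\ forall i, diameter (U i) <= delta%:E.

Definition hausdorff_premeasure (s delta : R) (A : set T) : \bar R :=
  ereal_inf [set \sum_(0 <= i <oo) hausdorff_weight s (U i) |
    U in [set U | delta_cover delta A U]].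

Definition hausdorff_measure (s : R) (A : set T) : \bar R :=
  ereal_sup [set hausdorff_premeasure s delta A |
    delta in [set delta : R | (0 < delta)%R]].

Definition hausdorff_dim (A : set T) : \bar R :=
  ereal_inf [set s%:E |
    s in [set s : R | (0 <= s)%R /\ hausdorff_measure s A = 0]].

End Hausdorff.

(* Main.v *)
Require Import Defs.
From HB Require Import structures.
From mathcomp Require Import all_boot all_order all_algebra.
From mathcomp Require Import generic_quotient.
From mathcomp Require Import all_classical all_reals all_analysis measurable_realfun.
From mathcomp Require Import zify ring lra.

Set Implicit Arguments.
Unset Strict Implicit.
Unset Printing Implicit Defensive.

Import Order.TTheory GRing.Theory Num.Theory.
Import numFieldNormedType.Exports.

Local Open Scope classical_set_scope.
Local Open Scope ring_scope.

(** Every coset has a representative [chart x y th], whose components are products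
    of a lower triangular matrix, which stays bounded under the forward flow, and
    of the unipotent matrix [(1 th; 0 1)], in the expanding direction. Hence the
    divergence of a trajectory depends on the coordinates [th] only. By Mahler's
    criterion ([mahler], [compact_bounded]) the trajectory diverges if and only if
    for each bound, at all large times, one of the [n] lattices in the plane has
    a vector shorter than this bound; the height of a lattice is the inverse of
    the length of its shortest vector.

    Upper bound. Cut the unit interval of an expanding coordinate into
    [B = 2 ^ (2 L)] subintervals, which a step of the flow with the dilation factor
    [A = 2 ^ L] expands to unit length. The sum of the heights after the step, over
    the subintervals, is at most about [L * (A * height + B)]
    ([sum_height_step]). Hence the sum of the products of the [n] heights, over the
    [B ^ n] boxes, grows by a factor of about [(200 L) ^ n * B ^ n], and by a
    factor [A = B ^ (1 / 2)] less when one of the lattices is high. Heights are at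
    least 1, so this bounds the number of boxes met by the parameters for which
    some lattice is high at all times ([cover_count]). With the [2 n] other
    coordinates, about [B ^ (N (3 n - 1 / 2))] boxes of side [B ^ - N] suffice, up
    to powers of [L] that are negligible when [L] is large, and the Hausdorff
    measure of any exponent [s > 3 n - 1 / 2] vanishes ([divergent_null]).

    Lower bound. Two lattices make alternating excursions into the cusp. A
    rational approximation [p / q] of [th] with [q] about [2 ^ e] and
    [|q th - p|] at most [2 ^ - f] puts the lattice of [th] in the cusp while the
    dilation factor of the flow is between [2 ^ e] and [2 ^ f]. [cusp_set 0] and
    [cusp_set 1] consist of the numbers with such approximations for two
    sequences of windows that alternate and overlap; with one coordinate in each
    of them the trajectory diverges ([cusp_divergent]). An interval of length
    [2 ^ - (e + f)] contains about [2 ^ (2 e' - e - f)] fractions with denominators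
    about [2 ^ e'] ([many_fractions]), and the resulting Cantor sets have dimension
    3/4 ([cusp_set_frostman]). Indeed [e], [f], [e'] are about [16 u ^ 3],
    [16 (u + 1) ^ 3], [16 (u + 2) ^ 3], where [u] increases by 2 with the level;
    adding up the [2 e' - e - f], about [144 u ^ 2], one finds about
    [2 ^ (24 u ^ 3)] points at the scale [2 ^ - (e + f)], about [2 ^ - (32 u ^ 3)].
    The product of the two Cantor sets with [3 n - 2] intervals has dimension
    [2 * 3 / 4 + 3 n - 2 = 3 n - 1 / 2] ([product_frostman], [divergent_positive]).

    The transfer between coordinates and the Riemannian distance is an upper bound
    by the length of the image of a segment ([riem_dist_chart]), and a lower bound
    that uses that a short curve moves a point by a matrix close to the identity
    ([curve_short], [chart_separation]). *)

(** * Heights of lattices in the plane *)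

Lemma sum_inv_pow2 (R : realType) m :
  \sum_(0 <= i < 2 ^ m) (maxn i 1)%:R^-1 <= (m.+1)%:R :> R.
Proof.
elim: m => [|m IHm]; first by rewrite big_nat1 invr1.
rewrite (@big_cat_nat _ _ _ (2 ^ m)%N) ?leq_exp2l//=.
rewrite -[in leRHS]natr1; apply: lerD => //.
apply: (@le_trans _ _ (\sum_(2 ^ m <= i < 2 ^ m.+1) (2 ^ m)%:R^-1)).
  apply: ler_sum_nat => i /andP[mi _].
  by rewrite lef_pV2 ?posrE ?ltr0n ?expn_gt0 ?ler_nat//; lia.
rewrite sumr_const_nat expnS mul2n -addnn addnK -[_ *+ _]mulr_natr mulVf//.
Qed.

(** Up to a constant the sum is a harmonic sum, whatever the position of
    [kappa]: to the left and to the right of the integer part of [kappa] the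
    distances are at least 0, 1, 2, ... *)
Lemma sum_inv_dist (R : realType) (kappa : R) m :
  \sum_(0 <= k < 2 ^ m) (Num.max 1 `|k%:R - kappa|)^-1 <= 2 * (m.+1)%:R.
Proof.
set n := (2 ^ m)%N; have n0 : (0 < n)%N by rewrite expn_gt0.
pose t i : R := (maxn i 1)%:R^-1.
have t0 i : 0 <= t i by rewrite invr_ge0.
pose c := minn (Num.truncn kappa) n.-1.
have cn : (c < n)%N by rewrite /c; lia.
have tmono (x : R) i : i%:R <= x -> (Num.max 1 x)^-1 <= t i.
  move=> ix; rewrite /t lef_pV2 ?posrE ?ltr0n ?lt_max ?ltr01//; last by lia.
  by rewrite le_max; case: (leqP i 1) => i1; rewrite ?lexx// ix orbT.
have left k : (k <= c)%N -> (Num.max 1 `|k%:R - kappa|)^-1 <= t (c - k)%N.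
  move=> kc; apply: tmono; have [k0|k0] := leP 0 kappa.
    rewrite natrB// distrC; apply: le_trans (ler_norm _); rewrite lerD2r.
    have /andP[+ _] := truncn_itv k0; apply: le_trans.
    by rewrite ler_nat geq_minl.
  by rewrite /c truncn_floor (lt_geF k0)/= min0n sub0n mulr0n normr_ge0.
have right k : (c < k < n)%N -> (Num.max 1 `|k%:R - kappa|)^-1 <= t (k - c.+1)%N.
  move=> /andP[ck kn]; apply: tmono; rewrite natrB//.
  apply: le_trans (ler_norm _); rewrite lerD2l lerN2.
  have cE : c = Num.truncn kappa by rewrite /c; move: ck; rewrite /c; lia.
  rewrite cE; exact: ltW (truncnS_gt _).
have tsum i : (i <= n)%N -> \sum_(0 <= k < i) t k <= (m.+1)%:R.
  move=> ni; apply: le_trans (sum_inv_pow2 R m).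
  rewrite -/n [leRHS](@big_cat_nat _ _ _ i)//= lerDl; apply: sumr_ge0 => k _; exact: t0.
rewrite (@big_cat_nat _ _ _ c.+1)//= mulr2n mulrDl mul1r; apply: lerD.
  apply: le_trans (tsum _ cn); rewrite [leRHS]big_nat_rev/=.
  by apply: ler_sum_nat => k /andP[_ kc]; rewrite add0n subSS; exact: left.
apply: le_trans (tsum (n - c.+1)%N (leq_subr _ _)).
rewrite -[X in \sum_(X <= _ < _) _ <= _]add0n big_addn; apply: ler_sum_nat => k /andP[_ kc].
by rewrite -[X in t X](addnK c.+1); apply: right; lia.
Qed.

Section PlaneVectors.
Context {R : realType}.
Implicit Types (S : set (R * R)) (v w : R * R) (f : R * R -> R * R).
Local Open Scope classical_set_scope.

Definition det2 v w : R := v.1 * w.2 - v.2 * w.1.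
Definition opp2 v : R * R := (- v.1, - v.2).
Definition norm2 v : R := Num.max `|v.1| `|v.2|.

(** What is retained of the set of primitive vectors of a unimodular lattice: two
    of them span a parallelogram of integral area, and are opposite or equal if
    the area vanishes. *)
Definition unimodular_set S :=
  (forall v, S v -> norm2 v != 0) /\
  (forall v w, S v -> S w -> `|det2 v w| < 1 -> w = v \/ w = opp2 v).

Definition area_preserving f :=
  (forall v w, det2 (f v) (f w) = det2 v w) /\ (forall v, f (opp2 v) = opp2 (f v)).

(** The inverse of the length of the shortest vector, cut off at 1. *)
Definition height S : R := sup [set r | r = 1 \/ exists2 v, S v & r = (norm2 v)^-1].

Lemma norm2_ge0 v : 0 <= norm2 v.
Proof. by rewrite le_max normr_ge0. Qed.

Lemma norm2_opp v : norm2 (opp2 v) = norm2 v.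
Proof. by rewrite /norm2/= !normrN. Qed.

Lemma norm2_le v (c : R) : (norm2 v <= c) = (`|v.1| <= c) && (`|v.2| <= c).
Proof. by rewrite ge_max. Qed.

Lemma norm2_lt v (c : R) : (norm2 v < c) = (`|v.1| < c) && (`|v.2| < c).
Proof. by rewrite gt_max. Qed.

Lemma norm2_fst v : `|v.1| <= norm2 v. Proof. by rewrite le_max lexx. Qed.
Lemma norm2_snd v : `|v.2| <= norm2 v. Proof. by rewrite le_max lexx orbT. Qed.

Lemma det2_le v w : `|det2 v w| <= 2 * norm2 v * norm2 w.
Proof.
apply: le_trans (ler_normB _ _) _; rewrite !normrM.
have := ler_pM (normr_ge0 _) (normr_ge0 _) (norm2_fst v) (norm2_snd w).
have := ler_pM (normr_ge0 _) (normr_ge0 _) (norm2_snd v) (norm2_fst w).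
lra.
Qed.

Lemma unimodular_short S v w : unimodular_set S -> S v -> S w ->
  2 * norm2 v * norm2 w < 1 -> w = v \/ w = opp2 v.
Proof. by move=> [_ HS] Sv Sw vw; apply: HS => //; apply: le_lt_trans (det2_le _ _) _. Qed.

Lemma unimodular_gt0 S v : unimodular_set S -> S v -> 0 < norm2 v.
Proof. by move=> [HS _] /HS v0; rewrite lt_def v0 norm2_ge0. Qed.

(* two short vectors that are not opposite span too small an area *)
Lemma height_has_sup S : unimodular_set S ->
  has_sup [set r | r = 1 \/ exists2 v, S v & r = (norm2 v)^-1].
Proof.
move=> HS; split; first by exists 1; left.
have [[v Sv]|noS] := pselect (exists v, S v); last first.
  by exists 1 => r [->//|[v Sv _]]; exfalso; apply: noS; exists v.
have v0 := unimodular_gt0 HS Sv.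
exists (1 + (norm2 v)^-1 + 2 * norm2 v) => r [->|[w Sw ->]].
  by rewrite -addrA lerDl addr_ge0 ?invr_ge0 ?mulr_ge0 ?norm2_ge0.
have w0 := unimodular_gt0 HS Sw.
have [vw|vw] := ltP (2 * norm2 v * norm2 w) 1.
  have -> : norm2 w = norm2 v.
    by have [->|->] := unimodular_short HS Sv Sw vw; rewrite ?norm2_opp.
  rewrite addrAC lerDr; apply: addr_ge0 => //; apply: mulr_ge0 => //; exact: ltW.
apply: (@le_trans _ _ (2 * norm2 v)); first by rewrite -ler_pdivrMr// div1r in vw.
by rewrite lerDr addr_ge0// invr_ge0 ltW.
Qed.

Lemma height_ge1 S : unimodular_set S -> 1 <= height S.
Proof. by move=> HS; apply: ub_le_sup; [case: (height_has_sup HS)|left]. Qed.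

Lemma height_ge S v : unimodular_set S -> S v -> (norm2 v)^-1 <= height S.
Proof.
by move=> HS Sv; apply: ub_le_sup; [case: (height_has_sup HS)|right; exists v].
Qed.

Lemma height_le S (c : R) : 1 <= c -> (forall v, S v -> (norm2 v)^-1 <= c) ->
  height S <= c.
Proof.
by move=> c1 Sc; apply: ge_sup => [|r [->//|[v Sv ->]]]; [exists 1; left|exact: Sc].
Qed.

Lemma unimodular_image S f : area_preserving f -> unimodular_set S ->
  unimodular_set (f @` S).
Proof.
move=> [fdet fopp] HS; split=> [_ [v Sv <-]|_ _ [v Sv <-] [w Sw <-]]; last first.
  rewrite fdet => vw; have [->|->] := HS.2 v w Sv Sw vw; first by left.
  by right; rewrite fopp.
apply/negP => /eqP fv0.
(* a vector of length 0 would have area 0 with a vector completing [v] *)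
have d0 w : det2 v w = 0.
  rewrite -fdet; apply/normr0_eq0/le_anti; rewrite normr_ge0 andbT.
  by apply: le_trans (det2_le _ _) _; rewrite fv0 mulr0 mul0r.
have := unimodular_gt0 HS Sv; rewrite lt_max.
have := d0 (0, 1); have := d0 (1, 0); rewrite /det2/= !mulr1 !mulr0.
by rewrite subr0 sub0r => /eqP; rewrite oppr_eq0 => /eqP-> ->; rewrite normr0 ltxx.
Qed.

Lemma height_image_le S f (c : R) : 1 <= c -> unimodular_set S ->
  (forall v, S v -> norm2 v <= c * norm2 (f v)) ->
  height (f @` S) <= c * height S.
Proof.
move=> c1 HS fc; have c0 : 0 < c by apply: lt_le_trans c1.
apply: height_le => [|_ [v Sv <-]].
  by apply: le_trans c1 _; rewrite ler_peMr ?height_ge1// ltW.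
have := height_ge HS Sv; rewrite -(ler_pM2l c0); apply: le_trans.
have v0 := unimodular_gt0 HS Sv.
have fv0 : 0 < norm2 (f v).
  by have := lt_le_trans v0 (fc _ Sv); rewrite pmulr_rgt0.
rewrite -[c]invrK -invfM lef_pV2 ?posrE ?mulr_gt0 ?invr_gt0//.
by rewrite ler_pdivrMl ?fc.
Qed.

Definition shear (x : R) v : R * R := (v.1 + x * v.2, v.2).
Definition dilate (a : R) v : R * R := (a * v.1, v.2 / a).

Lemma area_shear x : area_preserving (shear x).
Proof.
by split=> [v w|v]; rewrite /det2 /shear /opp2/=; [ring|rewrite mulrN -opprD].
Qed.

Lemma area_dilate a : a != 0 -> area_preserving (dilate a).
Proof.
move=> a0; split=> [v w|v]; rewrite /det2 /dilate /opp2/=; last by rewrite mulrN mulNr.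
by field.
Qed.

Lemma area_comp f g : area_preserving f -> area_preserving g ->
  area_preserving (f \o g).
Proof.
by move=> [fd fo] [gd go]; split=> [v w|v] /=; [rewrite fd gd|rewrite go fo].
Qed.

(** One step of the flow, seen from the [k]-th of the [2 ^ (2 L)] subintervals. *)
Definition step_map (L k : nat) : R * R -> R * R :=
  dilate (2 ^ L)%:R \o shear (k%:R / (2 ^ (2 * L))%:R).

Lemma pow2_gt0 m : 0 < (2 ^ m)%:R :> R. Proof. by rewrite ltr0n expn_gt0. Qed.

Lemma area_step L k : area_preserving (step_map L k).
Proof. by apply: area_comp (area_dilate _) (area_shear _); rewrite gt_eqF ?pow2_gt0. Qed.

Lemma norm2_step L k v : v.2 != 0 ->
  norm2 (step_map L k v) = `|v.2| / (2 ^ L)%:R *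
    Num.max 1 `|k%:R - (- v.1 * (2 ^ (2 * L))%:R / v.2)|.
Proof.
move=> y0; have A0 := pow2_gt0 L; rewrite maxr_pMr; last first.
  by rewrite divr_ge0 ?normr_ge0 ?ler0n.
rewrite mulr1 /norm2 /= normf_div (gtr0_norm A0) maxC; congr Num.max.
rewrite -[in RHS](gtr0_norm A0) -normf_div -normrM; congr (`|_|).
rewrite mul2n -addnn expnD natrM; field.
by rewrite y0 (gt_eqF A0).
Qed.

Lemma sum_step_inv L v : (0 < L)%N -> v.2 != 0 ->
  \sum_(0 <= k < 2 ^ (2 * L)) (norm2 (step_map L k v))^-1
    <= 8 * L%:R * ((2 ^ L)%:R / `|v.2|).
Proof.
move=> L0 y0.
under eq_bigr do rewrite norm2_step// invfM invf_div.
rewrite -mulr_sumr mulrC ler_wpM2r ?divr_ge0 ?normr_ge0 ?ler0n//.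
apply: le_trans (sum_inv_dist _ _) _.
by rewrite -!natrM ler_nat; lia.
Qed.

Lemma sum_step_inv_norm L v : (0 < L)%N -> norm2 v != 0 ->
  \sum_(0 <= k < 2 ^ (2 * L)) (norm2 (step_map L k v))^-1
    <= 16 * L%:R * ((2 ^ L)%:R / norm2 v).
Proof.
move=> L0 v0; have A0 := pow2_gt0 L.
have {}v0 : 0 < norm2 v by rewrite lt_def v0 norm2_ge0.
have L1 : 1 <= L%:R :> R by rewrite ler1n.
have [xy|xy] := leP `|v.1| (2 * `|v.2|).
  have yv : norm2 v <= 2 * `|v.2| by rewrite norm2_le xy; have := normr_ge0 v.2; lra.
  have y0 : 0 < `|v.2| by lra.
  apply: le_trans (sum_step_inv L0 _) _; first by rewrite -normr_gt0.
  rewrite (_ : 16 * _ * _ = 8 * L%:R * (2 * ((2 ^ L)%:R / norm2 v))); last by ring.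
  rewrite ler_wpM2l ?mulr_ge0 ?ler0n// [leRHS]mulrCA ler_wpM2l ?ler0n//.
  by rewrite ler_pdivlMr// ler_pdivrMl// mulrC.
have vE : norm2 v = `|v.1| by apply/max_idPl; have := normr_ge0 v.2; lra.
have x0 : 0 < `|v.1| by rewrite -vE.
apply: (@le_trans _ _ (\sum_(0 <= k < 2 ^ (2 * L)) 2 / ((2 ^ L)%:R * `|v.1|))).
  apply: ler_sum_nat => k /andP[_ kB].
  have Ax0 : 0 < (2 ^ L)%:R * `|v.1| / 2 by rewrite divr_gt0// mulr_gt0.
  suff Ax : (2 ^ L)%:R * `|v.1| / 2 <= norm2 (step_map L k v).
    by rewrite -[leRHS]invf_div lef_pV2 ?posrE// (lt_le_trans Ax0 Ax).
  apply: le_trans (norm2_fst _); rewrite /= normrM (gtr0_norm A0) -mulrA.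
  rewrite ler_wpM2l ?ltW//.
  have t1 : k%:R / (2 ^ (2 * L))%:R <= 1 :> R.
    by rewrite ler_pdivrMr ?pow2_gt0// mul1r ler_nat ltnW.
  have t0 : 0 <= k%:R / (2 ^ (2 * L))%:R :> R by rewrite divr_ge0.
  set t := _ / _ in t0 t1 *.
  have := lerB_normD v.1 (t * v.2); rewrite normrM (ger0_norm t0).
  have := ler_wpM2r (normr_ge0 v.2) t1; lra.
rewrite sumr_const_nat subn0 -[_ *+ _]mulr_natl mul2n -addnn expnD natrM vE.
rewrite (_ : _ * _ = 2 * ((2 ^ L)%:R / `|v.1|)); last first.
  by field; rewrite !gt_eqF.
by rewrite ler_wpM2r ?divr_ge0 ?ler0n//; lra.
Qed.

Lemma ler_sum_subrange (F : nat -> R) a b N : (a <= b)%N -> (b <= N)%N ->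
  (forall i, 0 <= F i) -> \sum_(a <= i < b) F i <= \sum_(0 <= i < N) F i.
Proof.
move=> ab bN F0; have sF c d : 0 <= \sum_(c <= i < d) F i by exact: sumr_ge0.
rewrite [leRHS](@big_cat_nat _ _ _ b)//= [in leRHS](@big_cat_nat _ _ _ a)//=.
by rewrite -addrA addrCA lerDl addr_ge0.
Qed.

Lemma count_near (rho kappa : R) k N : 0 <= rho -> `|k%:R - kappa| <= rho ->
  rho <= k%:R -> (k%:R + rho < N%:R) ->
  rho <= \sum_(0 <= m < N) (`|m%:R - kappa| <= rho)%R%:R.
Proof.
move=> rho0 kkappa rhok rhoN; have /andP[tr rt] := truncn_itv rho0.
set t := Num.truncn rho in tr rt.
have tk : (t <= k)%N by rewrite -(ler_nat R) (le_trans tr).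
have tN : (k + t < N)%N by rewrite -(ltr_nat R) natrD; apply: le_lt_trans rhoN; rewrite lerD2l.
have F0 m : 0 <= (`|m%:R - kappa| <= rho)%R%:R :> R by [].
have sum1 a : (forall m, (a <= m < a + t.+1)%N -> `|m%:R - kappa| <= rho) ->
    rho <= \sum_(a <= m < a + t.+1) (`|m%:R - kappa| <= rho)%R%:R.
  move=> Ha; apply: le_trans (ltW rt) _.
  rewrite (eq_big_nat _ _ (F2 := fun=> 1)) => [|m mt]; last by rewrite Ha.
  by rewrite sumr_const_nat addKn.
move: kkappa; rewrite ler_norml => /andP[k1 k2].
have [kk|kk] := leP k%:R kappa.
  apply: le_trans (ler_sum_subrange (a := k) (b := k + t.+1) _ _ F0); last 2 first.
  - by rewrite leq_addr.
  - by rewrite addnS.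
  apply: sum1 => m /andP[km mt]; rewrite ler_norml; apply/andP; split.
    by move: km; rewrite -(ler_nat R); lra.
  by move: mt; rewrite addnS ltnS -(ler_nat R) natrD; lra.
apply: le_trans (ler_sum_subrange (a := (k - t)%N) (b := ((k - t) + t.+1)%N) _ _ F0); last 2 first.
- by rewrite leq_addr.
- by rewrite addnS subnK// (leq_trans _ tN)// ltnS leq_addr.
apply: sum1 => m; rewrite addnS subnK// ltnS => /andP[km mt].
rewrite ler_norml; apply/andP; split.
  by move: km; rewrite leq_subLR -(ler_nat R) natrD; lra.
by move: mt; rewrite -(ler_nat R); lra.
Qed.

(** Every other vector [w] that is short after some step [k] owns an interval of
    about [2 ^ L / |w.2|] positions; those of different vectors are disjoint, and
    the sum over the steps at which [w] is short is proportional to the length of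
    its interval, up to the factor [L]. *)
Lemma sum_step_long S L : (0 < L)%N -> unimodular_set S ->
  exists beta : nat -> R,
  [/\ forall k, 0 <= beta k,
      forall k w, (k < 2 ^ (2 * L))%N -> S w -> 1 / 2 <= norm2 w ->
        norm2 (step_map L k w) < 1 / 4 -> (norm2 (step_map L k w))^-1 <= beta k &
      \sum_(0 <= k < 2 ^ (2 * L)) beta k <= 96 * L%:R * (2 ^ (2 * L))%:R].
Proof.
move=> L0 HS; set B := (2 ^ (2 * L))%N; set A : R := (2 ^ L)%:R.
have A0 : 0 < A := pow2_gt0 L; have B0 : 0 < B%:R :> R := pow2_gt0 (2 * L).
have BE : B%:R = A * A by rewrite /B mul2n -addnn expnD natrM.
have A2 : 2 <= A by rewrite (ler_nat _ 2) -[X in (X <= _)%N]expn1 leq_exp2l.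
pose P k w := [/\ S w, 1 / 2 <= norm2 w & norm2 (step_map L k w) < 1 / 4].
pose bad k := `[< exists w, P k w >].
pose wk k := xget (0, 0) (P k).
have Pk k : bad k -> P k (wk k).
  by move=> /asboolP[w Pw]; apply: (@xgetPex _ (0, 0) (P k)); exists w.
pose beta k : R := if bad k then (norm2 (step_map L k (wk k)))^-1 else 0.
have beta0 k : 0 <= beta k by rewrite /beta; case: ifP => // _; rewrite invr_ge0 norm2_ge0.
exists beta; split => //.
  move=> k w kB Sw w2 fw4.
  have badk : bad k by apply/asboolP; exists w.
  have [Sk k2 fk4] := Pk _ badk.
  rewrite /beta badk; have [|-> //|->] := HS.2 _ _ Sk Sw.
    rewrite -(area_step L k).1; apply: le_lt_trans (det2_le _ _) _.
    have := ler_pM (norm2_ge0 _) (norm2_ge0 _) (ltW fk4) (ltW fw4); lra.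
  by rewrite (area_step L k).2 norm2_opp.
(* shape of the vectors that become short *)
have shape k : (k < B)%N -> bad k ->
    [/\ S (wk k), 1 / 4 <= `|(wk k).2|, `|(wk k).2| <= A / 4 &
      `|(wk k).1 + k%:R / B%:R * (wk k).2| <= (4 * A)^-1].
  move=> kB /Pk[Sk k2]; rewrite norm2_lt /= normrM normf_div (gtr0_norm A0).
  set t := k%:R / B%:R; move=> /andP[x4 y4].
  have t0 : 0 <= t by rewrite divr_ge0.
  have t1 : t <= 1 by rewrite ler_pdivrMr// mul1r ler_nat ltnW.
  have x4' : `|(wk k).1 + t * (wk k).2| <= (4 * A)^-1.
    by rewrite -[leRHS]mul1r ler_pdivlMr ?mulr_gt0//; lra.
  split => //; last by rewrite ltr_pdivrMr// in y4; lra.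
  rewrite leNgt; apply/negP => y14.
  move: k2; rewrite leNgt norm2_lt; apply/negP/negPn/andP; split; last by lra.
  have := lerB_normD (wk k).1 (t * (wk k).2); rewrite normrM (ger0_norm t0).
  have := ler_wpM2r (normr_ge0 (wk k).2) t1.
  have : (4 * A)^-1 <= 1 / 8.
    by rewrite -[leLHS]mul1r ler_pdivrMr ?mulr_gt0//; lra.
  lra.
(* [K k] is the interval owned by [wk k], in steps shifted by [B] so that the
   positions are nonnegative *)
pose K k m := `|(wk k).1 + (m%:R - B%:R) / B%:R * (wk k).2| <= (4 * A)^-1.
have same k k' m : (k < B)%N -> (k' < B)%N -> bad k -> bad k' -> K k m -> K k' m ->
    wk k = wk k' \/ wk k = opp2 (wk k').
  move=> kB k'B /(shape _ kB)[Sk _ yk _] /(shape _ k'B)[Sk' _ yk' _] Km K'm.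
  apply: HS.2 => //; rewrite -(area_shear ((m%:R - B%:R) / B%:R)).1 /det2/=.
  apply: le_lt_trans (ler_normB _ _) _; rewrite !normrM.
  have := ler_pM (normr_ge0 _) (normr_ge0 _) Km yk'.
  have := ler_pM (normr_ge0 _) (normr_ge0 _) yk' Km.
  have := ler_pM (normr_ge0 _) (normr_ge0 _) K'm yk.
  have := ler_pM (normr_ge0 _) (normr_ge0 _) yk K'm.
  have -> : (4 * A)^-1 * (A / 4) = 1 / 16 by field; rewrite gt_eqF.
  have -> : A / 4 * (4 * A)^-1 = 1 / 16 by field; rewrite gt_eqF.
  lra.
have card k : (k < B)%N -> bad k ->
    1 <= 4 * `|(wk k).2| / A * \sum_(0 <= m < 3 * B) (K k m)%:R.
  move=> kB /(shape _ kB)[_ y1 y2 xk]; set y := (wk k).2 in y1 y2 xk *.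
  have y0 : 0 < `|y| by lra.
  pose rho := A / (4 * `|y|); pose kappa := B%:R - (wk k).1 * B%:R / y.
  have KE m : (`|m%:R - kappa| <= rho) = K k m.
    have lineE (x b t : R) : b != 0 ->
        x + (t - b) / b * y = (t - (b - x * b / y)) * (y / b).
      by move=> b0; field; rewrite b0 -normr_gt0 y0.
    rewrite /K -/y lineE ?gt_eqF//.
    rewrite normrM normf_div (gtr0_norm B0) -ler_pdivlMr ?divr_gt0//.
    by congr (_ <= _); rewrite /rho BE; field; rewrite !gt_eqF.
  rewrite -ler_pdivrMl; last by rewrite divr_gt0// mulr_gt0.
  rewrite mulr1 invf_div -/rho; under eq_bigr do rewrite -KE.
  have rhoA : rho <= A by rewrite /rho ler_pdivrMr; [rewrite ler_peMr; lra|lra].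
  have AB : A <= B%:R by rewrite BE ler_peMr; lra.
  apply: (@count_near _ _ (k + B)).
  - by rewrite divr_ge0; lra.
  - by rewrite KE /K natrD addrK.
  - by rewrite natrD; have := ler0n R k; lra.
  - by rewrite natrD natrM; move: kB; rewrite -(ltr_nat R); lra.
pose I m := \sum_(0 <= k < B) (if bad k && K k m then beta k * (4 * `|(wk k).2| / A) else 0).
have I0 m : I m <= 32 * L%:R.
  have [[k1 [k1B bad1 K1]]|no] := pselect (exists k1, [/\ (k1 < B)%N, bad k1 & K k1 m]); last first.
    rewrite /I big_nat big1; first by rewrite mulr_ge0.
    move=> k /andP[_ kB]; case: ifP => // /andP[bk Kk]; exfalso; apply: no.
    by exists k.
  have [_ y1 _ _] := shape _ k1B bad1.
  have y0 : 0 < `|(wk k1).2| by lra.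
  apply: (@le_trans _ _ (\sum_(0 <= k < B) (norm2 (step_map L k (wk k1)))^-1 * (4 * `|(wk k1).2| / A))).
    apply: ler_sum_nat => k /andP[_ kB]; case: ifP => [/andP[bk Kk]|_]; last first.
      by rewrite mulr_ge0 ?invr_ge0 ?norm2_ge0// divr_ge0 ?mulr_ge0// ltW.
    rewrite /beta bk; have [->//|->] := same _ _ _ kB k1B bk bad1 Kk K1.
    by rewrite (area_step L k).2 norm2_opp /= normrN.
  rewrite -mulr_suml -ler_pdivlMr; last by rewrite divr_gt0 ?mulr_gt0.
  apply: le_trans (sum_step_inv L0 _) _; first by rewrite -normr_gt0.
  by rewrite le_eqVlt; apply/orP; left; apply/eqP; rewrite -/A; field; rewrite !gt_eqF.
apply: (@le_trans _ _ (\sum_(0 <= m < 3 * B) I m)); last first.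
  apply: (@le_trans _ _ (\sum_(0 <= m < 3 * B) 32 * L%:R)); first exact: ler_sum.
  rewrite sumr_const_nat subn0 -[_ *+ _]mulr_natr natrM.
  by rewrite le_eqVlt; apply/orP; left; apply/eqP; ring.
rewrite exchange_big_nat//=; apply: ler_sum_nat => k /andP[_ kB].
rewrite {1}/beta; case: ifP => badk; last by rewrite sumr_ge0.
have := ler_wpM2l (beta0 k) (card _ kB badk); rewrite mulr1 {1}/beta badk.
move=> /le_trans; apply; rewrite mulrA mulr_sumr; apply: ler_sum => m _.
by rewrite /=; case: (K k m); rewrite /= ?mulr1 ?mulr0.
Qed.

(** The expansion inequality: on average over the subintervals, the height is
    divided by almost [2 ^ L], unless it was small in the first place. *)
Lemma sum_height_step S L : (0 < L)%N -> unimodular_set S ->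
  \sum_(0 <= k < 2 ^ (2 * L)) height (step_map L k @` S)
    <= 100 * L%:R * ((2 ^ L)%:R * height S + (2 ^ (2 * L))%:R).
Proof.
move=> L0 HS; have [beta [beta0 betaP sbeta]] := sum_step_long L0 HS.
set B := (2 ^ (2 * L))%N in betaP sbeta *; set A : R := (2 ^ L)%:R.
have A0 : 0 < A := pow2_gt0 L; have B0 : 0 < B%:R :> R := pow2_gt0 (2 * L).
have L1 : 1 <= L%:R :> R by rewrite ler1n.
have h1 := height_ge1 HS.
have [tau [tau0 tauP stau]] : exists tau : nat -> R,
  [/\ forall k, 0 <= tau k,
      forall k v, S v -> norm2 v < 1 / 2 -> (norm2 (step_map L k v))^-1 <= tau k &
      \sum_(0 <= k < B) tau k <= 16 * L%:R * (A * height S)].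
  have [[v0 [Sv0 v02]]|no] := pselect (exists v, S v /\ norm2 v < 1 / 2); last first.
    exists (fun=> 0); split=> // [k v Sv v2|]; first by exfalso; apply: no; exists v.
    by rewrite big1// !mulr_ge0 ?ler0n ?(le_trans ler01)// ltW.
  exists (fun k => (norm2 (step_map L k v0))^-1); split=> [k|k v Sv v2|].
  - by rewrite invr_ge0 norm2_ge0.
  - have [|->//|->] := unimodular_short HS Sv0 Sv.
      by have := ltr_pM (norm2_ge0 _) (norm2_ge0 _) v02 v2; lra.
    by rewrite (area_step L k).2 norm2_opp.
  - apply: le_trans (sum_step_inv_norm L0 (HS.1 _ Sv0)) _.
    apply: ler_wpM2l; first by rewrite mulr_ge0 ?ler0n.
    by apply: ler_wpM2l; [exact: ltW|exact: height_ge].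
(* [tau] is for the vectors that are short before the step, [beta] for those that
   become short, and 4 for all the others *)
apply: (@le_trans _ _ (\sum_(0 <= k < B) (4 + tau k + beta k))).
  apply: ler_sum_nat => k /andP[_ kB].
  have t0 := tau0 k; have b0 := beta0 k.
  apply: height_le => [|_ [v Sv <-]]; first by lra.
  have [v2|v2] := ltP (norm2 v) (1 / 2); first by have := tauP k v Sv v2; lra.
  have [fv4|fv4] := ltP (norm2 (step_map L k v)) (1 / 4).
    by have := betaP k v kB Sv v2 fv4; lra.
  have : (norm2 (step_map L k v))^-1 <= 4 by rewrite invf_ple ?posrE//; lra.
  lra.
rewrite !big_split/= sumr_const_nat subn0 -[_ *+ _]mulr_natr.
have : B%:R <= L%:R * B%:R :> R by rewrite ler_peMl// ltW.
have : 0 <= L%:R * (A * height S) by rewrite !mulr_ge0 ?ler0n// ltW// (lt_le_trans ltr01).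
rewrite mulrDr; lra.
Qed.

End PlaneVectors.

(** * Parameters of orbits that stay in the cusp *)

Section CoverCount.
Context {R : realType}.
Variables (n L : nat).
Hypothesis L0 : (0 < L)%N.
Implicit Types (S : 'I_n -> set (R * R)).
Local Notation A := ((2 ^ L)%:R : R).
Local Notation B := ((2 ^ (2 * L))%:R : R).

(** The lattice at time [j], for the initial point moved by [x] along the
    expanding direction. *)
Definition orbit_map (a : R) (j : nat) (x : R) : R * R -> R * R :=
  dilate (a ^+ j) \o shear x.

Lemma orbit_mapS j k (x : R) :
  orbit_map A j.+1 ((k%:R + x) / B) = orbit_map A j x \o step_map L k.
Proof.
have A0 := pow2_gt0 (R := R) L.
have BE : B = A * A by rewrite mul2n -addnn expnD natrM.
apply/funext => v; rewrite /orbit_map /step_map /dilate /shear/= BE.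
have : A ^+ j != 0 by rewrite expf_neq0// gt_eqF.
rewrite exprS; move: (A ^+ j) => aj aj0; move: A0; move: A => a a0.
by congr pair; field; rewrite ?aj0 !gt_eqF.
Qed.

Lemma height_orbit0 (S : set (R * R)) (x : R) : unimodular_set S -> 0 <= x < 1 ->
  height (orbit_map A 0 x @` S) <= 2 * height S.
Proof.
move=> HS /andP[x0 x1]; apply: height_image_le => //; first by lra.
move=> v _; have -> : orbit_map A 0 x v = (v.1 + x * v.2, v.2).
  by rewrite /orbit_map /dilate /= expr0 divr1 mul1r.
rewrite [leLHS]/norm2 ge_max.
set w := norm2 _; have w1 : `|v.1 + x * v.2| <= w by exact: norm2_fst (_, v.2).
have w2 : `|v.2| <= w by exact: norm2_snd (v.1 + x * v.2, _).
apply/andP; split; last by have := normr_ge0 v.2; lra.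
have := lerB_normD v.1 (x * v.2); rewrite normrM (ger0_norm x0).
have := ler_wpM2r (normr_ge0 v.2) (ltW x1); lra.
Qed.

Definition growth : R := (200 * L%:R * B) ^+ n.

Lemma growth_ge0 : 0 <= growth.
Proof. by rewrite exprn_ge0// !mulr_ge0. Qed.

Lemma prod_height_step S : (forall i, unimodular_set (S i)) ->
  \sum_(k : {ffun 'I_n -> 'I_(2 ^ (2 * L))}) \prod_i height (step_map L (k i) @` S i)
   <= growth * \prod_i height (S i).
Proof.
move=> HS; rewrite -(bigA_distr_bigA (fun i (k : 'I_(2 ^ (2 * L))) => height (step_map L k @` S i))).
rewrite /growth -[X in _ ^+ X]card_ord -prodr_const -big_split/=.
apply: ler_prod => i _; have h1 := height_ge1 (HS i); apply/andP; split.
  by apply: sumr_ge0 => k _; apply: le_trans (height_ge1 (unimodular_image (area_step _ _) (HS i))).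
rewrite -(big_mkord xpredT (fun k => height (step_map L k @` S i))).
apply: le_trans (sum_height_step L0 (HS i)) _.
have A0 : 0 < A := pow2_gt0 L.
have A1 : 1 <= A by rewrite ler1n expn_gt0.
have BE : B = A * A by rewrite mul2n -addnn expnD natrM.
have AB : A * height (S i) <= B * height (S i) by rewrite ler_wpM2r ?BE ?ler_peMl; lra.
have : B <= B * height (S i) by rewrite ler_peMr.
move: AB; move: B => b; move: (A * _) => c cb bh.
rewrite (_ : 200 * _ * _ * _ = 100 * L%:R * (b * height (S i) + b * height (S i))); last by ring.
by rewrite ler_wpM2l ?mulr_ge0 ?lerD.
Qed.

(** A step from a point high in the cusp in one coordinate is cheaper by a
    factor [2 ^ L]. *)
Lemma prod_height_step_high S : (forall i, unimodular_set (S i)) ->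
  (exists i, A <= height (S i)) ->
  \sum_(k : {ffun 'I_n -> 'I_(2 ^ (2 * L))}) \prod_i height (step_map L (k i) @` S i)
   <= growth / A * \prod_i height (S i).
Proof.
move=> HS [i0 hi0]; rewrite -(bigA_distr_bigA (fun i (k : 'I_(2 ^ (2 * L))) => height (step_map L k @` S i))).
have A0 : 0 < A := pow2_gt0 L.
have A1 : 1 <= A by rewrite ler1n expn_gt0.
have BE : B = A * A by rewrite mul2n -addnn expnD natrM.
pose c i : R := if i == i0 then A^-1 else 1.
have -> : growth / A * \prod_i height (S i) =
    \prod_i (200 * L%:R * B * c i * height (S i)).
  rewrite big_split/= big_split/= prodr_const card_ord; congr (_ * _ * _).
  by rewrite (bigD1 i0)//= big1 ?mulr1 /c ?eqxx// => i /negbTE ->.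
apply: ler_prod => i _; have h1 := height_ge1 (HS i); apply/andP; split.
  by apply: sumr_ge0 => k _; apply: le_trans (height_ge1 (unimodular_image (area_step _ _) (HS i))).
rewrite -(big_mkord xpredT (fun k => height (step_map L k @` S i))).
apply: le_trans (sum_height_step L0 (HS i)) _.
rewrite (_ : 200 * _ * _ * _ * _ = 100 * L%:R * (B * c i * height (S i) + B * c i * height (S i))); last by ring.
rewrite ler_wpM2l ?mulr_ge0// lerD//.
  rewrite ler_wpM2r ?(le_trans ler01)// /c BE; case: ifP => _.
    by rewrite mulfK ?gt_eqF.
  by rewrite mulr1 ler_peMr; lra.
rewrite /c BE; case: ifPn => [/eqP ->|_].
  by rewrite mulfK ?gt_eqF// ler_wpM2l// ltW.
by rewrite mulr1 ler_peMr ?mulr_ge0// ltW.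
Qed.

(** The set of parameters whose orbit is high in the cusp at all times between
    [N0] and [N] is covered by few boxes: every step multiplies the sum over the
    surviving boxes of the products of heights by [growth] at most, and by
    [growth / A] once an orbit has to be high. As heights are at least 1, this
    bounds the number of boxes. *)
Lemma cover_count N0 N S : (forall i, unimodular_set (S i)) ->
  exists l : seq {ffun 'I_n -> R},
    (size l)%:R <= growth ^+ (minn N0 N) * (growth / A) ^+ (N - N0) * \prod_i height (S i) /\
    forall s : 'I_n -> R, (forall i, 0 <= s i < 1) ->
      (forall j, (N0 <= j < N)%N ->
         exists i, 2 * A <= height (orbit_map A j (s i) @` S i)) ->
      exists2 c, c \in l & forall i, c i <= s i <= c i + B ^- N.
Proof.
have A0 : 0 < A := pow2_gt0 L; have B0 : 0 < B := pow2_gt0 (2 * L).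
have p0 m p : 0 <= growth ^+ m * (growth / A) ^+ p.
  have g0 := growth_ge0; have gA0 : 0 <= growth / A by rewrite divr_ge0.
  by rewrite mulr_ge0// exprn_ge0.
elim: N N0 S => [|N IH] N0 S HS.
  exists [:: [ffun=> 0]]; split.
    rewrite minn0 sub0n !expr0 !mul1r/=.
    by apply: (big_ind (fun x : R => 1 <= x)) => // [x y x1 y1|i _]; [exact: mulr_ege1|exact: height_ge1].
  move=> s s01 _; exists [ffun=> 0]; first by rewrite inE.
  by move=> i; rewrite ffunE; have := s01 i; rewrite expr0 invr1 add0r; lra.
pose good (s : 'I_n -> R) := (forall i, 0 <= s i < 1) /\ 
      (forall j, (N0 <= j < N.+1)%N ->
         exists i, 2 * A <= height (orbit_map A j (s i) @` S i)).
have [[s0 s0P]|no] := pselect (exists s, good s); last first.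
  exists [::]; split; last by move=> s s01 sh; exfalso; apply: no; exists s.
  apply: mulr_ge0 => //; by apply: prodr_ge0 => i _; apply: le_trans (height_ge1 (HS i)).
have HSk (k : {ffun 'I_n -> 'I_(2 ^ (2 * L))}) i : unimodular_set (step_map L (k i) @` S i).
  by apply: unimodular_image (area_step _ _) (HS i).
have [lk lkP] := boolp.choice (fun k => IH N0.-1 _ (HSk k)).
pose glue (k : {ffun 'I_n -> 'I_(2 ^ (2 * L))}) (c : {ffun 'I_n -> R}) : {ffun 'I_n -> R} :=
  [ffun i => ((k i)%:R + c i) / B].
exists (flatten [seq map (glue k) (lk k) | k <- enum {ffun 'I_n -> 'I_(2 ^ (2 * L))}]).
split.
  rewrite size_flatten /shape -map_comp sumnE big_map big_enum/= natr_sum.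
  under eq_bigr do rewrite size_map.
  apply: (@le_trans _ _ (\sum_(k : {ffun 'I_n -> 'I_(2 ^ (2 * L))}) growth ^+ (minn N0.-1 N) * (growth / A) ^+ (N - N0.-1) * \prod_i height (step_map L (k i) @` S i))).
    by apply: ler_sum => k _; exact: (lkP k).1.
  rewrite -mulr_sumr.
  rewrite /good {good} in s0P; case: N0 {IH lkP} s0P => [|N0] s0P /=.
    have hi : exists i, A <= height (S i).
      have [|i hi] := s0P.2 0%N; first by [].
      by exists i; have := height_orbit0 (HS i) (s0P.1 i); lra.
    apply: le_trans (ler_wpM2l (p0 _ _) (prod_height_step_high HS hi)) _.
    by rewrite !min0n !subn0 !expr0 !mul1r mulrA exprSr.
  apply: le_trans (ler_wpM2l (p0 _ _) (prod_height_step HS)) _.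
  by rewrite minnSS subSS exprSr mulrA [X in X * _ <= _]mulrAC lexx.
move=> s s01 sh.
have kP i : (Num.truncn (B * s i) < 2 ^ (2 * L))%N.
  have /andP[si0 si1] := s01 i.
  by rewrite truncn_lt_nat ?mulr_ge0// gtr_pMr.
pose k : {ffun 'I_n -> 'I_(2 ^ (2 * L))} := [ffun i => Ordinal (kP i)].
pose s' i := B * s i - (k i)%:R.
have sE i : s i = ((k i)%:R + s' i) / B by rewrite /s' addrC subrK mulrC mulKf ?gt_eqF.
have s'01 i : 0 <= s' i < 1.
  have /andP[si0 si1] := s01 i.
  have /andP[] : ((k i)%:R <= B * s i < (k i).+1%:R) by rewrite ffunE/= truncn_itv ?mulr_ge0.
  by rewrite /s' -natr1; lra.
have [|c cl cP] := (lkP k).2 s' s'01.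
  move=> j /andP[N0j jN]; have [|i hi] := sh j.+1; first by rewrite ltnS jN andbT; lia.
  by exists i; move: hi; rewrite {1}sE orbit_mapS image_comp.
exists (glue k c).
  by apply/flatten_mapP; exists k; [rewrite mem_enum|apply: map_f].
move=> i; rewrite ffunE sE exprSr invfM.
have /andP[c1 c2] := cP i; rewrite -mulrDl !ler_pM2r ?invr_gt0//.
by rewrite lerD2l c1 -addrA lerD2l c2.
Qed.
End CoverCount.

(** * Fractions close to a given fraction *)

Section CoprimePairs.
Local Open Scope nat_scope.

Lemma sum_dvdn g N : 0 < g -> \sum_(0 <= a < N) (g %| a) = (N + g.-1) %/ g.
Proof.
move=> g0; elim: N => [|N IH]; first by rewrite big_nil divn_small//; lia.
rewrite big_nat_recr//= IH addSn divnS// addnC; congr addn.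
by rewrite -addnS prednK// dvdn_addl.
Qed.

Lemma sum_dvdn_dyadic g W : 0 < g -> g * \sum_(W <= a < 2 * W) (g %| a) <= W + g.
Proof.
move=> g0; have := sum_dvdn (2 * W) g0; have := sum_dvdn W g0.
rewrite [in X in _ -> X](@big_cat_nat _ _ _ W)//=; last by lia.
move=> -> H; have := leq_trunc_div (2 * W + g.-1) g.
rewrite -H mulnDl [_ * g]mulnC => le1.
by have := ltn_ceil (W + g.-1) g0; rewrite mulnC; lia.
Qed.

Lemma sum_dvdn_initial g N : 0 < g -> g * \sum_(1 <= b < N.+1) (g %| b) <= N.
Proof.
move=> g0; have := sum_dvdn N.+1 g0; rewrite big_ltn//= dvdn0 => H.
by have := leq_trunc_div (N.+1 + g.-1) g; rewrite -H mulnDl; lia.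
Qed.

End CoprimePairs.

(* sum 1/g^2 over g >= 2 is at most 2/3 by telescoping 1/(g-1/2) - 1/(g+1/2) *)
Lemma sum_inv_sqr (R : realFieldType) N :
  \sum_(2 <= g < N) (g%:R ^- 2) <= 2 / 3 :> R.
Proof.
suff H : forall m, \sum_(2 <= g < m + 2) (g%:R ^- 2) <= 2 / 3 - (m%:R + 3 / 2)^-1 :> R.
  have [N2|N2] := leqP N 2; first by rewrite big_geq//; lra.
  rewrite -(subnK (ltnW N2)); apply: le_trans (H _) _.
  by rewrite gerBl invr_ge0; have := ler0n R (N - 2); lra.
elim=> [|m IH]; first by rewrite big_geq// mulr0n add0r invf_div subrr.
rewrite addSn big_nat_recr/=; last by lia.
apply: le_trans (lerD IH (lexx _)) _.
rewrite natrD -[m.+1%:R]natr1; move: (m%:R) (ler0n R m) => x x0.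
rewrite -subr_ge0 (_ : _ - _ = ((2 * x + 3) * (2 * x + 5) * (x + 2) ^+ 2)^-1); last first.
  field; rewrite !gt_eqF//; lra.
by rewrite invr_ge0 !mulr_ge0 ?sqr_ge0//; lra.
Qed.

(** At least a quarter of the pairs in a flat box are coprime: the pairs with a
    common divisor [g >= 2] are about [1 / g ^ 2] of all. *)
Lemma count_coprime W N : (8 * N <= W)%N ->
  (W * N <= 4 * \sum_(W <= a < 2 * W) \sum_(1 <= b < N.+1) coprime a b)%N.
Proof.
move=> NW; pose F a b g := ((g %| a) * (g %| b))%N.
have pair a b : (W <= a < 2 * W)%N -> (1 <= b < N.+1)%N ->
    (1 <= coprime a b + \sum_(2 <= g < N.+1) F a b g)%N.
  move=> aW bN; have [_|cop] := boolP (coprime a b); first by [].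
  have g0 : (0 < gcdn a b)%N by rewrite gcdn_gt0; lia.
  have gb : (gcdn a b <= b)%N by apply: dvdn_leq; [lia|exact: dvdn_gcdr].
  rewrite (@big_cat_nat _ _ _ (gcdn a b))//=; [|by move: cop; rewrite /coprime; lia|by lia].
  rewrite [X in (_ + (_ + X))%N]big_ltn; last by lia.
  by rewrite /F dvdn_gcdl dvdn_gcdr /=; lia.
have tot : (W * N <= \sum_(W <= a < 2 * W) \sum_(1 <= b < N.+1) coprime a b +
    \sum_(2 <= g < N.+1) (\sum_(W <= a < 2 * W) (g %| a)) * (\sum_(1 <= b < N.+1) (g %| b)))%N.
  have -> : (\sum_(2 <= g < N.+1) (\sum_(W <= a < 2 * W) (g %| a)) * (\sum_(1 <= b < N.+1) (g %| b)) =
      \sum_(W <= a < 2 * W) \sum_(1 <= b < N.+1) \sum_(2 <= g < N.+1) F a b g)%N.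
    under [RHS]eq_bigr do rewrite exchange_big/=.
    rewrite [RHS]exchange_big/=; apply: eq_bigr => g _.
    rewrite big_distrl/=; apply: eq_bigr => a _.
    by rewrite big_distrr.
  rewrite -big_split/=; under eq_bigr do rewrite -big_split/=.
  apply: (@leq_trans (\sum_(W <= a < 2 * W) \sum_(1 <= b < N.+1) 1)).
    by rewrite !sum_nat_const_nat muln1; lia.
  rewrite [leqLHS]big_nat [leqRHS]big_nat; apply: leq_sum => a aW.
  by rewrite [leqLHS]big_nat [leqRHS]big_nat; apply: leq_sum => b bN; exact: pair.
have divisor g : (2 <= g < N.+1)%N -> ((\sum_(W <= a < 2 * W) (g %| a)) * (\sum_(1 <= b < N.+1) (g %| b)))%N%:R
    <= 9 / 8 * (W%:R * N%:R) * g%:R ^- 2 :> rat.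
  move=> gN; have g0 : (0 < g)%N by lia.
  have := sum_dvdn_dyadic W g0; have := sum_dvdn_initial N g0.
  set x := (\sum_(W <= _ < _) _)%N; set y := (\sum_(1 <= _ < _) _)%N => gy gx.
  have gR : 0 < g%:R :> rat by rewrite ltr0n.
  rewrite ler_pdivlMr ?exprn_gt0//.
  have : (x * y * (g * g) * 8 <= 9 * (W * N))%N.
    rewrite (_ : x * y * (g * g) * 8 = 8 * (g * x) * (g * y))%N; last by ring.
    have gx8 : (8 * (g * x) <= 9 * W)%N by lia.
    by apply: leq_trans (leq_mul gx8 gy) _; rewrite mulnA.
  by rewrite -(ler_nat rat) !natrM; lra.
have : (\sum_(2 <= g < N.+1) (\sum_(W <= a < 2 * W) (g %| a)) * (\sum_(1 <= b < N.+1) (g %| b)))%N%:R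
    <= 3 / 4 * (W%:R * N%:R) :> rat.
  rewrite natr_sum; apply: le_trans (ler_sum_nat (fun g gN => divisor g gN)) _.
  rewrite -mulr_sumr; have := sum_inv_sqr rat N.+1.
  have : 0 <= W%:R * N%:R :> rat by rewrite mulr_ge0.
  move: (\sum_(_ <= _ < _) _) (W%:R * N%:R) => s p p0 s1; nra.
move: tot; set c := (\sum_(W <= a < 2 * W) _)%N; set d := (\sum_(2 <= g < N.+1) _)%N.
by move=> tot; rewrite -(ler_nat rat) natrM; move: tot; rewrite -(ler_nat rat) natrD !natrM; lra.
Qed.

Section Children.
Context {R : realType}.
Local Notation frac v := (v.1%:R / v.2%:R : R).

(** The fractions next to [p / q] with denominators up to [2 ^ e'] are
    [(a p + b p0) / (a q + b q0)] for coprime [a], [b], where [p0 / q0] is a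
    neighbour of [p / q]; such a fraction is at distance [b / (q q')], and the
    bounds on [a] and [b] control the distance and the denominator. *)
Lemma many_fractions (p q e f e' : nat) : coprime p q -> (0 < p)%N ->
  (2 ^ e <= 8 * q)%N -> (q <= 2 ^ e)%N -> (e <= f)%N -> (f + 7 <= e')%N ->
  exists l : seq (nat * nat),
  [/\ size l = (2 ^ (2 * e' - e - f - 12))%N,
      uniq [seq frac v | v <- l] &
      forall v, v \in l -> [/\ (0 < v.1)%N, coprime v.1 v.2,
        (2 ^ e' <= 8 * v.2)%N /\ (v.2 <= 2 ^ e')%N &
        p%:R / q%:R <= frac v <= p%:R / q%:R + (2 ^ (e + f + 1))%:R^-1]].
Proof.
move=> cpq p0 eq qe ef fe'.
have E0 m : (0 < 2 ^ m)%N by rewrite expn_gt0.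
have q0 : (0 < q)%N by have := E0 e; lia.
have [p1 q1 bez q1q] := egcdnP p q0.
move: bez q1q; rewrite gcdnC (eqP cpq) muln1 => bez q1q.
set Z := (2 ^ e')%N; pose W := (Z %/ (4 * q))%N; pose N := (2 ^ (e' - f - 7))%N.
have eZ : (8 * 2 ^ e <= Z)%N by rewrite -(expnD 2 3) leq_exp2l//; lia.
have W0 : (0 < W)%N by rewrite divn_gt0; lia.
have WZ : (4 * W * q <= Z)%N by have := leq_trunc_div Z (4 * q); rewrite -/W; lia.
have ZW : (Z <= 8 * W * q)%N.
  have : (Z < W.+1 * (4 * q))%N by apply: ltn_ceil; lia.
  by rewrite mulSn; nia.
have NW : (8 * N <= W)%N.
  have h : (64 * 2 ^ e * N <= Z)%N.
    by rewrite -(expnD 2 6) -expnD leq_exp2l//; lia.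
  have : (8 * N * (8 * 2 ^ e) <= W * (8 * 2 ^ e))%N.
    apply: (@leq_trans (8 * W * q)); first by lia.
    by rewrite mulnCA -mulnA leq_mul2l leq_mul2l qe orbT.
  by rewrite leq_pmul2r//; have := E0 e; lia.
have cnt := count_coprime NW.
pose pairs := [seq v <- [seq (a, b) | a <- index_iota W (2 * W), b <- index_iota 1 N.+1] | coprime v.1 v.2].
have pairsP (v : nat * nat) : v \in pairs -> [/\ coprime v.1 v.2, (W <= v.1 < 2 * W)%N & (1 <= v.2 <= N)%N].
  by rewrite mem_filter => /andP[cv /allpairsP[[a b] [/= + + vE]]]; subst v; rewrite !mem_index_iota.
have upairs : uniq pairs.
  by rewrite filter_uniq// allpairs_uniq ?iota_uniq// => -[a b] [c d].
have spairs : (2 ^ (2 * e' - e - f - 12) <= size pairs)%N.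
  have -> : size pairs = (\sum_(W <= a < 2 * W) \sum_(1 <= b < N.+1) coprime a b)%N.
    rewrite size_filter -sum1_count big_mkcond/= big_allpairs/=.
    by apply: eq_bigr => a _; apply: eq_bigr => b _; case: (coprime a b).
  rewrite -(leq_pmul2l (isT : 0 < 4)%N); apply: leq_trans cnt.
  rewrite -(leq_pmul2r (E0 (e + 3)%N)).
  apply: (@leq_trans (Z * N)).
    by rewrite -(expnD 2 2) -!expnD leq_exp2l//; lia.
  rewrite -mulnA [(N * _)%N]mulnC mulnA leq_mul2r; apply/orP; right.
  apply: leq_trans ZW _; rewrite -mulnA [leqRHS]mulnC expnD mulnC.
  by have := qe; nia.
have NZ : (64 * (2 ^ (e + f + 1) * N) <= 2 ^ e * Z)%N.
  by rewrite mulnA -(expnD 2 6) -!expnD leq_exp2l//; lia.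
clearbody W N Z pairs.
pose child (v : nat * nat) := (v.1 * p + v.2 * p1, v.1 * q + v.2 * q1)%N.
have q'W (v : nat * nat) : v \in pairs -> (W * q <= (child v).2 <= Z)%N.
  move=> /pairsP[_ /andP[a1 a2] /andP[b1 b2]] /=.
  apply/andP; split; first by apply: leq_trans (leq_addr _ _); rewrite leq_mul2r a1 orbT.
  apply: leq_trans WZ; apply: (@leq_trans (2 * W * q + W * q)); last by nia.
  apply: leq_add; first by rewrite leq_mul2r ltnW ?orbT.
  by apply: leq_mul; [lia|exact: ltnW].
have q'0 (v : nat * nat) : v \in pairs -> (0 < (child v).2)%N.
  by move=> /q'W/andP[+ _]; apply: leq_trans; rewrite muln_gt0 W0.
have diff (v : nat * nat) : v \in pairs -> frac (child v) - p%:R / q%:R = v.2%:R / (q%:R * (child v).2%:R).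
  move=> vp; have := q'0 _ vp.
  have qR : q%:R != 0 :> R by rewrite pnatr_eq0 -lt0n.
  rewrite lt0n -(pnatr_eq0 R) => cR.
  rewrite (_ : _ - _ = ((child v).1%:R * q%:R - p%:R * (child v).2%:R) / (q%:R * (child v).2%:R)); last first.
    by field; rewrite qR cR.
  congr (_ / _); apply/eqP; rewrite subr_eq -!natrM -natrD eqr_nat; apply/eqP => /=.
  have : (p1 * q = q1 * p + 1)%N by [].
  nia.
have inj : {in pairs &, injective (fun v => frac (child v))}.
  move=> v w vp wp /= vw; have := diff _ vp; rewrite vw (diff _ wp).
  have [cv _ /andP[bv _]] := pairsP _ vp; have [cw _ /andP[bw _]] := pairsP _ wp.
  have qR : q%:R != 0 :> R by rewrite pnatr_eq0 -lt0n.
  move=> /eqP; rewrite eqr_div ?mulf_neq0//; try by rewrite pnatr_eq0 -lt0n q'0.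
  rewrite -!natrM eqr_nat => /eqP E.
  have {}E : (w.2 * v.1 = v.2 * w.1)%N.
    have : (q * (w.2 * (child v).2) = q * (v.2 * (child w).2))%N.
      by rewrite mulnCA E mulnCA.
    move=> /eqP; rewrite eqn_pmul2l// => /eqP /=; rewrite !mulnDr !mulnA [(v.2 * w.2)%N]mulnC.
    by move=> /addIn/eqP; rewrite eqn_pmul2r// => /eqP.
  have d1 : (v.1 %| w.1)%N.
    by rewrite -(Gauss_dvdr _ cv) -E dvdn_mull.
  have d2 : (w.1 %| v.1)%N.
    by rewrite -(Gauss_dvdr _ cw) E dvdn_mull.
  have e1 : v.1 = w.1 by apply/eqP; rewrite eqn_dvd d1 d2.
  have v10 : (0 < v.1)%N by have [_ /andP[a1 _] _] := pairsP _ vp; exact: leq_trans a1.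
  move: E; rewrite e1 => /eqP; rewrite eqn_pmul2r -?e1// => /eqP e2.
  by rewrite [v]surjective_pairing [w]surjective_pairing e1 e2.
exists (map child (take (2 ^ (2 * e' - e - f - 12)) pairs)); split.
- by rewrite size_map size_takel.
- rewrite -map_comp map_inj_in_uniq ?take_uniq// => v w /mem_take vp /mem_take wp.
  exact: inj.
move=> _ /mapP[v /mem_take vp ->]; have [cv /andP[a1 a2] /andP[b1 b2]] := pairsP _ vp.
have /andP[c1 c2] := q'W _ vp; have c0 := q'0 _ vp.
have c8 : (Z <= 8 * (child v).2)%N by apply: leq_trans ZW _; rewrite -mulnA leq_mul2l c1 orbT.
split.
- by rewrite /= addn_gt0 muln_gt0 p0 (leq_trans W0 a1).
- rewrite /coprime eqn_leq gcdn_gt0 c0 orbT andbT; apply: dvdn_leq => //.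
  rewrite -(eqP cv) dvdn_gcd; set g := gcdn _ _.
  have gp : (g %| (child v).1)%N by exact: dvdn_gcdl.
  have gq : (g %| (child v).2)%N by exact: dvdn_gcdr.
  have -> : (g %| v.1)%N.
    rewrite -(dvdn_addr v.1 (dvdn_mull q1 gp)).
    rewrite (_ : _ + _ = p1 * (child v).2)%N ?dvdn_mull//=.
    by rewrite [RHS]mulnDr [(p1 * (_ * q))%N]mulnCA bez; ring.
  rewrite -(dvdn_addr v.2 (dvdn_mull p gq)).
  rewrite (_ : _ + _ = q * (child v).1)%N ?dvdn_mull//=.
  by rewrite [RHS]mulnC mulnDl -[(_ * p1 * q)%N]mulnA bez; ring.
- by split.
have qR : 0 < q%:R :> R by rewrite ltr0n.
have cR : 0 < (child v).2%:R :> R by rewrite ltr0n.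
rewrite -subr_ge0 diff// divr_ge0 ?mulr_ge0//= -lerBlDl diff//.
rewrite ler_pdivrMr ?mulr_gt0// ler_pdivlMl ?ltr0n// -!natrM ler_nat.
apply: (@leq_trans (2 ^ (e + f + 1) * N)); first by rewrite leq_mul2l b2 orbT.
have : (64 * (2 ^ (e + f + 1) * N) <= 64 * (q * (child v).2))%N.
  apply: leq_trans NZ _.
  rewrite (_ : 64 * _ = 8 * q * (8 * (child v).2))%N; last by ring.
  exact: leq_mul.
by rewrite leq_pmul2l.
Qed.

End Children.

(** * Cantor sets of approximable numbers *)

Section CantorSet.
Context {R : realType}.
Local Notation frac v := (v.1%:R / v.2%:R : R).
Local Notation dyad m := ((2 ^ m)%:R^-1 : R).

Lemma dyad_gt0 m : 0 < dyad m. Proof. by rewrite invr_gt0 ltr0n expn_gt0. Qed.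

Lemma dyad_le m m' : (m <= m')%N -> dyad m' <= dyad m.
Proof. by move=> mm; rewrite lef_pV2 ?posrE ?ltr0n ?expn_gt0// ler_nat leq_exp2l. Qed.

Lemma dyadD m m' : dyad (m + m') = dyad m * dyad m'.
Proof. by rewrite expnD natrM invfM. Qed.

Lemma size_separated (l : seq R) (a lambda sigma : R) : 0 < sigma -> uniq l ->
  {in l &, forall v w, v != w -> sigma <= `|v - w|} ->
  {in l, forall v, a <= v <= a + lambda} -> (size l)%:R <= Num.max 0 lambda / sigma + 1.
Proof.
move=> s0 ul sep la.
pose h (v : R) := Num.truncn ((v - a) / sigma).
have q0 v : v \in l -> 0 <= (v - a) / sigma.
  by move=> /la/andP[av _]; rewrite divr_ge0 ?subr_ge0// ltW.
have injh : {in l &, injective h}.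
  move=> v w vl wl hvw; apply/eqP/negPn/negP => /(sep _ _ vl wl).
  have /andP[h1 h2] := truncn_itv (q0 _ vl).
  have /andP[] := truncn_itv (q0 _ wl); rewrite -/(h w) -hvw => h3 h4.
  rewrite leNgt => /negP; apply; rewrite -/(h v) in h1 h2.
  rewrite ltr_norml -(ltr_pM2r (x := sigma^-1)) ?invr_gt0// -[X in _ && X](ltr_pM2r (x := sigma^-1)) ?invr_gt0//.
  rewrite mulNr divff ?gt_eqF// -natr1 in h2 h4 *.
  by rewrite (_ : (v - w) / sigma = (v - a) / sigma - (w - a) / sigma) -?mulrBl; [lra|congr (_ * _); ring].
set K : R := Num.max 0 lambda / sigma.
have sz : (size (map h l) <= size (iota 0 (Num.truncn K).+1))%N.
  apply: uniq_leq_size; first by rewrite map_inj_in_uniq.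
  move=> _ /mapP[v vl ->]; rewrite mem_iota/= add0n ltnS; apply: le_truncn.
  rewrite ler_pM2r ?invr_gt0// le_max; have /andP[_] := la _ vl.
  by rewrite -lerBlDl => ->; rewrite orbT.
move: sz; rewrite size_map size_iota -(ler_nat R) => /le_trans; apply.
rewrite -natr1 lerD2r; have : 0 <= K by rewrite divr_ge0 ?le_max ?lexx// ltW.
by move=> /truncn_itv/andP[].
Qed.

Lemma frac_separated (v w : nat * nat) m : (0 < v.2 <= 2 ^ m)%N -> (0 < w.2 <= 2 ^ m)%N ->
  frac v != frac w -> dyad (2 * m) <= `|frac v - frac w|.
Proof.
move=> vP wP; wlog : v w vP wP / frac v < frac w => [H|vw _].
  move=> ne; have [lt|gt|eq] := ltgtP (frac v) (frac w).
  - exact: H ne.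
  - by rewrite distrC; apply: H => //; rewrite lt_eqF.
  - by rewrite eq eqxx in ne.
case/andP: vP wP => v0 vm /andP[w0 wm].
have vR : 0 < v.2%:R :> R by rewrite ltr0n.
have wR : 0 < w.2%:R :> R by rewrite ltr0n.
rewrite distrC; apply: le_trans (ler_norm _).
rewrite (_ : _ - _ = (w.1%:R * v.2%:R - v.1%:R * w.2%:R) / (v.2%:R * w.2%:R)); last first.
  by field; rewrite !gt_eqF.
move: vw; rewrite ltr_pdivrMr// mulrAC ltr_pdivlMr// -!natrM ltr_nat => vw.
rewrite -(natrB _ (ltnW vw)) -[leLHS]mul1r; apply: ler_pM => //.
  by rewrite ler1n subn_gt0.
rewrite lef_pV2 ?posrE ?ltr0n ?muln_gt0 ?expn_gt0 ?v0// ler_nat.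
by rewrite mul2n -addnn expnD leq_mul.
Qed.

(* counts the children of a node whose descendants can meet an interval of
   length [r]: there are [m] children, separated by [sigma] *)
Lemma children_count (h m r sigma D s : R) : 0 <= s <= 1 -> 0 < m -> 0 < sigma ->
  0 < r -> 0 <= D -> 1 <= D * (m * sigma) `^ s -> h <= m -> h <= 3 * r / sigma ->
  h <= 3 * (m * D) * r `^ s.
Proof.
move=> /andP[s0 s1] m0 sg0 r0 D0 Dm hm hr.
have X0 : 0 < m * sigma by rewrite mulr_gt0.
have DX t : 0 <= t -> t <= t * (D * (m * sigma) `^ s) by move=> t0; rewrite ler_peMr.
have [Xr|rX] := leP (m * sigma) r.
  have le1 : m * (D * (m * sigma) `^ s) <= m * (D * r `^ s).
    by rewrite !ler_wpM2l ?(ltW m0)// ge0_ler_powR// ?nnegrE ltW.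
  have le2 := le_trans (DX _ (ltW m0)) le1.
  rewrite (_ : 3 * _ * _ = 3 * (m * (D * r `^ s))); last by ring.
  by apply: le_trans hm (le_trans le2 _); rewrite ler_peMl//; [exact: le_trans (ltW m0) le2|lra].
set t := r / (m * sigma).
have t01 : 0 < t <= 1 by rewrite divr_gt0//= ler_pdivrMr// mul1r ltW.
have -> : r = t * (m * sigma) by rewrite divfK ?gt_eqF.
have t0 : 0 <= t by case/andP: t01 => /ltW.
apply: le_trans hr _; rewrite {1}(_ : r = t * (m * sigma)); last by rewrite divfK ?gt_eqF.
rewrite (_ : 3 * _ / _ = 3 * m * t); last by field; rewrite gt_eqF.
rewrite powRM ?(ltW X0)// (_ : 3 * (m * D) * _ = 3 * m * (t `^ s * (D * (m * sigma) `^ s))); last by ring.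
rewrite ler_wpM2l ?mulr_ge0 ?(ltW m0)//; apply: le_trans (DX _ (powR_ge0 _ _)).
exact: ger1_powR.
Qed.

Section Tree.
Variables e f : nat -> nat.
Hypothesis ef : forall k, (e k < f k)%N.
Hypothesis fe : forall k, (f k + 7 <= e k.+1)%N.

(** [v] has a rational approximation that puts its lattice in the cusp during
    the [k]-th time window. *)
Definition approximable k (v : R) : Prop :=
  exists p q : nat, [/\ (0 < q)%N, (q <= 2 ^ e k)%N &
    `|q%:R * v - p%:R| <= (2 ^ f k)%:R^-1].

(* 2 ^ branching k is the number of children of a node of level k *)
Definition branching k := (2 * e k.+1 - e k - f k - 12)%N.

Definition node k (p q : nat) :=
  [/\ (0 < p)%N, coprime p q, (2 ^ e k <= 8 * q)%N & (q <= 2 ^ e k)%N].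

Lemma e_mono k j : (k <= j)%N -> (e k <= e j)%N.
Proof.
elim: j => [|j IH]; first by rewrite leqn0 => /eqP->.
rewrite leq_eqVlt => /orP[/eqP->//|/IH]; have := ef j; have := fe j; lia.
Qed.

Variables (s C : R).
Hypothesis s01 : 0 <= s <= 1.
Hypothesis C0 : 0 <= C.
Hypothesis numeric : forall k,
  2 ^+ k <= C * (2 ^ \sum_(0 <= j < k) branching j)%:R * dyad (e k + f k + 12) `^ s.

(** Points below a node of level [k], one for each chain of [d] generations of
    children. An interval shorter than the separation of the children meets at
    most two of them; a longer one is estimated by the number of children that it
    meets. The factor [2 ^ k] in [numeric] pays for the factor 2 lost at each level
    where an interval meets the offspring of two children. *)
Lemma cantor_tree d k p q : node k p q ->
  exists l : seq R,
  [/\ size l = (2 ^ \sum_(k <= j < k + d) branching j)%N,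
      forall v, v \in l -> p%:R / q%:R <= v <= p%:R / q%:R + dyad (e k + f k) /\
        forall j, (k <= j)%N -> approximable j v &
      forall lo r, dyad (2 * e (k + d)) <= r ->
        (count (fun v => lo <= v <= lo + r) l)%:R <=
        3 * C * 2 ^- k * (2 ^ \sum_(0 <= j < k + d) branching j)%:R * r `^ s].
Proof.
have dk m : 0 <= dyad m by exact: ltW (dyad_gt0 _).
have two0 k' : 0 < 2 ^+ k' :> R by rewrite exprn_gt0.
have T0 m : 0 < (2 ^ m)%:R :> R by rewrite ltr0n expn_gt0.
have [s0 s1] := andP s01.
elim: d k p q => [|d IH] k p q [p0 cpq eq qe].
  have q0 : (0 < q)%N by move: eq; case: (q) => //; rewrite muln0 leqn0 expn_eq0.
  exists [:: p%:R / q%:R]; split => [|v|lo r]; rewrite ?addn0.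
  - by rewrite big_geq.
  - rewrite inE => /eqP->; rewrite lexx lerDl dk; split=> // j kj.
    exists p, q; split=> //; first by rewrite (leq_trans qe)// leq_exp2l// e_mono.
    by rewrite mulrC divfK ?subrr ?normr0// pnatr_eq0 -lt0n.
  - move=> er; apply: (@le_trans _ _ 1); first by rewrite lern1 /=; case: (_ && _).
    have le_dyad : dyad (e k + f k + 12) <= r.
      by apply: le_trans er; apply: dyad_le; have := ef k; lia.
    have := ge0_ler_powR s0 _ _ le_dyad; rewrite !nnegrE => /(_ (dk _) (le_trans (dk _) le_dyad)).
    have CT : 0 <= C * (2 ^ \sum_(0 <= j < k) branching j)%:R by rewrite mulr_ge0.
    move=> /(ler_wpM2l CT)/(le_trans (numeric k)).
    rewrite -[X in X <= _]mulr1 -ler_pdivlMl ?two0//.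
    rewrite (_ : 3 * _ * _ * _ * _ = 3 * (2 ^- k *
      (C * (2 ^ \sum_(0 <= j < k) branching j)%:R * r `^ s))); last by ring.
    by lra.
have [lc [szc uc lcP]] :=
  @many_fractions R _ _ _ _ _ cpq p0 eq qe (ltnW (ef k)) (fe k).
have nodec c : c \in lc -> node k.+1 c.1 c.2.
  by move=> /lcP[c0 cc [ce ec] _]; split.
have /boolp.choice[sub subP] : forall c : nat * nat, exists l : seq R, c \in lc -> 
    [/\ size l = (2 ^ \sum_(k.+1 <= j < k.+1 + d) branching j)%N,
      forall v, v \in l -> frac c <= v <= frac c + dyad (e k.+1 + f k.+1) /\
        forall j, (k.+1 <= j)%N -> approximable j v &
      forall lo r, dyad (2 * e (k.+1 + d)) <= r ->
        (count (fun v => lo <= v <= lo + r) l)%:R <=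
        3 * C * 2 ^- k.+1 * (2 ^ \sum_(0 <= j < k.+1 + d) branching j)%:R * r `^ s].
  move=> c; have [cl|_] := boolP (c \in lc); last by exists [::].
  by have [l lP] := IH _ _ _ (nodec c cl); exists l.
set M := (2 ^ \sum_(k.+1 <= j < k.+1 + d) branching j)%N in subP.
set lam := dyad (e k.+1 + f k.+1) in subP.
have lam_le : lam <= dyad (e k + f k + 1).
  by apply: dyad_le; have := fe k; have := ef k; have := ef k.+1; lia.
exists (flatten [seq sub c | c <- lc]); split.
- rewrite size_flatten /shape -map_comp sumnE big_map big_seq.
  rewrite (eq_bigr (fun=> M)) => [|c cl]; last by case: (subP _ cl).
  rewrite -big_seq big_const_seq count_predT iter_addn_0 szc -expnD.
  congr expn; rewrite addnS -addSn [RHS]big_ltn; first exact: addnC.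
  by rewrite addSn ltnS leq_addr.
- move=> v /flatten_mapP[c cl vc]; have [_ /(_ v vc)[/andP[v1 v2] va] _] := subP _ cl.
  have [_ _ _ /andP[c1 c2]] := lcP _ cl.
  have x1 : p%:R / q%:R <= v by exact: le_trans v1.
  have x2 : v <= p%:R / q%:R + dyad (e k + f k).
    apply: le_trans v2 _; rewrite -(lerD2r lam) in c2; apply: le_trans c2 _.
    rewrite -addrA lerD2l; apply: le_trans (lerD (lexx _) lam_le) _.
    by rewrite dyadD expn1; lra.
  rewrite x1 x2; split => // j; rewrite leq_eqVlt => /orP[/eqP<-|]; last exact: va.
  have q0 : (0 < q)%N by move: eq; case: (q) => //; rewrite muln0 leqn0 expn_eq0.
  have qR : 0 < q%:R :> R by rewrite ltr0n.
  exists p, q; split => //.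
  rewrite (_ : _ - _ = q%:R * (v - p%:R / q%:R)); last by field; rewrite gt_eqF.
  rewrite normrM (gtr0_norm qR) ger0_norm ?subr_ge0//.
  apply: (@le_trans _ _ (q%:R * dyad (e k + f k))); first by rewrite ler_wpM2l// lerBlDl.
  rewrite dyadD mulrA ler_piMl// ler_pdivrMr ?T0// mul1r ler_nat.
  exact: qe.
move=> lo r; rewrite addnS -addSn => er.
have r0 : 0 < r by apply: lt_le_trans er; exact: dyad_gt0.
pose P v := lo <= v <= lo + r; set sig := dyad (2 * e k.+1).
have sig0 : 0 < sig := dyad_gt0 _.
have lam_sig : 2 * lam <= sig.
  rewrite mulrC -ler_pdivlMr// -[2^-1]/(dyad 1) -dyadD; apply: dyad_le.
  by have := ef k.+1; lia.
pose hit c := lo - lam <= frac c <= lo + r.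
have cnt_le (bnd : R) : 0 <= bnd -> (forall c, c \in lc -> (count P (sub c))%:R <= bnd) ->
    (count P (flatten [seq sub c | c <- lc]))%:R <= (count hit lc)%:R * bnd.
  move=> b0 bP; rewrite count_flatten -map_comp sumnE big_map natr_sum big_seq.
  rewrite -sum1_count natr_sum mulr_suml [leRHS]big_mkcond [leRHS]big_seq/=; apply: ler_sum => c cl.
  rewrite mul1r; case: ifPn => [_|nh]; first exact: bP.
  rewrite lern0 -leqn0 leqNgt -has_count -all_predC; apply/allP => v vc /=.
  have [_ /(_ v vc)[/andP[v1 v2] _] _] := subP _ cl.
  apply: contra nh => /andP[h1 h2]; rewrite /hit (le_trans v1 h2) andbT.
  by rewrite lerBlDr (le_trans h1).
have hits : (count hit lc)%:R <= (r + lam) / sig + 1.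
  have -> : r + lam = Num.max 0 (r + lam).
    by symmetry; apply/max_idPr; rewrite addr_ge0 ?(ltW r0)// dk.
  rewrite -size_filter -(size_map (fun v => frac v)).
  apply: (@size_separated _ (lo - lam)) => //.
  - apply: subseq_uniq uc; apply: map_subseq; exact: filter_subseq.
  - move=> _ _ /mapP[v + ->] /mapP[w + ->]; rewrite !mem_filter => /andP[_ vl] /andP[_ wl].
    have [_ _ v1 v2] := nodec _ vl; have [_ _ w1 w2] := nodec _ wl.
    have pos x : (2 ^ e k.+1 <= 8 * x)%N -> (0 < x)%N.
      by case: x => //; rewrite muln0 leqn0 expn_eq0.
    by apply: frac_separated; rewrite ?v2 ?w2 ?pos.
  - move=> _ /mapP[v + ->]; rewrite mem_filter => /andP[/andP[h1 h2] _].
    by rewrite h1/=; lra.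
(* at most two children are met when [r] is below their separation [sig] *)
have [sr|rs] := leP sig r; last first.
  have h2 : (count hit lc <= 2)%N.
    rewrite -ltnS -(ltr_nat R); apply: le_lt_trans hits _.
    rewrite -ltrBrDr ltr_pdivrMr// (_ : 3 - 1 = 2); last by ring.
    by have := dk (e k.+1 + f k.+1); rewrite -/lam; lra.
  have bnd0 : 0 <= 3 * C * 2 ^- k.+1 * (2 ^ \sum_(0 <= j < k.+1 + d) branching j)%:R * r `^ s.
    by rewrite !mulr_ge0 ?powR_ge0// invr_ge0 ltW.
  apply: le_trans (cnt_le _ bnd0 _) _; first by move=> c cl; have [_ _] := subP _ cl; apply.
  apply: (@le_trans _ _ (2 * (3 * C * 2 ^- k.+1 * (2 ^ \sum_(0 <= j < k.+1 + d) branching j)%:R * r `^ s))).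
    by rewrite ler_wpM2r// ler_nat.
  rewrite exprS invfM; move: bnd0 (two0 k); move: (2 ^+ k) (r `^ s) (_%:R) => t rs' T _ t0.
  by rewrite le_eqVlt; apply/orP; left; apply/eqP; field; rewrite gt_eqF.
apply: le_trans (cnt_le M%:R _ _) _ => //.
  move=> c cl; have [<- _ _] := subP _ cl; by rewrite ler_nat count_size.
have -> : (\sum_(0 <= j < k.+1 + d) branching j =
    \sum_(0 <= j < k) branching j + branching k + \sum_(k.+1 <= j < k.+1 + d) branching j)%N.
  by rewrite (@big_cat_nat _ _ _ k.+1)//= ?leq_addr// big_nat_recr.
have D0 : 0 <= C * 2 ^- k * (2 ^ \sum_(0 <= j < k) branching j)%:R.
  by rewrite !mulr_ge0// invr_ge0 ltW.
rewrite !expnD -/M !natrM [leRHS](_ : _ = 3 * ((2 ^ branching k)%:R * (C * 2 ^- k *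
  (2 ^ \sum_(0 <= j < k) branching j)%:R)) * r `^ s * M%:R); last by ring.
rewrite ler_wpM2r//.
apply: (@children_count _ _ _ sig) => //.
- have -> : (2 ^ branching k)%:R * sig = dyad (e k + f k + 12).
    have E : (2 * e k.+1 = branching k + (e k + f k + 12))%N.
      by rewrite /branching; move: (ef k) (fe k); clear; lia.
    by rewrite /sig E dyadD mulrA divff ?mul1r// gt_eqF.
  have := numeric k; rewrite -[X in X <= _]mulr1 -ler_pdivlMl ?two0//.
  by move=> /le_trans; apply; rewrite le_eqVlt; apply/orP; left; apply/eqP; ring.
- by rewrite ler_nat /branching -szc count_size.
- apply: le_trans hits _; rewrite -[X in _ + X](@divff _ sig) ?gt_eqF// -mulrDl.
  by rewrite ler_pM2r ?invr_gt0//; lra.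
Qed.
End Tree.
End CantorSet.

(** * Approximation in alternating windows *)

(** The time windows of the two coordinates, in powers of two: coordinate [a] is
    in the cusp between [2 ^ (window_start a k + k)] and [2 ^ (window_end a k - k)].
    The windows of the coordinates 0 and 1 alternate and overlap. *)
Definition window_start (a k : nat) : nat := (16 * (2 * k + a).+1 ^ 3)%N.
Definition window_end (a k : nat) : nat := (16 * (2 * k + a).+2 ^ 3 + 2 * k + 2)%N.

Lemma window_lt a k : (window_start a k < window_end a k)%N.
Proof.
rewrite /window_start /window_end; have : ((2 * k + a).+1 ^ 3 <= (2 * k + a).+2 ^ 3)%N by rewrite leq_exp2r.
lia.
Qed.

Lemma window_next a k : (window_end a k + 7 <= window_start a k.+1)%N.
Proof.
rewrite /window_start /window_end (_ : 2 * k.+1 + a = (2 * k + a).+2)%N; last by lia.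
by move: (2 * k + a)%N (leq_addr a (2 * k)) => u ku; rewrite !expnS expn0 !muln1; nia.
Qed.

Lemma branching_ge a k : (144 * (2 * k + a).+1 ^ 2 + 288 * (2 * k + a).+1 + 192 <= 
  branching (window_start a) (window_end a) k)%N.
Proof.
rewrite /branching /window_start /window_end (_ : 2 * k.+1 + a = (2 * k + a).+2)%N; last by lia.
by move: (2 * k + a)%N (leq_addr a (2 * k)) => u ku; rewrite !expnS expn0 !muln1; nia.
Qed.

Lemma sum_branching_ge a k : (24 * (2 * k + a).+1 ^ 3 <= 24 * a.+1 ^ 3 +
  \sum_(0 <= j < k) branching (window_start a) (window_end a) j)%N.
Proof.
elim: k => [|k IH]; first by rewrite leq_addr.
rewrite big_nat_recr//= addnA; apply: leq_trans (leq_add IH (branching_ge a k)).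
rewrite (_ : 2 * k.+1 + a = (2 * k + a).+2)%N; last by lia.
by move: (2 * k + a)%N => u; rewrite !expnS expn0 !muln1; nia.
Qed.

Section ManyApproximable.
Context {R : realType}.
Local Notation dyad m := ((2 ^ m)%:R^-1 : R).

Lemma pow2_powR m : (2 ^ m)%:R = 2 `^ m%:R :> R.
Proof. by rewrite powR_mulrn// natrX. Qed.

(** Up to lower order terms the number of points of level [k] is
    [2 ^ (24 u ^ 3)] and they are grouped at scale [2 ^ - (32 u ^ 3)], where
    [u = 2 k + a + 1]: this is where the dimension 3/4 comes from. *)
Lemma window_numeric a (s : R) : (a < 2)%N -> 0 <= s < 3 / 4 -> exists C : R, 0 <= C /\
  forall k, 2 ^+ k <= C * (2 ^ \sum_(0 <= j < k) branching (window_start a) (window_end a) j)%:R *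
    dyad (window_start a k + window_end a k + 12) `^ s.
Proof.
move=> a2 /andP[s0 s1]; pose delta := 24 - 32 * s.
have d0 : 0 < delta by rewrite /delta; lra.
exists (2 `^ (192 + 128 ^+ 3 / delta ^+ 2)); split=> [|k]; first exact: powR_ge0.
set K0 := 192 + _; rewrite -[_%:R^-1]powR_inv1 ?ler0n// !pow2_powR -!powRrM -powR_mulrn// -!powRD; try by rewrite pnatr_eq0 implybT.
apply: ler_powR; first by rewrite ler1n.
set tau := (\sum_(_ <= _ < _) _)%N; have := sum_branching_ge a k; rewrite -/tau.
set u := (2 * k + a).+1 => le_tau.
have le_m : (window_start a k + window_end a k + 12 <= 32 * u ^ 3 + 127 * u ^ 2)%N.
  rewrite /window_start /window_end -/u.
  have ku : (2 * k < u)%N by rewrite /u; lia.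
  by move: (u) ku => v ku; rewrite !expnS expn0 !muln1; nia.
have ku : (k <= u ^ 2)%N by rewrite /u expnS expn1; nia.
have a8 : (a.+1 ^ 3 <= 8)%N by case: a a2 {le_tau le_m tau u ku} => [|[|]].
have {}le_tau : (24 * u ^ 3 <= 192 + tau)%N by lia.
have u1 : 1 <= u%:R :> R by rewrite ler1n.
move: (window_start a k) (window_end a k) tau u u1 le_tau le_m ku => w1 w2 tau u u1.
rewrite -!(ler_nat R) !(natrD, natrX, natrM).
move: w1%:R w2%:R k%:R tau%:R => m1 m2 kr t le_tau le_m ku.
set x := u%:R in u1 le_tau le_m ku.
have x0 : 0 < x by lra.
have sm : s * (m1 + m2 + 12) <= 32 * s * x ^+ 3 + 127 * x ^+ 2.
  apply: (@le_trans _ _ (s * (32 * x ^+ 3 + 127 * x ^+ 2))); first by rewrite ler_wpM2l.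
  have : s * x ^+ 2 <= 1 * x ^+ 2 by rewrite ler_wpM2r ?sqr_ge0//; lra.
  lra.
have K : 128 * x ^+ 2 - delta * x ^+ 3 <= 128 ^+ 3 / delta ^+ 2.
  have [xd|xd] := leP (128 / delta) x.
    apply: (@le_trans _ _ 0); last by rewrite divr_ge0 ?sqr_ge0// exprn_ge0.
    have : 128 <= x * delta by rewrite -ler_pdivrMr.
    move=> /(ler_wpM2r (sqr_ge0 x)); rewrite exprS; lra.
  have : x ^+ 2 <= (128 / delta) ^+ 2.
    by rewrite ler_sqr ?nnegrE ?(ltW x0) ?divr_ge0// ltW.
  rewrite expr_div_n => x2.
  have : 0 <= delta * x ^+ 3 by rewrite mulr_ge0 ?exprn_ge0// ltW.
  have -> : 128 ^+ 3 / delta ^+ 2 = 128 * (128 ^+ 2 / delta ^+ 2) by rewrite exprS mulrA.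
  lra.
rewrite /K0; rewrite /delta in K *; lra.
Qed.

Definition cusp_set (a : nat) : set R :=
  [set v | 0 <= v <= 1 / 16 /\ forall k, approximable (window_start a) (window_end a) k v]%classic.

(** The existence of a measure on [A] giving mass at most [C r ^ e] to intervals
    of length [r], in a form without measures: normalized counting measures of
    finite subsets that satisfy the bound down to scale [eps]. *)
Definition frostman (A : set R) (e : R) := exists C : R, 0 <= C /\
  forall eps : R, 0 < eps -> exists l : seq R,
  [/\ (0 < size l)%N, forall v, v \in l -> A v &
    forall lo r, eps <= r ->
      (count (fun v => lo <= v <= lo + r) l)%:R <= C * (size l)%:R * r `^ e].

(** The tree of the fractions that are approximations of the successive windows,
    rooted at [1 / 2 ^ window_start a 0]. *)
Lemma cusp_set_frostman a (s : R) : (a < 2)%N -> 0 <= s < 3 / 4 -> frostman (cusp_set a) s.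
Proof.
move=> a2 s34; have [C [C0 num]] := window_numeric a2 s34.
exists (3 * C); split=> [|eps eps0]; first by rewrite mulr_ge0.
have s01 : 0 <= s <= 1 by case/andP: s34 => -> /= ?; lra.
have root : node (window_start a) 0 1 (2 ^ window_start a 0).
  by split=> //; rewrite ?coprime1n// leq_pmull.
pose d := (Num.truncn eps^-1).+1.
have [l [szl lP lcount]] := cantor_tree (window_lt a) (window_next a) s01 C0 num d root.
exists l; split.
- by rewrite szl expn_gt0.
- move=> v /lP[/andP[v1 v2] va]; split; last by move=> k; apply: va.
  apply/andP; split; first by apply: le_trans v1; rewrite divr_ge0.
  apply: le_trans v2 _; rewrite mul1r.
  have h m : (5 < m)%N -> dyad m <= 1 / 32.
    by move=> m5; apply: le_trans (dyad_le (ltnW m5)) _; rewrite div1r.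
  have w16 : (16 <= window_start a 0)%N by rewrite /window_start leq_pmulr// expn_gt0.
  have := h (window_start a 0); have := h (window_start a 0 + window_end a 0)%N.
  move=> /(_ (ltn_addr _ (leq_trans _ w16))) => /(_ isT) h1 /(_ (leq_trans _ w16)) => /(_ isT) h2.
  by rewrite natrX div1r in h1 h2 *; lra.
move=> lo r er; apply: le_trans (lcount lo r _) _.
  apply: le_trans er; rewrite invf_ple ?posrE ?ltr0n ?expn_gt0//.
  apply: le_trans (ltW (truncnS_gt _)) _; rewrite -/d ler_nat add0n.
  apply: leq_trans (ltnW (ltn_expl _ (isT : 1 < 2)%N)); rewrite /window_start.
  by have : (0 < (2 * d + a).+1 ^ 2)%N; [rewrite expn_gt0|rewrite expnSr; nia].
by rewrite expr0 divr1 szl add0n.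
Qed.

End ManyApproximable.

(** * Lengths of curves and matrix entries *)

Section Variation.
Context {R : realType}.
Local Notation mu := (@lebesgue_measure R).

(** Monotonicity by way of the supremum over simple functions; it spares the
    measurability of the speed of a curve. *)
Lemma ge0_le_integral_restrict (D1 D2 : set R) (f1 f2 : R -> \bar R) :
  (forall x, D1 x -> 0 <= f1 x)%E -> (forall x, D2 x -> 0 <= f2 x)%E ->
  (forall x, D1 x -> D2 x /\ f1 x <= f2 x)%E ->
  (\int[mu]_(x in D1) f1 x <= \int[mu]_(x in D2) f2 x)%E.
Proof.
move=> f10 f20 f12; rewrite [leLHS]integral_mkcond [leRHS]integral_mkcond.
rewrite !ge0_integralTE; [|by move=> x; apply: erestrict_ge0..].
apply: le_ereal_sup => _ [h hf <-]; exists h => // x.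
apply: le_trans (hf x) _; rewrite /patch; case: ifPn => [/set_mem/[dup]/f12[D2x f12x] D1x|_].
  by rewrite mem_set.
by case: ifPn => // /set_mem; apply: f20.
Qed.

(** The fundamental theorem of calculus, for a function whose derivative is
    dominated by the speed [sigma] of a curve of length [l]. *)
Lemma length_bounds_increment (F sigma : R -> R) (k l : R) : 0 < k ->
  (forall x, derivable F x 1) -> continuous (derive1 F) ->
  (forall x, 0 <= x <= 1 -> `|derive1 F x| <= k * sigma x) ->
  (\int[mu]_(x in `[0%R, 1%R]) (sigma x)%:E <= l%:E)%E ->
  forall s, 0 <= s <= 1 -> `|F s - F 0| <= k * l.
Proof.
move=> k0 dF cF Fs sl s /andP[s0 s1].
have sigma0 x : 0 <= x <= 1 -> 0 <= sigma x.
  by move=> /Fs; rewrite -ler_pdivrMl//; apply: le_trans; rewrite mulr_ge0 ?invr_ge0 ?normr_ge0 ?ltW.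
move: s0; rewrite le_eqVlt => /predU1P[<-|s0].
  rewrite subrr normr0 mulr_ge0 ?(ltW k0)// -lee_fin; apply: le_trans sl.
  by apply: integral_ge0 => x /=; rewrite in_itv/= lee_fin; exact: sigma0.
have cFx : continuous (fun x => k^-1 * derive1 F x).
  by move=> x; apply: cvgM; [exact: cvg_cst|exact: cF].
have FTC : (\int[mu]_(x in `[0%R, s]) (derive1 F x)%:E = (F s)%:E - (F 0)%:E)%E.
  apply: continuous_FTC2; first exact: s0.
  - exact: continuous_subspaceT.
  - have cont x : {for x, continuous F}.
      by apply: differentiable_continuous; apply/derivable1_diffP.
    split=> [x _|//|//]; first exact: dF.
    + by apply: cvg_at_right_filter; exact: cont.
    + by apply: cvg_at_left_filter; exact: cont.
  - by [].
pose f' : R -> R := derive1 F.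
have mF : measurable_fun [set: R] f' by exact: continuous_measurable_fun.

rewrite -ler_pdivrMl// -lee_fin; apply: le_trans sl.
rewrite EFinM -abse_EFin EFinB -FTC.
apply: (@le_trans _ _ (k^-1%:E * \int[mu]_(x in `[0%R, s]) `|(derive1 F x)%:E|)%E).
  apply: lee_wpmul2l; first by rewrite lee_fin invr_ge0 (ltW k0).
  apply: le_abse_integral => //; exact/measurable_EFinP/measurable_funTS.
rewrite -ge0_integralZl//.
- apply: ge0_le_integral_restrict => x /=; rewrite !in_itv/=.
  + by move=> _; rewrite mule_ge0// lee_fin invr_ge0 (ltW k0).
  + by move=> x01; rewrite lee_fin sigma0.
  + move=> /andP[x0 xs]; rewrite x0 (le_trans xs s1); split=> //.
    by rewrite -EFinM lee_fin ler_pdivrMl// Fs// x0 (le_trans xs).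
- by apply: measurableT_comp => //; exact/measurable_EFinP/measurable_funTS.
- by rewrite lee_fin invr_ge0 ltW.
Qed.
End Variation.

(** A positive definite form dominates each coordinate: the coordinate is the
    inner product with a fixed vector, by invertibility of the Gram matrix, and
    the Cauchy-Schwarz inequality applies. *)
Lemma pos_def_coord (R : realFieldType) m (M : 'M[R]_m) : M^T = M ->
  (forall x : 'rV_m, x != 0 -> 0 < (x *m M *m x^T) 0 0) ->
  exists2 c : R, 0 < c & forall (x : 'rV_m) i, c * x 0 i ^+ 2 <= (x *m M *m x^T) 0 0.
Proof.
move=> Msym Mpos.
have Mge0 (x : 'rV_m) : 0 <= (x *m M *m x^T) 0 0.
  by have [->|x0] := eqVneq x 0; [rewrite !mul0mx mxE|exact: ltW (Mpos _ x0)].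
have Minv : M \in unitmx.
  rewrite -row_free_unit -kermx_eq0; apply/rowV0P => x /sub_kermxP xM.
  by apply/eqP/negPn/negP => /Mpos; rewrite xM mul0mx mxE ltxx.
pose y i := delta_mx 0 i *m invmx M : 'rV_m.
pose q i := (y i *m M *m (y i)^T) 0 0.
have yM i : y i *m M = delta_mx 0 i by rewrite /y mulmxKV.
have q0 i : 0 < q i.
  apply: Mpos; apply/eqP => y0; have := yM i; rewrite y0 mul0mx => /matrixP/(_ 0 i).
  by rewrite !mxE !eqxx => /esym/eqP; rewrite oner_eq0.
have CS (x : 'rV_m) i : x 0 i ^+ 2 <= q i * (x *m M *m x^T) 0 0.
  have xy : (x *m M *m (y i)^T) 0 0 = x 0 i.
    have -> : x *m M *m (y i)^T = x *m delta_mx i 0.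
      by rewrite -mulmxA -[M *m _]trmxK trmx_mul trmxK Msym yM trmx_delta.
    by rewrite -colE mxE.
  have yx : (y i *m M *m x^T) 0 0 = x 0 i by rewrite yM -rowE !mxE.
  have evB (A B : 'M[R]_1) a b : (a *: A - b *: B) 0 0 = a * A 0 0 - b * B 0 0 by rewrite !mxE.
  have Bl a b (u v w : 'rV_m) : ((a *: u - b *: v) *m M *m w^T) 0 0 =
      a * (u *m M *m w^T) 0 0 - b * (v *m M *m w^T) 0 0.
    by rewrite !mulmxBl -!scalemxAl evB.
  have Br a b (u v w : 'rV_m) : (w *m M *m (a *: u - b *: v)^T) 0 0 =
      a * (w *m M *m u^T) 0 0 - b * (w *m M *m v^T) 0 0.
    have -> : (a *: u - b *: v)^T = a *: u^T - b *: v^T by apply/matrixP => ? ?; rewrite !mxE.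
    by rewrite mulmxBr -!scalemxAr evB.
  have := Mge0 (q i *: x - x 0 i *: y i); rewrite Bl !Br xy yx -/(q i).
  rewrite (_ : _ - _ = q i * (q i * (x *m M *m x^T) 0 0 - x 0 i ^+ 2)); last by ring.
  by rewrite pmulr_rge0// subr_ge0.
exists (1 + \sum_i q i)^-1 => [|x i].
  by rewrite invr_gt0 ltr_pwDl// sumr_ge0// => i _; exact: ltW.
have d0 : 0 < 1 + \sum_i q i by rewrite ltr_pwDl// sumr_ge0// => j _; exact: ltW.
rewrite ler_pdivrMl//; apply: le_trans (CS x i) _; rewrite ler_wpM2r//.
rewrite (bigD1 i)//= addrCA lerDl addr_ge0// sumr_ge0// => j _; exact: ltW.
Qed.

Lemma ord2P (i : 'I_2) : i = 0 \/ i = 1.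
Proof. by case: i => [[|[|//]] ?]; [left|right]; apply/val_inj. Qed.

Lemma det_mx22 (R : comNzRingType) (A : 'M[R]_2) : \det A = A 0 0 * A 1 1 - A 0 1 * A 1 0.
Proof.
rewrite (expand_det_row _ 0) !big_ord_recl big_ord0 addr0 /cofactor !det_mx11 !mxE/=.
rewrite expr0 mul1r /= /bump/= expr1 mulN1r mulrN.
by congr (A _ _ * A _ _ - A _ _ * A _ _); apply/val_inj.
Qed.

Lemma mulmx22 (R : pzSemiRingType) (A B : 'M[R]_2) i j :
  (A *m B) i j = A i 0 * B 0 j + A i 1 * B 1 j.
Proof.
rewrite mxE !big_ord_recl big_ord0 addr0.
by congr (_ + A _ _ * B _ _); apply/val_inj.
Qed.

Lemma sl2_det (R : realType) (g : SL2 R) : g 0 0 * g 1 1 - g 0 1 * g 1 0 = 1.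
Proof. by rewrite -det_mx22 (eqP (slmxP g)). Qed.

Lemma slmx_inv (R : realType) (g : SL2 R) :
  [/\ slmx g^-1%g 0 0 = g 1 1, slmx g^-1%g 0 1 = - g 0 1,
      slmx g^-1%g 1 0 = - g 1 0 & slmx g^-1%g 1 1 = g 0 0].
Proof.
pose h := \matrix_(i < 2, j < 2) (if i == 0 then (if j == 0 then g 1 1 else - g 0 1)
                                 else (if j == 0 then - g 1 0 else g 0 0)).
suff -> : slmx g^-1%g = h by rewrite /h !mxE.
have gh : h *m slmx g = 1%:M.
  have d := sl2_det g; apply/matrixP => i j; rewrite mulmx22 !mxE.
  by have [->|->] := ord2P i; have [->|->] := ord2P j; rewrite /=; lra.
have gg : slmx g *m slmx g^-1%g = 1%:M.
  by rewrite -[_ *m _]/(slmx (g * g^-1)%g) mulgV.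
by rewrite -[LHS]mul1mx -gh -mulmxA gg mulmx1.
Qed.

Section RiemannianNorm.
Variables (R : realType) (n : nat) (rho : Gn R n -> ambient R n -> ambient R n -> R).
Hypothesis Hrho : right_invariant_riemannian rho.
Local Notation T1 := (tangent (1%g : Gn R n)).

Lemma tangent1E w : T1 w <-> forall i, w i 0 0 + w i 1 1 = 0.
Proof.
have E i : \tr (w i *m slmx ((1%g : Gn R n) i)^-1%g) = w i 0 0 + w i 1 1.
  rewrite ffunE invg1 mulmx1 /mxtrace !big_ord_recl big_ord0 addr0.
  by congr (_ + w i _ _); apply/val_inj.
by split=> H i; [rewrite -E; exact: (H i)|rewrite -[RHS](H i) -E].
Qed.

Lemma tangentE (g : Gn R n) w : tangent g w <-> T1 (translate_vec w g^-1%g).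
Proof.
have E i : \tr (w i *m slmx (g i)^-1%g) = (translate_vec w g^-1%g) i 0 0 + (translate_vec w g^-1%g) i 1 1.
  rewrite !ffunE /mxtrace !big_ord_recl big_ord0 addr0.
  by congr (_ + (w i *m _) _ _); apply/val_inj.
split=> [H|/tangent1E H i]; first by apply/tangent1E => i; rewrite -E; exact: (H i).
by rewrite -[RHS](H i) -E.
Qed.

Lemma rho_translate (g : Gn R n) v : tangent g v ->
  rho g v v = rho 1%g (translate_vec v g^-1%g) (translate_vec v g^-1%g).
Proof. by move=> tv; rewrite -(riem_right_inv Hrho g^-1%g tv tv) mulgV. Qed.

Lemma T1_0 : T1 0.
Proof. by apply/tangent1E => i; rewrite ffunE !mxE addr0. Qed.

Lemma T1_lin (a : R) u v : T1 u -> T1 v -> T1 (a *: u + v).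
Proof.
move=> /tangent1E Hu /tangent1E Hv; apply/tangent1E => i.
by rewrite !ffunE !mxE addrACA -mulrDr Hu Hv mulr0 addr0.
Qed.

Lemma T1_sum (I : Type) (r : seq I) (x : I -> R) (t : I -> ambient R n) :
  (forall k, T1 (t k)) -> T1 (\sum_(k <- r) x k *: t k).
Proof.
move=> Ht; elim: r => [|k r IH]; first by rewrite big_nil; exact: T1_0.
by rewrite big_cons; apply: T1_lin.
Qed.

Lemma rho_suml (I : Type) (r : seq I) (x : I -> R) (t : I -> ambient R n) w :
  (forall k, T1 (t k)) -> T1 w ->
  rho 1%g (\sum_(k <- r) x k *: t k) w = \sum_(k <- r) x k * rho 1%g (t k) w.
Proof.
move=> Ht Hw; elim: r => [|k r IH].
  rewrite !big_nil; have := riem_linear Hrho 1 T1_0 T1_0 Hw.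
  by rewrite scaler0 addr0 mul1r => /eqP; rewrite -subr_eq subrr eq_sym => /eqP.
by rewrite !big_cons (riem_linear Hrho)// ?IH//; exact: T1_sum.
Qed.

Lemma rho_sumr (I : Type) (r : seq I) (x : I -> R) (t : I -> ambient R n) w :
  (forall k, T1 (t k)) -> T1 w ->
  rho 1%g w (\sum_(k <- r) x k *: t k) = \sum_(k <- r) x k * rho 1%g w (t k).
Proof.
move=> Ht Hw; rewrite (riem_sym Hrho)//; last exact: T1_sum.
rewrite rho_suml//; apply: eq_bigr => k _; congr (_ * _); exact: (riem_sym Hrho).
Qed.

Definition sl2_basis (k : 'I_3) : 'M[R]_2 :=
  if k == 0 then delta_mx 0 0 - delta_mx 1 1 else if k == 1 then delta_mx 0 1 else delta_mx 1 0.

Let J : finType := ('I_n * 'I_3)%type.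

Definition basis_vec (k : J) : ambient R n := [ffun i => if i == k.1 then sl2_basis k.2 else 0].

Definition sl2_coord (w : ambient R n) (k : J) : R :=
  if k.2 == 0 then w k.1 0 0 else if k.2 == 1 then w k.1 0 1 else w k.1 1 0.

Lemma T1_basis k : T1 (basis_vec k).
Proof.
apply/tangent1E => i; rewrite ffunE; case: ifP => _; last by rewrite !mxE addr0.
by rewrite /sl2_basis; case: ifP => _; [|case: ifP => _]; rewrite !mxE/= ?subr0 ?sub0r ?addrN ?addr0.
Qed.

Lemma basis_decomp w : T1 w -> w = \sum_(k : J) sl2_coord w k *: basis_vec k.
Proof.
move=> /tangent1E Hw; apply/ffunP => i; rewrite sum_ffunE.
transitivity (\sum_(k < 3) sl2_coord w (i, k) *: sl2_basis k); last first.
  transitivity (\sum_(j < n) \sum_(k < 3) (sl2_coord w (j, k) *: basis_vec (j, k)) i); last first.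
    by rewrite pair_bigA; apply: eq_bigr => -[].
  rewrite [RHS](bigD1 i)//= [X in _ = _ + X]big1 ?addr0 => [|j ji].
    by apply: eq_bigr => k _; rewrite !ffunE eqxx.
  by apply: big1 => k _; rewrite !ffunE eq_sym (negbTE ji) scaler0.
rewrite !big_ord_recl big_ord0 addr0 /sl2_coord /sl2_basis/=.
apply/matrixP => a b; rewrite !mxE.
by have [->|->] := ord2P a; have [->|->] := ord2P b; rewrite /=; have := Hw i; lra.
Qed.

Lemma sl2_coord_basis k l : sl2_coord (basis_vec l) k = (l == k)%:R.
Proof.
case: k l => i a [j b]; rewrite /sl2_coord /basis_vec !ffunE/= xpair_eqE [j == i]eq_sym.
case: (i == j) => /=; last by do 2?case: ifP => _; rewrite !mxE.
rewrite /sl2_basis; case: a => [[|[|[|//]]] ?]; case: b => [[|[|[|//]]] ?];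
by rewrite /= !mxE/= ?subr0 ?sub0r ?oppr0.
Qed.

Lemma sl2_coord_sum (x : J -> R) k :
  sl2_coord (\sum_(l : J) x l *: basis_vec l) k = x k.
Proof.
transitivity (\sum_(l : J) x l * sl2_coord (basis_vec l) k).
  rewrite /sl2_coord sum_ffunE; case: ifP => _; [|case: ifP => _]; rewrite summxE;
  by apply: eq_bigr => l _; rewrite !ffunE mxE.
rewrite (bigD1 k)//= sl2_coord_basis eqxx mulr1 big1 ?addr0// => l lk.
by rewrite sl2_coord_basis (negbTE lk) mulr0.
Qed.

Lemma rho1E (x : J -> R) (w := \sum_(l : J) x l *: basis_vec l) :
  rho 1%g w w = \sum_(k : J) \sum_(l : J) x k * x l * rho 1%g (basis_vec k) (basis_vec l).
Proof.
have Tw : T1 w by exact: T1_sum T1_basis.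
rewrite {1}/w rho_suml//; last exact: T1_basis.
apply: eq_bigr => k _; rewrite rho_sumr; [|exact: T1_basis|exact: T1_basis].
by rewrite mulr_sumr; apply: eq_bigr => l _; rewrite mulrA.
Qed.

(** The norm of a tangent vector at [g] is comparable, uniformly in [g], to the
    largest entry of its right translate to the identity. *)
Lemma riem_norm_le : exists2 C : R, 0 < C & forall g v m, 0 <= m -> tangent g v ->
  (forall i a b, `|(v i *m slmx (g i)^-1%g) a b| <= m) -> Num.sqrt (rho g v v) <= C * m.
Proof.
pose G (k l : J) := rho 1%g (basis_vec k) (basis_vec l).
pose S := \sum_(k : J) \sum_(l : J) `|G k l|.
have S0 : 0 <= S by apply: sumr_ge0 => k _; exact: sumr_ge0.
exists (1 + S) => [|g v m m0 tv vm]; first by rewrite ltr_pwDl.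
have C0 : 0 <= 1 + S by rewrite addr_ge0.
rewrite -[leRHS]ger0_norm ?mulr_ge0// -sqrtr_sqr ler_wsqrtr//.
have Tw := (tangentE g v).1 tv; rewrite rho_translate// (basis_decomp Tw) rho1E.
set x := sl2_coord _.
have xm k : `|x k| <= m.
  by rewrite /x /sl2_coord !ffunE; case: ifP => _; [|case: ifP => _]; apply: vm.
apply: (@le_trans _ _ (S * m ^+ 2)).
  rewrite mulr_suml; apply: ler_sum => k _; rewrite mulr_suml; apply: ler_sum => l _.
  apply: le_trans (ler_norm _) _; rewrite normrM mulrC ler_wpM2l// normrM expr2.
  by apply: ler_pM.
rewrite exprMn ler_wpM2r ?sqr_ge0// expr2; nra.
Qed.

Lemma riem_norm_ge : exists2 C : R, 0 < C & forall g v i a b, tangent g v ->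
  `|(v i *m slmx (g i)^-1%g) a b| <= C * Num.sqrt (rho g v v).
Proof.
pose V (x : 'rV[R]_#|{: J}|) := \sum_(l : J) x 0 (enum_rank l) *: basis_vec l.
pose M := \matrix_(k < #|{: J}|, l < #|{: J}|) rho 1%g (basis_vec (enum_val k)) (basis_vec (enum_val l)).
have rank_sum (F : 'I_#|{: J}| -> R) : \sum_i F i = \sum_(l : J) F (enum_rank l).
  by rewrite (reindex (@enum_rank J))//; exact: onW_bij (enum_rank_bij J).
have VM x : (x *m M *m x^T) 0 0 = rho 1%g (V x) (V x).
  rewrite rho1E mxE rank_sum exchange_big/=; apply: eq_bigr => l _.
  rewrite mxE rank_sum mulr_suml; apply: eq_bigr => k _.
  by rewrite !mxE !enum_rankK mulrAC.
have TV x : T1 (V x) by exact: T1_sum T1_basis.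
have [||c c0 cP] := @pos_def_coord R _ M.
- by apply/matrixP => k l; rewrite !mxE; apply: (riem_sym Hrho); exact: T1_basis.
- move=> x x0; rewrite VM; apply: (riem_pos Hrho) => //; apply: contra_neq x0 => Vx0.
  apply/rowP => k; rewrite mxE -[k]enum_valK.
  have := sl2_coord_sum (fun l => x 0 (enum_rank l)) (enum_val k); rewrite -/(V x) Vx0 => <-.
  by rewrite /sl2_coord !ffunE; do 2?case: ifP => _; rewrite mxE.
exists (Num.sqrt c^-1) => [|g v i a b tv]; first by rewrite sqrtr_gt0 invr_gt0.
have Tw := (tangentE g v).1 tv; rewrite rho_translate//.
set w := translate_vec _ _ in Tw *.
have -> : v i *m slmx (g i)^-1%g = w i by rewrite !ffunE.
have coord k : `|sl2_coord w k| <= Num.sqrt c^-1 * Num.sqrt (rho 1%g w w).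
  rewrite -sqrtrM ?invr_ge0 ?(ltW c0)// -sqrtr_sqr ler_wsqrtr// ler_pdivlMl//.
  have := cP (\row_l sl2_coord w (enum_val l)) (enum_rank k); rewrite VM.
  rewrite mxE enum_rankK; suff -> : V (\row_l sl2_coord w (enum_val l)) = w by [].
  rewrite [RHS](basis_decomp Tw); apply: eq_bigr => l _; by rewrite mxE enum_rankK.
have := coord (i, 0); have := coord (i, 1); have := coord (i, 2); rewrite /sl2_coord/=.
have /tangent1E/(_ i) w11 := Tw.
have [->|->] := ord2P a; have [->|->] := ord2P b => //.
by rewrite (_ : w i 1 1 = - w i 0 0) ?normrN//; lra.
Qed.
End RiemannianNorm.

Lemma cvg_mx_entries (R : realType) (T : Type) (F : set_system T) (FF : Filter F)
    m p (f : T -> 'M[R]_(m, p)) (l : 'M[R]_(m, p)) :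
  (forall i j, (fun t => f t i j) @ F --> l i j) -> f @ F --> l.
Proof.
move=> fl; apply/cvgrPdist_le => e e0; near=> x.
rewrite /Num.Def.normr/= mx_normrE (bigmax_le _ (ltW e0))//= => i _.
rewrite !mxE; move: i; near: x; apply: filter_forall => /= i.
exact: ((cvgrPdist_le _ _).1 (fl i.1 i.2)).
Unshelve. all: by end_near. Qed.

Lemma is_derive_mulr (R : realType) (f : R -> R) (x k df : R) :
  is_derive x (1 : R) f df -> is_derive x (1 : R) (fun s => f s * k) (df * k).
Proof.
move=> Hf; have Hk := is_derive_cst k x (1 : R); apply: is_derive_eq.
by rewrite scaler0 add0r /GRing.scale/= mulrC.
Qed.

Section Curves.
Variables (R : realType) (n : nat).

Lemma entry_derive (c : R -> Gn R n) i a b s : C1_curve c ->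
  is_derive s (1 : R) (fun s => Defs.coord c i s a b : R) (velocity c s i a b).
Proof.
move=> /(_ i)[dc cc]; apply: DeriveDef.
  by have /derivable_mxP := dc s; apply.
by rewrite /velocity ffunE derive1E derive_mx ?mxE//; exact: dc.
Qed.

Lemma entry_continuous (c : R -> Gn R n) i a b : C1_curve c ->
  continuous (fun s => velocity c s i a b).
Proof.
move=> /(_ i)[dc cc].
have -> : (fun s => velocity c s i a b) = (fun M : 'M[R]_2 => M a b) \o derive1 (Defs.coord c i).
  by apply/funext => t; rewrite /velocity ffunE.
by move=> s; apply: continuous_comp; [exact: cc|exact: coord_continuous].
Qed.

(* differentiate the equation det = 1 *)
Lemma velocity_tangent (c : R -> Gn R n) s : C1_curve c -> tangent (c s) (velocity c s).
Proof.
move=> Cc; apply/tangentE/tangent1E => i; rewrite /translate_vec ffunE [(c s)^-1%g i]ffunE.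
have [i00 i01 i10 i11] := slmx_inv (c s i).
rewrite !mulmx22 i00 i01 i10 i11.
have d a b := entry_derive i a b s Cc.
have := is_deriveB (is_deriveM (d 0 0) (d 1 1)) (is_deriveM (d 0 1) (d 1 0)).
rewrite (_ : _ - _ = cst 1); last by apply/funext => t; exact: sl2_det.
move=> /(@derive_val _ _ _ _ _ _ _); rewrite derive_cst /GRing.scale/= /Defs.coord.
lra.
Qed.

(** A short curve stays close to its starting point, in the sense of right
    translates: an upper bound for the entries of [c s * (c 0)^-1] along the
    curve improves itself when the curve is short. *)
Lemma curve_short (rho : Gn R n -> ambient R n -> ambient R n -> R) :
  right_invariant_riemannian rho ->
  exists2 K : R, 0 < K & forall c l, C1_curve c -> (curve_length rho c <= l%:E)%E -> K * l <= 1 ->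
    forall i a b, `|(slmx (c 1 i) *m slmx (c 0 i)^-1%g) a b - (a == b)%:R| <= K * l.
Proof.
move=> Hrho; have [C C0 CP] := riem_norm_ge Hrho.
exists (4 * C) => [|c l Cc cl Kl i]; first by rewrite mulr_gt0.
pose sigma s := Num.sqrt (rho (c s) (velocity c s) (velocity c s)).
pose E a b s : R := (slmx (c s i) *m slmx (c 0 i)^-1%g) a b.
pose W s := velocity c s i *m slmx (c s i)^-1%g.
have l0 : 0 <= l.
  rewrite -lee_fin; apply: le_trans cl; apply: integral_ge0 => s _.
  by rewrite lee_fin sqrtr_ge0.
have Wle s a b : `|W s a b| <= C * sigma s by exact/CP/velocity_tangent.
pose dE a b s : R := velocity c s i a 0 * slmx (c 0 i)^-1%g 0 b + velocity c s i a 1 * slmx (c 0 i)^-1%g 1 b.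
have dEE a b s : is_derive s (1 : R) (E a b) (dE a b s).
  have -> : E a b = (fun s => Defs.coord c i s a 0 * slmx (c 0 i)^-1%g 0 b + Defs.coord c i s a 1 * slmx (c 0 i)^-1%g 1 b).
    by apply/funext => t; rewrite /E mulmx22.
  by apply: is_deriveD; apply: is_derive_mulr; exact: entry_derive.
have dE1 a b s : derive1 (E a b) s = dE a b s.
  by rewrite derive1E; have := dEE a b s => /(@derive_val _ _ _ _ _ _ _).
have dEW a b s : dE a b s = W s a 0 * E 0 b s + W s a 1 * E 1 b s.
  rewrite /dE /W /E -!mulmx22 -mulmxA [in RHS](mulmxA (slmx (c s i)^-1%g)).
  by rewrite -[slmx _ *m slmx (c s i)]/(slmx ((c s i)^-1 * c s i)%g) mulVg mul1mx.
have cdE a b : continuous (derive1 (E a b)).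
  have -> : derive1 (E a b) = dE a b by apply/funext.
  by move=> s; apply: cvgD; apply: cvgM; [exact: entry_continuous|exact: cvg_cst|exact: entry_continuous|exact: cvg_cst].
have dEs a b s : derivable (E a b) s 1 by exact: ex_derive.
have cE a b : continuous (E a b).
  by move=> s; apply: differentiable_continuous; apply/derivable1_diffP.
have ex a b : exists2 s, s \in `[0, 1]%R & forall t, t \in `[0, 1]%R -> `|E a b t| <= `|E a b s|.
  apply: EVT_max => //; apply: continuous_subspaceT => s.
  by apply: continuous_comp; [exact: cE|exact: norm_continuous].
have /boolp.choice[sm smP] : forall p : 'I_2 * 'I_2, exists sm, 0 <= sm <= 1 /\
    forall t, 0 <= t <= 1 -> `|E p.1 p.2 t| <= `|E p.1 p.2 sm|.
  by move=> p; have [s s01 sP] := ex p.1 p.2; exists s; split.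
pose M := \big[Num.max/0]_p `|E p.1 p.2 (sm p)|.
have ME a b t : 0 <= t <= 1 -> `|E a b t| <= M.
  move=> t01; apply: le_trans ((smP (a, b)).2 t t01) _.
  exact: (le_bigmax _ (fun p => `|E p.1 p.2 (sm p)|) (a, b)).
have M0 : 0 <= M by apply: bigmax_ge_id.
have E0 a b : E a b 0 = (a == b)%:R.
  rewrite /E -[slmx _ *m _]/(slmx (c 0 i * (c 0 i)^-1)%g) mulgV /= mxE.
  by case: (a == b).
have var a b (k : R) : M <= k -> 0 < k -> forall s, 0 <= s <= 1 -> `|E a b s - (a == b)%:R| <= (2 * C * k) * l.
  move=> Mk k0 s s01; rewrite -(E0 a b); apply: (@length_bounds_increment R (E a b) sigma) => //.
    by rewrite !mulr_gt0.
  move=> x x01; rewrite dE1 dEW; apply: le_trans (ler_normD _ _) _; rewrite !normrM.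
  have h b' : `|W x a b'| * `|E b' b x| <= C * sigma x * k.
    by apply: ler_pM => //; apply: le_trans (ME _ _ _ x01) Mk.
  by have := h 0; have := h 1; lra.
(* otherwise [M <= 1 + M / 2] *)
have Mle : M <= 2.
  rewrite leNgt; apply/negP => M2.
  have : M <= 1 + 2 * C * M * l.
    apply: bigmax_le => [|[a b] _ /=].
      by rewrite addr_ge0// !mulr_ge0// ltW.
    have := var a b M (lexx _) (lt_trans (ltr0Sn R 1) M2) (sm (a, b)) (smP (a, b)).1.
    have : `|(a == b)%:R| <= 1 :> R by case: (a == b); rewrite ?normr1 ?normr0.
    have := ler_normD (E a b (sm (a, b)) - (a == b)%:R) (a == b)%:R; rewrite subrK; lra.
  have : 2 * (2 * C * l * M) <= M by rewrite (_ : _ * _ = 4 * C * l * M); [rewrite ler_piMl|ring].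
  lra.
move=> a b; apply: le_trans (var a b 2 Mle _ 1 _) _ => //.
  by rewrite ler01 lexx.
by rewrite (_ : 2 * C * 2 = 4 * C)//; ring.
Qed.
End Curves.

(** * Coordinates adapted to the flow *)

Section Chart.
Variables (R : realType).

(** The product of a lower triangular matrix [(e ^ x 0; y e ^ - x)], whose
    conjugates by the forward flow are bounded, and of the unipotent matrix
    [(1 t; 0 1)], in the expanding direction. *)
Definition chart_mx (x y t : R) : 'M[R]_2 := \matrix_(i, j)
  (if i == 0 then (if j == 0 then expR x else expR x * t)
             else (if j == 0 then y else y * t + expR (- x))).

Fact chart_subproof x y t : \det (chart_mx x y t) == 1.
Proof.
rewrite det_mx22 !mxE/= mulrDr -expRD subrr expR0 mulrCA [expR x * t * y]mulrC.
by apply/eqP; rewrite mulrA; ring.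
Qed.
Definition chart_sl2 x y t : SL2 R := MkSL2 (chart_subproof x y t).

Definition chart n (x y t : 'I_n -> R) : Gn R n := [ffun i => chart_sl2 (x i) (y i) (t i)].

Variables (n : nat) (x y t p q r : 'I_n -> R).

Definition chart_curve (s : R) : Gn R n :=
  chart (fun i => x i + p i * s) (fun i => y i + q i * s) (fun i => t i + r i * s).

(* the entries of the derivative of [chart_curve] *)
Definition chart_velocity i s : 'M[R]_2 :=
  let X := x i + p i * s in let Y := y i + q i * s in let T := t i + r i * s in
  \matrix_(a, b) (if a == 0 then (if b == 0 then p i * expR X else p i * expR X * T + expR X * r i)
             else (if b == 0 then q i else q i * T + Y * r i - p i * expR (- X))).

Lemma chart_curve_derive i a b s :
  is_derive s (1 : R) (fun s => slmx (chart_curve s i) a b : R) (chart_velocity i s a b).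
Proof.
have aff (u v : R) : is_derive s (1 : R) (fun s => u + v * s) v.
  have := is_deriveD (is_derive_cst u s (1 : R)) (is_deriveZ v (is_derive_id s (1 : R))).
  by rewrite add0r /GRing.scale/= mulr1.
have dexp : is_derive s (1 : R) (fun s => expR (x i + p i * s)) (p i * expR (x i + p i * s)).
  have := @is_derive1_comp R expR (fun s => x i + p i * s) s _ _ (is_derive_expR _) (aff (x i) (p i)).
  by rewrite mulrC.
have dexpN : is_derive s (1 : R) (fun s => expR (- (x i + p i * s))) (- (p i * expR (- (x i + p i * s)))).
  have := @is_derive1_comp R expR (fun s => - (x i + p i * s)) s _ _ (is_derive_expR _) (is_deriveN (aff (x i) (p i))).
  by rewrite mulrN mulrC.
have E : (fun s => slmx (chart_curve s i) a b : R) = fun s => chart_mx (x i + p i * s) (y i + q i * s) (t i + r i * s) a b.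
  by apply/funext => u; rewrite ffunE.
have E2 (F : R -> R) : (forall u, F u = chart_mx (x i + p i * u) (y i + q i * u) (t i + r i * u) a b) ->
    (fun s => chart_mx (x i + p i * s) (y i + q i * s) (t i + r i * s) a b) = F.
  by move=> H; apply/funext => u; rewrite H.
rewrite E; case: (ord2P a) (ord2P b) E2 => -> [->|->] E2; rewrite /chart_velocity mxE/=.
- by rewrite (E2 (fun s => expR (x i + p i * s)))// => u; rewrite mxE.
- rewrite (E2 (fun s => expR (x i + p i * s) * (t i + r i * s))) => [|u]; last by rewrite mxE.
  by apply: (is_derive_eq (is_deriveM dexp (aff (t i) (r i)))); rewrite /GRing.scale/=; ring.
- by rewrite (E2 (fun s => y i + q i * s))// => u; rewrite mxE.
- rewrite (E2 (fun s => (y i + q i * s) * (t i + r i * s) + expR (- (x i + p i * s)))) => [|u]; last by rewrite mxE.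
  by apply: (is_derive_eq (is_deriveD (is_deriveM (aff (y i) (q i)) (aff (t i) (r i))) dexpN)); rewrite /GRing.scale/=; ring.
Qed.

Lemma chart_curve_C1 : C1_curve chart_curve.
Proof.
have D i s : derivable (Defs.coord chart_curve i) s 1.
  by apply/derivable_mxP => a b; apply: ex_derive; exact: chart_curve_derive.
move=> i; split=> [//|].
have -> : derive1 (Defs.coord chart_curve i) = chart_velocity i.
  apply/funext => s; rewrite derive1E derive_mx; last exact: D.
  by apply/matrixP => a b; rewrite mxE; have := chart_curve_derive i a b s => /(@derive_val _ _ _ _ _ _ _).
move=> s; apply: cvg_mx_entries => a b.
have aff (u v : R) : (fun s => u + v * s) @ s --> u + v * s.
  by apply: cvgD; [exact: cvg_cst|apply: cvgM; [exact: cvg_cst|exact: cvg_id]].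
have cexp (u v : R) : (fun s => expR (u + v * s)) @ s --> expR (u + v * s).
  by apply: (cvg_comp _ _ (aff u v)); exact: continuous_expR.
have cexpN (u v : R) : (fun s => expR (- (u + v * s))) @ s --> expR (- (u + v * s)).
  by apply: (cvg_comp _ _ (cvgN (aff u v))); exact: continuous_expR.
rewrite (_ : chart_velocity i ^~ a ^~ b = fun s => chart_velocity i s a b)//.
under eq_fun do rewrite mxE; rewrite mxE.
case: (ord2P a) (ord2P b) => -> [->|->] /=.
- by apply: cvgM; [exact: cvg_cst|exact: cexp].
- apply: cvgD; apply: cvgM; [|exact: aff|exact: cexp|exact: cvg_cst].
  by apply: cvgM; [exact: cvg_cst|exact: cexp].
- exact: cvg_cst.
- apply: cvgB; [apply: cvgD; apply: cvgM|apply: cvgM]; [exact: cvg_cst|exact: aff|exact: aff|exact: cvg_cst|exact: cvg_cst|exact: cexpN].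
Qed.

Lemma chart_curve_velocity i s : velocity chart_curve s i = chart_velocity i s.
Proof.
rewrite /velocity ffunE derive1E derive_mx; last by have [+ _] := chart_curve_C1 i; apply.
by apply/matrixP => a b; rewrite mxE; have := chart_curve_derive i a b s => /(@derive_val _ _ _ _ _ _ _).
Qed.

End Chart.

Section ChartDistance.
Variables (R : realType) (n : nat) (rho : Gn R n -> ambient R n -> ambient R n -> R).
Hypothesis Hrho : right_invariant_riemannian rho.

(** In bounded parts the chart is Lipschitz, by the length of the image of a segment. *)
Lemma riem_dist_chart (m : R) : 0 <= m -> exists2 K : R, 0 < K &
  forall (x y t x' y' t' : 'I_n -> R) eps,
    0 <= eps ->
    (forall i, [/\ `|x i| <= m, `|y i| <= m & `|t i| <= m]) ->
    (forall i, [/\ `|x' i| <= m, `|y' i| <= m & `|t' i| <= m]) ->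
    (forall i, [/\ `|x' i - x i| <= eps, `|y' i - y i| <= eps & `|t' i - t i| <= eps]) ->
    (riem_dist rho (chart x y t) (chart x' y' t') <= (K * eps)%:E)%E.
Proof.
move=> m0; have [C C0 CP] := riem_norm_le Hrho.
pose Q := expR m + m + 1.
have em : 0 < expR m by exact: expR_gt0.
have Q1 : 1 <= Q by rewrite /Q; lra.
exists (C * (12 * Q ^+ 4)) => [|x y t x' y' t' eps e0 B B' D].
  by rewrite mulr_gt0// mulr_gt0// exprn_gt0//; lra.
pose p i := x' i - x i; pose q i := y' i - y i; pose r i := t' i - t i.
pose c := chart_curve x y t p q r.
apply: (@le_trans _ _ (curve_length rho c)).
  apply: ereal_inf_lbound; exists c => //; split; first exact: chart_curve_C1.
  - by congr chart; apply/funext => i; rewrite mulr0 addr0.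
  - by congr chart; apply/funext => i; rewrite mulr1 /p /q /r addrC subrK.
have seg (u v s : R) : 0 <= s <= 1 -> `|u| <= m -> `|v| <= m -> `|u + (v - u) * s| <= m.
  move=> /andP[s0 s1] um vm; rewrite (_ : _ + _ = (1 - s) * u + s * v); last by ring.
  apply: le_trans (ler_normD _ _) _; rewrite !normrM (ger0_norm s0) ger0_norm ?subr_ge0//.
  have h1 : (1 - s) * `|u| <= (1 - s) * m by rewrite ler_wpM2l// subr_ge0.
  have h2 : s * `|v| <= s * m by rewrite ler_wpM2l.
  lra.
have expQ (u : R) : `|u| <= m -> `|expR u| <= Q /\ `|expR (- u)| <= Q.
  move=> um; rewrite !ger0_norm ?expR_ge0//.
  have h1 : expR u <= expR m by rewrite ler_expR (le_trans (ler_norm _)).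
  have h2 : expR (- u) <= expR m by rewrite ler_expR (le_trans (ler_norm _))// normrN.
  by rewrite /Q; split; lra.
have bound s : 0 <= s <= 1 -> Num.sqrt (rho (c s) (velocity c s) (velocity c s)) <= C * (12 * Q ^+ 4 * eps).
  move=> s01; apply: CP.
  - by rewrite mulr_ge0// mulr_ge0// exprn_ge0//; lra.
  - exact/velocity_tangent/chart_curve_C1.
  move=> i a b; have [x1 y1 t1] := B i; have [x2 y2 t2] := B' i; have [d1 d2 d3] := D i.
  have X1 := seg _ _ _ s01 x1 x2; have Y1 := seg _ _ _ s01 y1 y2; have T1 := seg _ _ _ s01 t1 t2.
  have [i00 i01 i10 i11] := slmx_inv (c s i).
  rewrite chart_curve_velocity.
  have cE a' b' : c s i a' b' = chart_mx (x i + p i * s) (y i + q i * s) (t i + r i * s) a' b'.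
    by rewrite ffunE.
  have [E1 E2] := expQ _ X1.
  rewrite !cE !mxE/= in i00 i01 i10 i11.
  have prod (u v U V : R) : `|u| <= U -> `|v| <= V -> `|u * v| <= U * V.
    by move=> uU vV; rewrite normrM; apply: ler_pM.
  have Y1Q : `|y i + q i * s| <= Q by apply: le_trans Y1 _; rewrite /Q; lra.
  have T1Q : `|t i + r i * s| <= Q by apply: le_trans T1 _; rewrite /Q; lra.
  have Q0 : 0 <= Q by lra.
  have eQ : 0 <= eps * Q by rewrite mulr_ge0.
  have Q2 : Q <= Q ^+ 2 by rewrite expr2 ler_peMr.
  have eQ1 : eps * 1 <= eps * Q by rewrite ler_wpM2l.
  have eQ2 : eps * Q <= eps * Q ^+ 2 by rewrite ler_wpM2l.
  have Ve a' b' : `|chart_velocity x y t p q r i s a' b'| <= 3 * (eps * Q ^+ 2).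
    have [->|->] := ord2P a'; have [->|->] := ord2P b'; rewrite mxE/=.
    - by have := prod _ _ _ _ d1 E1; lra.
    - have := prod _ _ _ _ (prod _ _ _ _ d1 E1) T1Q; have := prod _ _ _ _ E1 d3.
      rewrite -/(p i) -/(r i) => h1 h2; apply: le_trans (ler_normD _ _) _; lra.
    - by rewrite -/(q i) in d2; lra.
    - have := prod _ _ _ _ d2 T1Q; have := prod _ _ _ _ Y1Q d3; have := prod _ _ _ _ d1 E2.
      rewrite -/(p i) -/(r i) -/(q i) => h1 h2 h3.
      apply: le_trans (ler_normB _ _) _; apply: le_trans (lerD (ler_normD _ _) (lexx _)) _.
      lra.
  have Ie a' b' : `|slmx (c s i)^-1%g a' b'| <= 2 * Q ^+ 2.
    have YT := prod _ _ _ _ Y1Q T1Q; have ET := prod _ _ _ _ E1 T1Q.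
    have [->|->] := ord2P a'; have [->|->] := ord2P b'; rewrite ?i00 ?i01 ?i10 ?i11 ?normrN; try lra.
    by apply: le_trans (ler_normD _ _) _; lra.
  rewrite mulmx22; apply: le_trans (ler_normD _ _) _.
  have := prod _ _ _ _ (Ve a 0) (Ie 0 b); have := prod _ _ _ _ (Ve a 1) (Ie 1 b).
  rewrite (_ : 12 * Q ^+ 4 * eps = 3 * (eps * Q ^+ 2) * (2 * Q ^+ 2) + 3 * (eps * Q ^+ 2) * (2 * Q ^+ 2)); last by ring.
  by move=> h1 h2; apply: lerD.
apply: (@le_trans _ _ (\int[lebesgue_measure]_(s in `[0%R, 1%R]) (cst (C * (12 * Q ^+ 4 * eps))%:E s))%E).
  apply: ge0_le_integral_restrict => s /=; rewrite in_itv/=.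
  - by rewrite lee_fin sqrtr_ge0.
  - by rewrite lee_fin mulr_ge0 ?(ltW C0)// mulr_ge0// mulr_ge0// exprn_ge0//; lra.
  - by move=> s01; split=> //; rewrite lee_fin bound.
rewrite integral_cst//= lebesgue_measure_itv/= lte_fin ltr01 oppr0 adde0 mule1.
by rewrite lee_fin mulrA.
Qed.
End ChartDistance.

(** * Reduction theory *)

Section Lattice.
Variable R : realType.
Implicit Types (h g : SL2 R) (v w : R * R).

Definition act (A : 'M[R]_2) v : R * R :=
  (A 0 0 * v.1 + A 0 1 * v.2, A 1 0 * v.1 + A 1 1 * v.2).

Lemma act_mul A B v : act (A *m B) v = act A (act B v).
Proof. by rewrite /act !mulmx22/=; congr pair; ring. Qed.

Lemma area_act h : area_preserving (act h).
Proof.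
split=> [v w|v]; rewrite /det2 /act /opp2/=; last by congr pair; ring.
by have := sl2_det h; move: (h 0 0) (h 0 1) (h 1 0) (h 1 1) => a b c d D;
  rewrite -[RHS]mul1r -D; ring.
Qed.

(** The primitive integer vectors; the Bezout form of primitivity directly gives
    a completion to a basis. *)
Definition primitive_vectors : set (R * R) :=
  [set v | exists p q r s : int, p * s - q * r = 1 /\ v = (p%:~R, q%:~R)].

Lemma primitive_unimodular : unimodular_set primitive_vectors.
Proof.
split=> [_ [p [q [r [s [ps ->]]]]]|_ _ [p [q [r [s [ps ->]]]]] [p' [q' [r' [s' [ps' ->]]]]]].
  apply/negP => /eqP n0.
  have : norm2 (p%:~R, q%:~R) <= (0 : R) by rewrite n0.
  rewrite norm2_le/= !normr_le0 !intr_eq0 => /andP[/eqP p0 /eqP q0].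
  by move: ps; rewrite p0 q0 !mul0r.
rewrite /det2/= -!intrM -rmorphB/= -intr_norm.
rewrite (ltr_int _ _ 1) -abszE (ltz_nat _ 1) ltnS leqn0 absz_eq0 => /eqP/eqP; rewrite subr_eq0 => /eqP d0.
pose k := p' * s - q' * r.
have pk : p' = k * p.
  rewrite -[LHS]mulr1 -ps (_ : _ * _ = p' * p * s - r * (q * p')); last by ring.
  by rewrite -d0 /k; ring.
have qk : q' = k * q.
  rewrite -[LHS]mulr1 -ps (_ : _ * _ = s * (p * q') - q' * q * r); last by ring.
  by rewrite d0 /k; ring.
have : `|k|%N = 1%N.
  have kk : k * (p * s' - q * r') = 1 by rewrite -ps' pk qk; ring.
  by apply/eqP; rewrite -dvdn1; have := congr1 absz kk; rewrite abszM/= => <-; rewrite dvdn_mulr.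
move=> k1.
have [k1'|k1'] : k = 1 \/ k = -1 by lia.
  by left; rewrite pk qk k1' !mul1r.
by right; rewrite /opp2/= pk qk k1' !mulN1r !rmorphN.
Qed.

Definition lattice h : set (R * R) := act h @` primitive_vectors.

Lemma lattice_unimodular h : unimodular_set (lattice h).
Proof. exact: unimodular_image (area_act h) primitive_unimodular. Qed.

Lemma lattice_mul h g : lattice (h * g)%g = act h @` lattice g.
Proof.
rewrite /lattice image_comp; congr (_ @` _); apply/funext => v.
exact: act_mul.
Qed.

Definition mx22 (a b c d : R) : 'M[R]_2 := \matrix_(i, j)
  (if i == 0 then (if j == 0 then a else b) else (if j == 0 then c else d)).

Lemma mx22_ext (A : 'M[R]_2) : A = mx22 (A 0 0) (A 0 1) (A 1 0) (A 1 1).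
Proof.
by apply/matrixP => i j; rewrite mxE; have [->|->] := ord2P i; have [->|->] := ord2P j.
Qed.

Definition int_entries h := forall a b, h a b \is a Num.int.

Lemma integral_sl2 (p q r s : int) : p * s - q * r = 1 ->
  exists2 h, int_entries h & slmx h = mx22 p%:~R r%:~R q%:~R s%:~R.
Proof.
move=> ps; have D : \det (mx22 p%:~R r%:~R q%:~R s%:~R) == 1.
  by rewrite det_mx22 !mxE/= -!intrM -rmorphB/= [r * q]mulrC ps.
exists (MkSL2 D) => // a b; rewrite /= mxE.
by do 2?case: ifP => _; exact: intr_int.
Qed.

(** The height bounds the lengths of vectors from below. A vector [U] that is
    shortest up to a factor 3/2 extends to a basis, whose other vector [W] can be
    shortened by multiples of [U]; comparing [U] with the result [W'] shows that
    the length of [U] is at most 3. *)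
Lemma short_basis h (H : R) : height (lattice h) <= H ->
  exists2 g, int_entries g & forall a b, `|slmx (h * g)%g a b| <= 3 + H.
Proof.
move=> hH; have H1 : 1 <= H := le_trans (height_ge1 (lattice_unimodular h)) hH.
pose N := [set norm2 v | v in lattice h].
have e1 : primitive_vectors (1, 0).
  by exists 1, 0, 0, 1; rewrite mul0r subr0 mulr1.
have N0 : N !=set0 by exists (norm2 (act h (1, 0))); exists (act h (1, 0)) => //; exists (1, 0).
have Nlb v : lattice h v -> H^-1 <= norm2 v.
  move=> hv; have v0 := unimodular_gt0 (lattice_unimodular h) hv.
  rewrite invf_ple ?posrE//; last by lra.
  by apply: le_trans hH; exact: height_ge (lattice_unimodular h) hv.
have H0 : 0 < H^-1 by rewrite invr_gt0; lra.
have Ninf : has_inf N by split => //; exists H^-1 => _ [v hv <-]; exact: Nlb.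
have I0 : H^-1 <= inf N by apply: lb_le_inf => // _ [v hv <-]; exact: Nlb.
have [_ [_ [v [p [q [r [s [ps ->]]]]] <-] <-]] := @inf_adherent _ N (inf N / 2) (divr_gt0 (lt_le_trans H0 I0) (ltr0Sn R 1)) Ninf.
set U := act h _ => Umin.
have {}Umin w : lattice h w -> norm2 U <= 3 / 2 * norm2 w.
  move=> hw; apply: ltW (lt_le_trans Umin _).
  have : inf N <= norm2 w by apply: inf_lbound; [exact: Ninf.2|exists w].
  lra.
have U0 : H^-1 <= norm2 U by apply: Nlb; exists (p%:~R, q%:~R) => //; exists p, q, r, s.
pose W := act h (r%:~R, s%:~R).
have UW : U.1 * W.2 - U.2 * W.1 = 1.
  have := (area_act h).1 (p%:~R, q%:~R) (r%:~R, s%:~R); rewrite /det2 -/U -/W => ->.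
  by rewrite /= -!intrM -rmorphB/= ps.
pose n2 := U.1 ^+ 2 + U.2 ^+ 2; set nU := norm2 U in Umin U0.
have nU0 : 0 < nU by apply: lt_le_trans U0.
have n2U : nU ^+ 2 <= n2.
  have sq (x y : R) : `|x| ^+ 2 <= x ^+ 2 + y ^+ 2 by rewrite real_normK ?num_real// lerDl sqr_ge0.
  rewrite /nU /norm2; case: (leP `|U.1| `|U.2|) => _; last exact: sq.
  by rewrite /n2 addrC; exact: sq.
have n20 : 0 < n2 by apply: lt_le_trans n2U; rewrite exprn_gt0.
pose tau := (W.1 * U.1 + W.2 * U.2) / n2; pose k := Num.floor (tau + 1 / 2).
have /andP[k1 k2] := floor_itv (tau + 1 / 2).
pose W' := act h ((r - k * p)%:~R, (s - k * q)%:~R).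
have tau_k : `|tau - k%:~R| <= 1 / 2.
  by rewrite ler_norml; move: k1 k2; rewrite -/k rmorphD/=; lra.
have tn : tau * n2 = W.1 * U.1 + W.2 * U.2 by rewrite /tau divfK ?gt_eqF.
have tau1 : W.1 = tau * U.1 - U.2 / n2.
  apply: (mulIf (lt0r_neq0 n20)); rewrite mulrBl divfK ?gt_eqF// [tau * _ * _]mulrAC tn.
  apply/eqP; rewrite -subr_eq0 (_ : _ - _ = - U.2 * (U.1 * W.2 - U.2 * W.1 - 1)); last by rewrite /n2; ring.
  by rewrite UW subrr mulr0.
have tau2 : W.2 = tau * U.2 + U.1 / n2.
  apply: (mulIf (lt0r_neq0 n20)); rewrite [RHS]mulrDl divfK ?gt_eqF// [tau * _ * _]mulrAC tn.
  apply/eqP; rewrite -subr_eq0 (_ : _ - _ = U.1 * (U.1 * W.2 - U.2 * W.1 - 1)); last by rewrite /n2; ring.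
  by rewrite UW subrr mulr0.
have W'1 : W'.1 = (tau - k%:~R) * U.1 - U.2 / n2.
  have -> : W'.1 = W.1 - k%:~R * U.1 by rewrite /W' /W /U /= !rmorphB/= !rmorphM/=; ring.
  by rewrite {1}tau1; ring.
have W'2 : W'.2 = (tau - k%:~R) * U.2 + U.1 / n2.
  have -> : W'.2 = W.2 - k%:~R * U.2 by rewrite /W' /W /U /= !rmorphB/= !rmorphM/=; ring.
  by rewrite {1}tau2; ring.
have small x : `|x| <= nU -> `|x / n2| <= nU^-1.
  move=> xU; rewrite normf_div (gtr0_norm n20) ler_pdivrMr//.
  apply: le_trans xU _; rewrite ler_pdivlMl// -expr2; exact: n2U.
have prod x : `|x| <= nU -> `|(tau - k%:~R) * x| <= 1 / 2 * nU.
  by move=> xU; rewrite normrM; apply: ler_pM.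
have W'le : norm2 W' <= 1 / 2 * nU + nU^-1.
  rewrite norm2_le W'1 W'2; apply/andP; split.
    apply: le_trans (ler_normB _ _) _; apply: lerD; [apply: prod|apply: small].
      exact: norm2_fst.
    exact: norm2_snd.
  apply: le_trans (ler_normD _ _) _; apply: lerD; [apply: prod|apply: small].
    exact: norm2_snd.
  exact: norm2_fst.
have hW' : lattice h W'.
  exists ((r - k * p)%:~R, (s - k * q)%:~R) => //.
  exists (r - k * p), (s - k * q), (- p), (- q); split=> //.
  by rewrite -ps; ring.
have nU3 : nU <= 3.
  have h1 := Umin _ hW'; rewrite leNgt; apply/negP => U3.
  have : nU^-1 <= 1 / 3 by rewrite div1r lef_pV2 ?posrE ?ltW.
  lra.
have W'3 : norm2 W' <= 3 + H.
  have : nU^-1 <= H by rewrite invf_ple ?posrE//; lra.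
  lra.
have [|g gint gE] := @integral_sl2 p q (r - k * p) (s - k * q).
  by rewrite -ps; ring.
exists g => // a b.
have -> : slmx (h * g)%g = mx22 U.1 W'.1 U.2 W'.2.
  rewrite [slmx (h * g)%g]/(slmx h *m slmx g) gE [LHS]mx22_ext !mulmx22 !mxE/=.
  by rewrite /U /W' /act/=.
have U1 := norm2_fst U; have U2 := norm2_snd U; have W1 := norm2_fst W'; have W2 := norm2_snd W'.
by rewrite -/nU in U1 U2; rewrite mxE; case: ifP => _; case: ifP => _; lra.
Qed.

(** Every matrix is equivalent to one in the range of the chart, with parameters
    bounded in terms of the height: one of the two columns of a short basis has
    a large first entry. *)
Lemma chart_reduction (H : R) : exists2 m : R, 0 <= m & forall h, height (lattice h) <= H ->
  exists2 g, int_entries g & exists x y t : R,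
    [/\ `|x| <= m, `|y| <= m, `|t| <= m & (h * g)%g = chart_sl2 x y t].
Proof.
pose M := 3 + `|H|; have M3 : 3 <= M by rewrite /M lerDl.
exists (2 * M ^+ 2) => [|h hH]; first by rewrite mulr_ge0// sqr_ge0.
have M2 : M <= 2 * M ^+ 2 by rewrite expr2; nra.
have [g gint gM] := short_basis hH.
have {}gM a b : `|slmx (h * g)%g a b| <= M by apply: le_trans (gM a b) _; rewrite lerD2l ler_norm.
have final g' : int_entries g' -> (forall a b, `|slmx (h * g')%g a b| <= M) ->
    1 / (2 * M) <= slmx (h * g')%g 0 0 -> exists2 g, int_entries g & exists x y t : R,
    [/\ `|x| <= 2 * M ^+ 2, `|y| <= 2 * M ^+ 2, `|t| <= 2 * M ^+ 2 & (h * g)%g = chart_sl2 x y t].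
  move=> g'int g'M a0; exists g' => //; have D := sl2_det (h * g')%g.
  have M0 : 0 < 2 * M by lra.
  set A := slmx (h * g')%g in g'M a0 D.
  have A0 : 0 < A 0 0 by apply: lt_le_trans a0; rewrite divr_gt0.
  exists (ln (A 0 0)), (A 1 0), (A 0 1 / A 0 0); split.
  - rewrite ler_norml; apply/andP; split.
      rewrite lerNl -lnV ?posrE//; apply: le_trans (ltW (ln_sublinear _)) _; first by rewrite invr_gt0.
      rewrite invf_ple ?posrE ?(lt_le_trans _ M2)//; last by lra.
      apply: le_trans a0; rewrite -div1r ler_pdivrMr; last by lra.
      rewrite mulrAC ler_pdivlMr// mul1r; nra.
    apply: le_trans (ltW (ln_sublinear A0)) _; apply: le_trans M2.
    by apply: le_trans (ler_norm _) (g'M 0 0).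
  - exact: le_trans (g'M 1 0) M2.
  - rewrite normf_div (gtr0_norm A0) ler_pdivrMr//.
    apply: le_trans (g'M 0 1) _.
    have E : 2 * M ^+ 2 * (1 / (2 * M)) = M by field; lra.
    by rewrite -[leLHS]E; apply: ler_wpM2l => //; rewrite mulr_ge0// sqr_ge0.
  - apply: val_inj; rewrite /= -/A [LHS]mx22_ext.
    have eA : expR (ln (A 0 0)) = A 0 0 by rewrite lnK ?posrE.
    apply/matrixP => a b; rewrite [LHS]mxE [RHS]mxE.
    have [->|->] := ord2P a; have [->|->] := ord2P b; rewrite /= ?expRN ?eA//.
      by rewrite mulrC divfK ?gt_eqF.
    by rewrite -[X in _ + X]mul1r -D; field; rewrite gt_eqF.
have mulE (p q r s : int) (k : SL2 R) : slmx k = mx22 p%:~R r%:~R q%:~R s%:~R -> forall a,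
    slmx (h * (g * k))%g a 0 = slmx (h * g)%g a 0 * p%:~R + slmx (h * g)%g a 1 * q%:~R /\
    slmx (h * (g * k))%g a 1 = slmx (h * g)%g a 0 * r%:~R + slmx (h * g)%g a 1 * s%:~R.
  move=> kE a; rewrite mulgA [slmx (h * g * k)%g]/(slmx (h * g)%g *m slmx k) kE.
  by rewrite !mulmx22 !mxE/=.
have intM (k k' : SL2 R) : int_entries k -> int_entries k' -> int_entries (k * k')%g.
  by move=> kint k'int a b; rewrite [slmx _]/(slmx k *m slmx k') mulmx22 rpredD// rpredM.
have D := sl2_det (h * g)%g.
have case_sign (p q r s : int) (k : SL2 R) : int_entries k -> slmx k = mx22 p%:~R r%:~R q%:~R s%:~R ->
   (p = 0 \/ q = 0) /\ (r = 0 \/ s = 0) -> `|p| <= 1 -> `|q| <= 1 -> `|r| <= 1 -> `|s| <= 1 ->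
   1 / (2 * M) <= slmx (h * g)%g 0 0 * p%:~R + slmx (h * g)%g 0 1 * q%:~R ->
   exists2 g, int_entries g & exists x y t : R,
    [/\ `|x| <= 2 * M ^+ 2, `|y| <= 2 * M ^+ 2, `|t| <= 2 * M ^+ 2 & (h * g)%g = chart_sl2 x y t].
  move=> kint kE [pq rs] p1 q1 r1 s1 big.
  apply: (final (g * k)%g) => [|a b|]; [exact: intM| |by have [-> _] := mulE _ _ _ _ _ kE 0].
  have ent (i j : int) : i = 0 \/ j = 0 -> `|i| <= 1 -> `|j| <= 1 ->
      `|slmx (h * g)%g a 0 * i%:~R + slmx (h * g)%g a 1 * j%:~R| <= M.
    have one (u v : R) (j' : int) : `|u| <= M -> `|j'| <= 1 -> `|u * j'%:~R| <= M.
      move=> uM j1; rewrite normrM -[leRHS]mulr1; apply: ler_pM => //.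
      by rewrite -intr_norm (ler_int _ _ 1).
    by move=> [->|->] i1 j1; rewrite mulr0 ?add0r ?addr0; apply: one.
  have [E0 E1] := mulE _ _ _ _ _ kE a.
  by have [->|->] := ord2P b; rewrite ?E0 ?E1; exact: ent.
have M0 : 0 < 2 * M by lra.
have [big|sm] := leP (1 / (2 * M)) `|slmx (h * g)%g 0 0|.
  have [a0|a0] := leP 0 (slmx (h * g)%g 0 0).
    have [//|k kint kE] := @integral_sl2 1 0 0 1.
    apply: (case_sign _ _ _ _ k kint kE); rewrite ?normr0 ?normr1//; first by split; [right|left].
    by rewrite mulr1 mulr0 addr0 -(ger0_norm a0).
  have [//|k kint kE] := @integral_sl2 (- 1) 0 0 (- 1).
  apply: (case_sign _ _ _ _ k kint kE); rewrite ?normrN ?normr0 ?normr1//; first by split; [right|left].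
  by rewrite rmorphN mulrN mulr1 mulr0 addr0 -(ltr0_norm a0).
have big : 1 / (2 * M) <= `|slmx (h * g)%g 0 1|.
  rewrite leNgt; apply/negP => sm1.
  have h1 : `|slmx (h * g)%g 0 0 * slmx (h * g)%g 1 1| <= 1 / (2 * M) * M.
    by rewrite normrM; apply: ler_pM => //; exact: ltW.
  have h2 : `|slmx (h * g)%g 0 1 * slmx (h * g)%g 1 0| < 1 / (2 * M) * M.
    rewrite normrM; apply: le_lt_trans (ler_wpM2l (normr_ge0 _) (gM 1 0)) _.
    by rewrite ltr_pM2r//; lra.
  have E : 1 / (2 * M) * M = 1 / 2 by field; lra.
  have := ler_normB (slmx (h * g)%g 0 0 * slmx (h * g)%g 1 1) (slmx (h * g)%g 0 1 * slmx (h * g)%g 1 0).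
  rewrite D normr1; lra.
have [a0|a0] := leP 0 (slmx (h * g)%g 0 1).
  have [//|k kint kE] := @integral_sl2 0 1 (- 1) 0.
  apply: (case_sign _ _ _ _ k kint kE); rewrite ?normrN ?normr0 ?normr1//; first by split; [left|right].
  by rewrite mulr1 mulr0 add0r -(ger0_norm a0).
have [//|k kint kE] := @integral_sl2 0 (- 1) 1 0.
apply: (case_sign _ _ _ _ k kint kE); rewrite ?normrN ?normr0 ?normr1//; first by split; [left|right].
by rewrite rmorphN mulrN mulr1 mulr0 add0r -(ltr0_norm a0).
Qed.
End Lattice.

(** * Compactness and divergence in the quotient *)

HB.instance Definition _ (R : realType) (n : nat) :=
  isPointed.Build (GGamma R n) (coset_pi 1%g).

Section Cusp.
Variables (R : realType) (n : nat).
Implicit Types (g h : Gn R n) (K : set (GGamma R n)).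

Lemma Gn_continuous (X : topologicalType) (f : X -> Gn R n) :
  (forall i a b, continuous (fun x => slmx (f x i) a b)) -> continuous f.
Proof.
move=> cf; apply: (@continuous_comp_initial _ _ _ (@Gn_prod R n) f) => x.
apply/cvg_sup => i; move: x; apply: (@continuous_comp_initial _ _ _ _ (fun x => Gn_prod (f x))) => x /=.
move: x; apply: (@continuous_comp_initial _ _ _ (@slmx R) (fun x => f x i)) => x.
by apply: cvg_mx_entries => a b; exact: cf.
Qed.

Lemma entry_Gn_continuous i a b : continuous (fun g => slmx (g i) a b).
Proof.
move=> g; pose f1 : Gn R n -> prod_topology (fun _ : 'I_n => SL2 R) := @Gn_prod R n.
have c1 : continuous f1 by exact: initial_continuous.
have c2 : continuous (fun h : prod_topology (fun _ : 'I_n => SL2 R) => h i) by exact: proj_continuous.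
have c3 : continuous (@slmx R : SL2 R -> 'M[R]_2) by exact: initial_continuous.
have c4 : continuous (fun M : 'M[R]_2 => M a b) by exact: coord_continuous.
have c : {for g, continuous ((fun M : 'M[R]_2 => M a b) \o ((@slmx R : SL2 R -> 'M[R]_2) \o
    ((fun h : prod_topology (fun _ : 'I_n => SL2 R) => h i) \o f1)))}.
  apply: continuous_comp; last exact: c4.
  apply: continuous_comp; last exact: c3.
  by apply: continuous_comp; [exact: c1|exact: c2].
exact: c.
Qed.

Lemma coset_pi_continuous : continuous (@coset_pi R n).
Proof. exact: pi_continuous. Qed.

Lemma coset_pi_integral g h : (forall i, int_entries (h i)) -> coset_pi (g * h)%g = coset_pi g.
Proof.
move=> hi; apply/esym/coset_piP; rewrite /Gamma_rel mulKg.
by apply/GammaP => i a b; exact: hi.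
Qed.

Lemma coset_pi_eq g h : coset_pi g = coset_pi h ->
  exists2 k : Gn R n, forall i, int_entries (k i) & h = (g * k)%g.
Proof.
move=> /coset_piP gh; exists (g^-1 * h)%g; last by rewrite mulVKg.
by move=> i a b; exact: (GammaP _ gh).
Qed.

Lemma chart_representative (H : 'I_n -> R) : exists2 m : R, 0 <= m &
  forall g, (forall i, height (lattice (g i)) <= H i) -> 
  exists x y t, (forall i, [/\ `|x i| <= m, `|y i| <= m & `|t i| <= m]) /\ coset_pi g = coset_pi (chart x y t).
Proof.
have /boolp.choice[m mP] : forall i, exists m : R, 0 <= m /\ forall h : SL2 R, height (lattice h) <= H i ->
  exists2 g : SL2 R, int_entries g & exists x y t : R,
    [/\ `|x| <= m, `|y| <= m, `|t| <= m & (h * g)%g = chart_sl2 x y t].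
  by move=> i; have [m m0 mP] := chart_reduction (H i); exists m.
pose m' := \sum_i m i.
have mm' i : m i <= m' by rewrite /m' (bigD1 i)//= lerDl sumr_ge0// => j _; exact: (mP j).1.
exists m' => [|g gH]; first by apply: sumr_ge0 => j _; exact: (mP j).1.
have /boolp.choice[k kP] : forall i, exists k : SL2 R * (R * R * R), 
   int_entries k.1 /\ [/\ `|k.2.1.1| <= m i, `|k.2.1.2| <= m i, `|k.2.2| <= m i &
     (g i * k.1)%g = chart_sl2 k.2.1.1 k.2.1.2 k.2.2].
  by move=> i; have [h hint [x [y [t xyt]]]] := (mP i).2 _ (gH i); exists (h, (x, y, t)).
exists (fun i => (k i).2.1.1), (fun i => (k i).2.1.2), (fun i => (k i).2.2); split.
  by move=> i; have [_ [h1 h2 h3 _]] := kP i; split; apply: le_trans (mm' i).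
rewrite -(@coset_pi_integral g [ffun i => (k i).1]) => [|i]; last by rewrite ffunE; exact: (kP i).1.
congr coset_pi; apply/ffunP => i; rewrite ffunE [RHS]ffunE ffunE.
by have [_ []] := kP i.
Qed.

(** Mahler's criterion: where the heights are bounded, the quotient is covered by
    the image of a compact set of parameters. *)
Lemma mahler (H : R) : exists2 K, compact K &
  forall g, (forall i, height (lattice (g i)) <= H) -> K (coset_pi g).
Proof.
have [m m0 mP] := chart_representative (fun=> H).
pose X := prod_topology (fun _ : 'I_n * 'I_3 => R : topologicalType).
pose F (z : X) := coset_pi (chart (fun i => z (i, 0)) (fun i => z (i, 1)) (fun i => z (i, 2))).
pose Box : set X := [set z | forall k, `[- m, m]%classic (z k)].
have cBox : compact Box.
  have := @tychonoff ('I_n * 'I_3)%type (fun _ => R : topologicalType) (fun _ => `[- m, m]%classic).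
  by apply => k; exact: segment_compact.
exists (F @` Box).
  apply: continuous_compact => //; apply: continuous_subspaceT => z.
  apply: continuous_comp; last exact: coset_pi_continuous.
  move: z; apply: Gn_continuous => i a b z.
  have cz k : (fun z : X => z k) @ z --> z k by exact: proj_continuous.
  have cexp k : (fun z : X => expR (z k)) @ z --> expR (z k).
    by apply: (cvg_comp _ _ (cz k)); exact: continuous_expR.
  have cexpN k : (fun z : X => expR (- z k)) @ z --> expR (- z k).
    by apply: (cvg_comp _ _ (cvgN (cz k))); exact: continuous_expR.
  pose G a b (z : X) : R := chart_mx (z (i, 0)) (z (i, 1)) (z (i, 2)) a b.
  suff cG : G a b @ z --> G a b z.
    have E : (fun x : X => slmx (chart (fun i => x (i, 0)) (fun i => x (i, 1)) (fun i => x (i, 2)) i) a b) = G a b.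
      by apply/funext => u; rewrite ffunE.
    by move: cG; rewrite -E.
  case: (ord2P a) (ord2P b) => -> [->|->].
  - have -> : G 0 0 = fun z => expR (z (i, 0)) by apply/funext => u; rewrite /G mxE.
    exact: (cexp (i, 0)).
  - have -> : G 0 1 = fun z => expR (z (i, 0)) * z (i, 2) by apply/funext => u; rewrite /G mxE.
    exact: cvgM (cexp (i, 0)) (cz (i, 2)).
  - have -> : G 1 0 = fun z => z (i, 1) by apply/funext => u; rewrite /G mxE.
    exact: (cz (i, 1)).
  - have -> : G 1 1 = fun z => z (i, 1) * z (i, 2) + expR (- z (i, 0)) by apply/funext => u; rewrite /G mxE.
    exact: cvgD (cvgM (cz (i, 1)) (cz (i, 2))) (cexpN (i, 0)).
move=> g /mP[x [y [t [xyt ->]]]].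
exists (fun k => if k.2 == 0 then x k.1 else if k.2 == 1 then y k.1 else t k.1) => //.
move=> [i k] /=; rewrite in_itv/= -ler_norml; have [h1 h2 h3] := xyt i.
by case: ifP => _ //; case: ifP.
Qed.

(** Conversely, a compact set is covered by the image of a bounded open set of
    matrices. *)
Lemma compact_bounded K : compact K -> exists2 m : R, 0 < m &
  forall g, K (coset_pi g) -> exists k : Gn R n, (forall i, int_entries (k i)) /\
    forall i a b, `|slmx ((g * k)%g i) a b| < m.
Proof.
rewrite compact_cover => cK.
pose S g := \sum_(i < n) \sum_(a < 2) \sum_(b < 2) `|slmx (g i) a b|.
have Sle g i a b : `|slmx (g i) a b| <= S g.
  rewrite /S (bigD1 i)//= (bigD1 a)//= (bigD1 b)//= -!addrA lerDl.
  by rewrite !addr_ge0// !sumr_ge0// => *; rewrite !sumr_ge0// => *; rewrite sumr_ge0.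
have cS (k : Gn R n) : continuous (fun g => S (g * k)%g).
  apply: continuous_big => [|i _]; first exact: add_continuous.
  apply: continuous_big => [|a _]; first exact: add_continuous.
  apply: continuous_big => [|b _]; first exact: add_continuous.
  suff c : continuous (fun g : Gn R n => slmx ((g * k)%g i) a b).
    move=> g; have cn : {for g, continuous ((fun r : R => `|r|) \o (fun g : Gn R n => slmx ((g * k)%g i) a b))}.
      by apply: continuous_comp; [exact: c|exact: norm_continuous].
    exact: cn.
  have -> : (fun g : Gn R n => slmx ((g * k)%g i) a b) = fun g => slmx (g i) a 0 * slmx (k i) 0 b + slmx (g i) a 1 * slmx (k i) 1 b.
    by apply/funext => u; rewrite ffunE [slmx _]/(slmx (u i) *m slmx (k i)) mulmx22.
  move=> g; have h b' := @entry_Gn_continuous i a b' g.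
  exact: (cvgD (cvgM (h 0) (cvg_cst (slmx (k i) 0 b))) (cvgM (h 1) (cvg_cst (slmx (k i) 1 b)))).
pose O (m : nat) : set (GGamma R n) := [set x | exists g (k : Gn R n),
  [/\ x = coset_pi g, forall i, int_entries (k i) & S (g * k)%g < m%:R]].
have Oopen m : open (O m).
  have -> : open (O m) = open (@coset_pi R n @^-1` O m) by [].
  have -> : @coset_pi R n @^-1` O m = \bigcup_(k in [set k : Gn R n | forall i, int_entries (k i)])
      [set g | S (g * k)%g < m%:R].
    apply/seteqP; split=> [g [h [k [/coset_pi_eq[k' k'int hE] kint Sm]]]|g [k kint Sm]].
      exists (k' * k)%g => [i a b|] /=.
        by rewrite ffunE [slmx _]/(slmx (k' i) *m slmx (k i)) mulmx22 rpredD// rpredM//; [exact: k'int|exact: kint|exact: k'int|exact: kint].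
      by rewrite mulgA -hE.
    by exists g, k.
  apply: bigcup_open => k _.
  have -> : [set g | S (g * k)%g < m%:R] = (fun g => S (g * k)%g) @^-1` [set r | r < m%:R] by [].
  by apply: open_comp; [move=> g _; exact: cS|exact: open_lt].
have KO : K `<=` cover setT O.
  move=> x _; exists (Num.truncn (S (repr x))).+1 => //.
  exists (repr x), 1%g; split; [by rewrite /coset_pi reprK| |by rewrite mulg1 truncnS_gt].
  by move=> i a b; rewrite ffunE mxE; case: (a == b).
have [D _ KD] := cK _ _ _ (fun m _ => Oopen m) KO.
pose M := \max_(m <- finmap.enum_fset D) m.
exists (M.+1)%:R => [|g Kg]; first by rewrite ltr0n.
have [m /= mD [h [k [gh kint Sm]]]] := KD _ Kg.
have [k' k'int hE] := coset_pi_eq gh.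
exists (k' * k)%g; split=> [i a b|i a b].
  by rewrite ffunE [slmx _]/(slmx (k' i) *m slmx (k i)) mulmx22 rpredD// rpredM//; [exact: k'int|exact: kint|exact: k'int|exact: kint].
rewrite mulgA -hE; apply: le_lt_trans (Sle _ _ _ _) _; apply: lt_trans Sm _.
rewrite ltr_nat ltnS. apply: (@leq_bigmax_seq nat _ xpredT (fun m => m)) => //.
Qed.

Lemma act_diag_flow (t : R) : act (diag_flow t) = dilate (expR (t / 2)).
Proof.
apply/funext => v; rewrite /act /dilate /= !mxE/= !mulr0n !mulr1n !mul0r addr0 add0r.
by rewrite mulNr expRN [_ * v.2]mulrC.
Qed.

Lemma flow_coset_pi (t : R) g : flow t (coset_pi g) = coset_pi [ffun i => diag_flow t * g i]%g.
Proof. by rewrite flow_pi; congr coset_pi; apply/ffunP => i; rewrite !ffunE. Qed.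

Lemma divergent_height g (H : R) : divergent_set R n (coset_pi g) ->
  exists T : R, forall t, T < t -> exists i, H < height (lattice (diag_flow t * g i)%g).
Proof.
move=> Dg; have [K cK KP] := mahler H; have [T TP] := Dg K cK.
exists T => t /TP nK; apply: contrapT => no; apply: nK; rewrite flow_coset_pi; apply: KP => i.
by rewrite ffunE leNgt; apply/negP => hi; apply: no; exists i.
Qed.

Lemma norm2_act_inv (h : SL2 R) (m : R) v : (forall a b, `|slmx h a b| <= m) ->
  norm2 v <= 2 * m * norm2 (act h v).
Proof.
move=> hm; have D := sl2_det h; set w := act h v.
have le (a b c d : R) : `|a| <= m -> `|b| <= m -> `|a * w.1 + b * w.2| <= 2 * m * norm2 w.
  move=> am bm; apply: le_trans (ler_normD _ _) _; rewrite !normrM.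
  have := ler_pM (normr_ge0 _) (normr_ge0 _) am (norm2_fst w).
  have := ler_pM (normr_ge0 _) (normr_ge0 _) bm (norm2_snd w); lra.
rewrite norm2_le; apply/andP; split.
  have -> : v.1 = slmx h 1 1 * w.1 + (- slmx h 0 1) * w.2 by rewrite /w /act/= -[LHS]mul1r -D; ring.
  by apply: le; rewrite ?normrN.
have -> : v.2 = - slmx h 1 0 * w.1 + slmx h 0 0 * w.2 by rewrite /w /act/= -[LHS]mul1r -D; ring.
by apply: le; rewrite ?normrN.
Qed.

(** A trajectory diverges as soon as some integer vectors become short. *)
Lemma short_vectors_divergent g :
  (forall eps : R, 0 < eps -> exists T : R, forall t, T < t -> exists i (p q : int),
     (p != 0) || (q != 0) /\ norm2 (act (diag_flow t * g i)%g (p%:~R, q%:~R)) < eps) ->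
  divergent_set R n (coset_pi g).
Proof.
move=> short K cK; have [m m0 mP] := compact_bounded cK.
have [|T TP] := short (1 / (2 * m)); first by rewrite divr_gt0// mulr_gt0.
exists T => t /TP[i [p [q [pq vs]]]]; rewrite flow_coset_pi => /mP[k [kint km]].
set B := (diag_flow t * g i)%g in vs.
set v := (p%:~R, q%:~R) in vs; pose w := act (k i)^-1%g v.
have Bw : act B v = act (B * k i)%g w.
  by rewrite /w -act_mul -[slmx _ *m slmx _]/(slmx (B * k i * (k i)^-1)%g) mulgK.
have vw : v = act (k i) w.
  rewrite /w -act_mul -[slmx _ *m slmx _]/(slmx (k i * (k i)^-1)%g) mulgV /act /= !mxE/=.
  by rewrite !mul1r !mul0r addr0 add0r.
have w1 : norm2 w < 1.
  have Bk a b : `|slmx (B * k i)%g a b| <= m by have := km i a b; rewrite ffunE ffunE => /ltW.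
  apply: le_lt_trans (norm2_act_inv w Bk) _; rewrite -Bw.
  by rewrite -ltr_pdivlMl ?mulr_gt0// mulrC.
have [i00 i01 i10 i11] := slmx_inv (k i).
have int1 : w.1 \is a Num.int by rewrite /w/= i00 i01 rpredD// rpredM ?rpredN ?intr_int//; exact: kint.
have int2 : w.2 \is a Num.int by rewrite /w/= i10 i11 rpredD// rpredM ?rpredN ?intr_int//; exact: kint.
move: w1; rewrite norm2_lt => /andP[w11 w21].
have z1 : w.1 = 0 by apply/eqP/negPn/negP => /(norm_intr_ge1 int1); rewrite leNgt w11.
have z2 : w.2 = 0 by apply/eqP/negPn/negP => /(norm_intr_ge1 int2); rewrite leNgt w21.
move: vw; rewrite /act z1 z2 !mulr0 addr0 => -[/eqP + /eqP]; rewrite !intr_eq0 => p0 q0.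
by rewrite p0 q0 in pq.
Qed.

(** The lower triangular factor of the chart only changes heights by a bounded
    factor along the forward trajectory, as the flow contracts it. *)
Lemma height_chart (m t x y th : R) : 0 <= t -> `|x| <= m -> `|y| <= m ->
  height (lattice (diag_flow t * chart_sl2 x y th)%g) <=
  2 * (expR m + m) * height ((dilate (expR (t / 2)) \o shear th) @` @primitive_vectors R).
Proof.
move=> t0 xm ym; have m0 : 0 <= m by apply: le_trans xm.
have D : \det (mx22 (expR x) 0 (expR (- t) * y) (expR (- x))) == 1.
  by rewrite det_mx22 !mxE/= -expRD subrr expR0 mul0r subr0.
have em : 1 <= expR m by rewrite -expR0 ler_expR.
have E : lattice (diag_flow t * chart_sl2 x y th)%g =
    act (MkSL2 D) @` ((dilate (expR (t / 2)) \o shear th) @` @primitive_vectors R).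
  rewrite lattice_mul act_diag_flow /lattice !image_comp; congr (_ @` _); apply/funext => v.
  have tt : expR (- t) = (expR (t / 2))^-1 * (expR (t / 2))^-1 by rewrite -expRN -expRD; congr expR; lra.
  rewrite /dilate /shear /act /= !mxE/= tt; congr pair; first by ring.
  by field; rewrite gt_eqF// expR_gt0.
rewrite E; apply: height_image_le.
- lra.
- apply: unimodular_image; last exact: primitive_unimodular.
  apply: area_comp (area_dilate _) (area_shear _).
  by rewrite gt_eqF// expR_gt0.
move=> v _; apply: norm2_act_inv => a b; rewrite /= mxE.
have [->|->] := ord2P a; have [->|->] := ord2P b; rewrite /=.
- rewrite ger0_norm ?expR_ge0//; have : expR x <= expR m by rewrite ler_expR (le_trans (ler_norm _)).
  lra.
- by rewrite normr0; lra.
- rewrite normrM ger0_norm ?expR_ge0//.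
  have : expR (- t) * `|y| <= 1 * m by apply: ler_pM; rewrite ?expR_ge0// -expR0 ler_expR; lra.
  lra.
- rewrite ger0_norm ?expR_ge0//; have : expR (- x) <= expR m by rewrite ler_expR (le_trans (ler_norm _))// normrN.
  lra.
Qed.

Lemma divergent_chart_high L (m : R) (x y th : 'I_n -> R) : (0 < L)%N ->
  (forall i, `|x i| <= m /\ `|y i| <= m) -> divergent_set R n (coset_pi (chart x y th)) ->
  exists N0, forall j, (N0 <= j)%N -> exists i,
    2 * (2 ^ L)%:R <= height (orbit_map (2 ^ L)%:R j (th i) @` @primitive_vectors R).
Proof.
move=> L0 xy Dg; have [T TP] := divergent_height (2 * (expR m + m) * (2 * (2 ^ L)%:R)) Dg.
have A0 := @pow2_gt0 R L.
have l0 : 0 < ln (2 ^ L)%:R :> R by rewrite ln_gt0// ltr1n -[X in (X < _)%N](expn0 2) ltn_exp2l.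
exists (Num.truncn (`|T| / (2 * ln (2 ^ L)%:R))).+1 => j Nj.
pose t := 2 * (j%:R * ln (2 ^ L)%:R) : R.
have tT : T < t.
  apply: le_lt_trans (ler_norm _) _.
  rewrite /t (_ : 2 * _ = j%:R * (2 * ln (2 ^ L)%:R)); last by ring.
  rewrite -ltr_pdivrMr ?mulr_gt0//; apply: lt_le_trans (truncnS_gt _) _.
  by rewrite ler_nat.
have t0 : 0 <= t by rewrite !mulr_ge0 ?(ltW l0).
have [i hi] := TP _ tT; exists i.
have [xm ym] := xy i; have m0 : 0 <= m by apply: le_trans xm.
have := lt_le_trans hi _; rewrite ffunE.
have := height_chart (th i) t0 xm ym => /[swap] /[apply].
have c0 : 0 < 2 * (expR m + m) by rewrite mulr_gt0// ltr_wpDr// expR_gt0.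
rewrite ltr_pM2l// => /ltW; rewrite /orbit_map.
have -> // : expR (t / 2) = (2 ^ L)%:R ^+ j.
rewrite /t mulrAC divff// mul1r mulr_natl -lnXn// lnK// posrE exprn_gt0//.
Qed.

End Cusp.

(** * Hausdorff null sets *)

Section HausdorffNull.
Context {R : realType} {T : Type}.
Variable d : T -> T -> \bar R.

Lemma diameter_set0 : diameter d set0 = -oo%E.
Proof.
rewrite /diameter (_ : _ @` _ = set0) ?ereal_sup0//.
by apply/seteqP; split=> // x [[a b] []].
Qed.

Lemma hausdorff_weight_ge0 s U : (0 <= hausdorff_weight d s U)%E.
Proof. by rewrite /hausdorff_weight; case: ifP => // _; exact: poweR_ge0. Qed.

Lemma hausdorff_weight_le s U (r : R) : (forall x, 0 <= d x x)%E -> 0 <= s -> 0 <= r ->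
  (diameter d U <= r%:E)%E -> (hausdorff_weight d s U <= (r `^ s)%:E)%E.
Proof.
move=> d0 s0 r0 Ur; rewrite /hausdorff_weight; case: ifPn => [_|U0].
  by rewrite lee_fin powR_ge0.
rewrite -poweR_EFin; apply: gt0_ler_poweR => //; rewrite in_itv/= leey andbT ?lee_fin//.
move/set0P: U0 => [x Ux]; apply: le_trans (d0 x) _.
by apply: ereal_sup_ubound; exists (x, x).
Qed.

Lemma ler_sum_uniq_subset (I : eqType) (s1 s2 : seq I) (f : I -> R) : uniq s1 -> uniq s2 ->
  {subset s1 <= s2} -> (forall i, 0 <= f i) -> \sum_(i <- s1) f i <= \sum_(i <- s2) f i.
Proof.
move=> u1 u2 s12 f0; rewrite [leRHS](bigID (mem s1))/= -[leLHS]addr0 lerD//; last exact: sumr_ge0.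
rewrite le_eqVlt; apply/orP; left; apply/eqP; rewrite -[RHS]big_filter; apply: perm_big.
apply: uniq_perm => //; first exact: filter_uniq.
by move=> x; rewrite mem_filter; case: (boolP (x \in s1)) => // /s12 ->.
Qed.

(** Null sets are stable under countable unions; here in terms of finite covers
    by sets of equal diameter. *)
Lemma hausdorff_null (s : R) (A : set T) (P : nat -> set T) :
  (forall x, 0 <= d x x)%E -> 0 <= s -> A `<=` \bigcup_m P m ->
  (forall m (delta eta : R), 0 < delta -> 0 < eta ->
    exists (l : seq (set T)) (r : R), [/\ 0 <= r <= delta, (size l)%:R * r `^ s <= eta,
      forall j, (j < size l)%N -> (diameter d (nth set0 l j) <= r%:E)%E &
      P m `<=` [set x | exists2 j, (j < size l)%N & nth set0 l j x]]) ->
  hausdorff_measure d s A = 0%E.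
Proof.
move=> d0 s0 AP Pcov; apply/eqP; rewrite eq_le; apply/andP; split; last first.
  apply: (@le_trans _ _ (hausdorff_premeasure d s 1 A)).
    by apply: le_ereal_inf_tmp => _ [U _ <-]; apply: nneseries_ge0 => *; exact: hausdorff_weight_ge0.
  by apply: ereal_sup_ubound; exists 1 => //=.
apply: ub_ereal_sup => _ [delta /= delta0 <-].
apply/lee_addgt0Pr => eta eta0; rewrite add0e.
have e0 m : 0 < eta * 2^-1 ^+ m.+1 by rewrite mulr_gt0// exprn_gt0.
have /boolp.choice[l lP] : forall m, exists lr : seq (set T) * R, [/\ 0 <= lr.2 <= delta,
      (size lr.1)%:R * lr.2 `^ s <= eta * 2^-1 ^+ m.+1,
      forall j, (j < size lr.1)%N -> (diameter d (nth set0 lr.1 j) <= lr.2%:E)%E &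
      P m `<=` [set x | exists2 j, (j < size lr.1)%N & nth set0 lr.1 j x]].
  by move=> m; have [l [r lr]] := Pcov m delta _ delta0 (e0 m); exists (l, r).
pose U k : set T := if pickle_inv k is Some mj then nth set0 (l mj.1).1 mj.2 else set0.
pose c (mj : nat * nat) : R := if (mj.2 < size (l mj.1).1)%N then (l mj.1).2 `^ s else 0.
have c0 mj : 0 <= c mj by rewrite /c; case: ifP => // _; exact: powR_ge0.
apply: (@le_trans _ _ (\sum_(0 <= k <oo) hausdorff_weight d s (U k))%E).
  apply: ereal_inf_lbound; exists U => //; split.
    move=> x /AP[m _ Pm]; have [_ _ _ /(_ x Pm)[j jl xj]] := lP m.
    by exists (pickle (m, j)) => //; rewrite /U pickleK_inv.
  move=> k; rewrite /U; case: pickle_inv => [[m j]|]; last by rewrite diameter_set0 leNye.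
  have [/andP[_ rd] _ dl _] := lP m; have [jl|lj] := ltnP j (size (l m).1).
    by apply: le_trans (dl j jl) _; rewrite lee_fin.
  by rewrite nth_default// diameter_set0 leNye.
have wU k : (hausdorff_weight d s (U k) <= (if pickle_inv k is Some mj then c mj else 0)%:E)%E.
  rewrite /U /c; case: pickle_inv => [[m j]|]; last by rewrite /hausdorff_weight eqxx.
  rewrite /=; have [/andP[r0 _] _ dl _] := lP m; case: ltnP => lj.
    by apply: hausdorff_weight_le => //; exact: dl.
  by rewrite nth_default// /hausdorff_weight eqxx.
apply: lime_le; first by apply: is_cvg_nneseries => *; exact: hausdorff_weight_ge0.
near=> N.
apply: (@le_trans _ _ (\sum_(0 <= k < N) (if pickle_inv k is Some mj then c mj else 0)%:E)%E).
  by apply: lee_sum => k _; exact: wU.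
rewrite sumEFin lee_fin.
pose s1 : seq (nat * nat) := pmap (@pickle_inv (nat * nat)%type) (iota 0 N).
have -> : \sum_(0 <= k < N) (if pickle_inv k is Some mj then c mj else 0) = \sum_(mj <- s1) c mj.
  rewrite /s1 /index_iota subn0; elim: (iota 0 N) => [|k r IH]; first by rewrite !big_nil.
  by rewrite big_cons IH /=; case: pickle_inv => [mj|] /=; rewrite ?big_cons// add0r.
pose M := (\max_(mj <- s1) (mj.1 + mj.2))%N.
have us1 : uniq s1 by apply: (pmap_uniq (@pickle_invK _)); exact: iota_uniq.
have sub : {subset s1 <= [seq (m, j) | m <- iota 0 M.+1, j <- iota 0 M.+1]}.
  move=> [m j] mj; have : (m + j <= M)%N by apply: (@leq_bigmax_seq _ _ xpredT (fun mj => mj.1 + mj.2)%N _ mj).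
  by move=> mjM; apply/allpairsP; exists (m, j); rewrite !mem_iota/= !add0n !ltnS; split=> //; lia.
apply: le_trans (ler_sum_uniq_subset us1 _ sub c0) _.
  by rewrite allpairs_uniq ?iota_uniq// => -[a b] [a' b'].
rewrite big_allpairs/=.
have inner m : \sum_(j <- iota 0 M.+1) c (m, j) <= eta * 2^-1 ^+ m.+1.
  have [_ le2 _ _] := lP m; apply: le_trans le2.
  have -> : \sum_(j <- iota 0 M.+1) c (m, j) = (\sum_(j <- iota 0 M.+1) (j < size (l m).1))%N%:R * (l m).2 `^ s.
    by rewrite natr_sum mulr_suml; apply: eq_bigr => j _; rewrite /c/=; case: ifP => _; rewrite ?mul1r ?mul0r.
  rewrite ler_wpM2r ?powR_ge0// ler_nat.
  have cnt K z : (\sum_(j <- iota 0 K) (j < z) <= z)%N.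
    suff -> : (\sum_(j <- iota 0 K) (j < z) = minn K z)%N by rewrite geq_minr.
    elim: K => [|K IH]; first by rewrite big_nil min0n.
    by rewrite -[K.+1]addn1 iotaD cats1 big_rcons/= IH add0n; case: ltnP; lia.
  exact: cnt.
apply: le_trans (ler_sum _ (fun m _ => inner m)) _.
rewrite -mulr_sumr -[leRHS]mulr1 ler_wpM2l ?(ltW eta0)//.
suff -> : \sum_(m <- iota 0 M.+1) 2^-1 ^+ m.+1 = 1 - 2^-1 ^+ M.+1 :> R.
  by rewrite gerBl exprn_ge0.
elim: M.+1 => [|K IH]; first by rewrite big_nil expr0 subrr.
rewrite -[in iota _ _]addn1 iotaD cats1 big_rcons/= IH add0n !exprS.
by move: (2^-1 ^+ K) => t; field.
Unshelve. all: by end_near. Qed.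
End HausdorffNull.

(** * The upper bound *)

Section UpperBound.
Variables (R : realType) (n : nat) (s : R).
Hypothesis n0 : (0 < n)%N.
Hypothesis s_gt : (3 * n)%:R - 1 / 2 < s.

(** In a step with a high orbit the number of boxes of side [B ^ - N] in all
    [3 n] coordinates grows by a factor [(200 L) ^ n * B ^ (3 n - 1 / 2)], where
    [A = B ^ (1 / 2)]. For long steps the power of [L] is negligible. *)
Lemma step_length : exists2 L, (0 < L)%N &
  @growth R n L / (2 ^ L)%:R * (2 ^ (2 * L))%:R ^+ (2 * n) * ((2 ^ (2 * L))%:R^-1) `^ s < 1.
Proof.
pose delta := s - ((3 * n)%:R - 1 / 2); have delta0 : 0 < delta by rewrite subr_gt0.
have nR : 0 < n%:R :> R by rewrite ltr0n.
have ln2 : 0 < ln 2 :> R by rewrite ln_gt0// ltr1n.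
pose c := 2 * delta * ln 2 / n%:R; have c0 : 0 < c by rewrite divr_gt0// !mulr_gt0.
pose L := (Num.truncn (800 / c ^+ 2)).+1; exists L => //.
have LR : 0 < L%:R :> R by rewrite ltr0n.
have key : 200 * L%:R < expR (c * L%:R).
  have h : 1 + c * L%:R / 2 <= expR (c * L%:R / 2) by exact: expR_ge1Dx.
  have c20 : 0 <= c * L%:R / 2 by apply: divr_ge0 => //; apply: mulr_ge0 => //; exact: ltW.
  have : (c * L%:R / 2) ^+ 2 < expR (c * L%:R).
    rewrite {2}(splitr (c * L%:R)) expRD -expr2 ltr_sqr ?nnegrE ?expR_ge0 ?c20//; lra.
  apply: le_lt_trans.
  have : 800 / c ^+ 2 <= L%:R by apply: ltW; exact: truncnS_gt.
  rewrite ler_pdivrMr ?exprn_gt0// => h2.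
  rewrite (_ : _ ^+ 2 = (L%:R * c ^+ 2) * L%:R / 4); last by field.
  have := ler_wpM2r (ltW LR) h2; lra.
have keyn : (200 * L%:R) ^+ n < 2 `^ (2 * delta * L%:R).
  have -> : 2 `^ (2 * delta * L%:R) = expR (c * L%:R) ^+ n.
    by rewrite -expRM_natl /powR (gt_eqF (ltr0Sn R 1)); congr expR; rewrite /c; field; rewrite gt_eqF.
  by rewrite ltrXn2r ?gtn_eqF// ?expR_ge0 ?mulr_ge0.
have two0 : (2 : R) != 0 by rewrite pnatr_eq0.
have pw (k : nat) : (2 ^ k)%:R = 2 `^ k%:R :> R by rewrite powR_mulrn// natrX.
rewrite /growth exprMn -!mulrA.
rewrite (_ : (2 ^ (2 * L))%:R ^+ n * _ = 2 `^ (- (2 * delta * L%:R))); last first.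
  have two_pow x y : 2 `^ x * 2 `^ y = 2 `^ (x + y) :> R by rewrite -powRD// two0 implybT.
  have inv2 x : (2 `^ x)^-1 = 2 `^ (- x) :> R by rewrite powRN.
  rewrite !pw -!powR_mulrn ?powR_ge0// -!powRrM !inv2 -powRrM !two_pow.
  by congr powR; rewrite !natrM /delta natrM; field.
by rewrite powRN ltr_pdivrMr ?powR_gt0// mul1r.
Qed.

Lemma powR_exprV (b : R) N : 0 < b -> (b ^- N) `^ s = (b^-1 `^ s) ^+ N.
Proof.
move=> /ltW b0; have b'0 : 0 <= b^-1 by rewrite invr_ge0.
have e1 := powR_mulrn N b'0; have e2 := powR_mulrn N (powR_ge0 b^-1 s).
by rewrite -exprVn -e1 -e2 -!powRrM mulrC.
Qed.

Lemma exists_small (q C0 C1 B delta eta : R) (N0 : nat) : 0 <= q < 1 -> 1 < B -> 0 < delta -> 0 < eta ->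
  exists2 N, (N0 <= N)%N & C0 * q ^+ N <= eta /\ C1 * B ^- N <= delta.
Proof.
move=> /andP[q0 q1] B1 delta0 eta0.
have cq : (fun N => C0 * q ^+ N) @ \oo --> C0 * 0.
  by apply: cvgM; [exact: cvg_cst|apply: cvg_expr; rewrite ger0_norm].
have B0 : 0 < B by apply: lt_trans B1.
have cB : (fun N => C1 * (B^-1) ^+ N) @ \oo --> C1 * 0.
  apply: cvgM; [exact: cvg_cst|apply: cvg_expr; rewrite ger0_norm ?invr_ge0 ?ltW//].
  by rewrite invf_lt1.
have : \forall N \near \oo, [/\ (N0 <= N)%N, C0 * q ^+ N <= eta & C1 * (B^-1) ^+ N <= delta].
  near=> N; split.
  - by near: N; exact: nbhs_infty_ge.
  - near: N; move/cvgrPdist_le : cq => /(_ _ eta0); apply: filterS => N.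
    by rewrite mulr0 sub0r normrN; apply: le_trans; exact: ler_norm.
  - near: N; move/cvgrPdist_le : cB => /(_ _ delta0); apply: filterS => N.
    by rewrite mulr0 sub0r normrN; apply: le_trans; exact: ler_norm.
move=> [N _ /(_ N (leqnn N))[h1 h2 h3]]; exists N => //; split=> //.
by rewrite -exprVn.
Unshelve. all: by end_near. Qed.

Variable rho : Gn R n -> ambient R n -> ambient R n -> R.
Hypothesis Hrho : right_invariant_riemannian rho.

(** The divergent points are exhausted by countably many such pieces: [N0] is the
    time from which some lattice is always high, [m] consists of the integral
    parts of the expanding coordinates, and [b] bounds the other coordinates. *)
Definition piece L (m : 'I_n -> int) (b N0 : nat) : set (GGamma R n) :=
  [set u | exists x y th : 'I_n -> R, [/\ u = coset_pi (chart x y th),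
     forall i, `|x i| <= b%:R /\ `|y i| <= b%:R,
     forall i, (m i)%:~R <= th i < (m i)%:~R + 1 &
     forall j, (N0 <= j)%N -> exists i,
       2 * (2 ^ L)%:R <= height (orbit_map (2 ^ L)%:R j (th i) @` @primitive_vectors R)]].

Lemma quotient_dist_pi g h : (quotient_dist rho (coset_pi g) (coset_pi h) <= riem_dist rho g h)%E.
Proof. by apply: ereal_inf_lbound; exists (g, h). Qed.

Lemma orbit_shear (a : R) j (x x' : R) : orbit_map a j x \o shear x' = orbit_map a j (x + x').
Proof. by apply/funext => v; rewrite /orbit_map /shear/=; congr dilate; congr pair; ring. Qed.

(* the subinterval of length 1/B of [-b, b] that contains a given point *)
Lemma grid_point (b : nat) (B : nat) (x : R) : (0 < B)%N -> `|x| <= b%:R ->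
  exists k : 'I_(2 * b * B).+1, - b%:R + k%:R / B%:R <= x <= - b%:R + k%:R / B%:R + B%:R^-1.
Proof.
move=> B0; have BR : 0 < B%:R :> R by rewrite ltr0n.
rewrite ler_norml => /andP[x1 x2].
have z0 : 0 <= (x + b%:R) * B%:R by rewrite mulr_ge0// -lerBlDr sub0r.
have /andP[t1 t2] := truncn_itv z0.
have kP : (Num.truncn ((x + b%:R) * B%:R)%R < (2 * b * B).+1)%N.
  rewrite truncn_lt_nat// -natr1; apply: (@le_lt_trans _ _ (2 * b * B)%:R); last by rewrite ltrDl.
  by rewrite !natrM ler_pM2r//; lra.
exists (Ordinal kP) => /=; move: t1 t2; rewrite -natr1; move: (Num.truncn _)%:R => t t1 t2.
have E : x = - b%:R + ((x + b%:R) * B%:R) / B%:R by rewrite mulfK ?gt_eqF//; ring.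
have BB : B%:R * B%:R^-1 = 1 :> R by rewrite mulfV ?gt_eqF.
have B'0 : 0 < B%:R^-1 :> R by rewrite invr_gt0.
rewrite E; apply/andP; split; first by rewrite lerD2l ler_pM2r.
by rewrite -addrA lerD2l -[leRHS]/(_ + _) -[X in _ <= _ + X]mul1r -mulrDl ler_pM2r// ltW.
Qed.

Lemma normr_le_unit_interval (b z M t : R) : 0 <= b -> b + 1 + `|z| <= M -> z <= t < z + 1 ->
  b <= M /\ `|t| <= M.
Proof.
move=> b0 zM /andP[zt tz]; have := normr_ge0 z; have := ler_norm z; have := ler_norm (- z).
by rewrite normrN ler_norml => ? ? ?; split; [lra|apply/andP; split; lra].
Qed.

Lemma dist_le_interval (lo e p p' : R) : lo <= p <= lo + e -> lo <= p' <= lo + e -> `|p' - p| <= e.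
Proof. by move=> /andP[? ?] /andP[? ?]; rewrite ler_norml; apply/andP; split; lra. Qed.

(** The expanding coordinates are covered by [cover_count], the other [2 n]
    coordinates by the boxes of a grid with the same side. *)
Lemma piece_cover L m b N0 : (0 < L)%N ->
  growth n L / (2 ^ L)%:R * (2 ^ (2 * L))%:R ^+ (2 * n) * ((2 ^ (2 * L))%:R^-1) `^ s < 1 ->
  forall (delta eta : R), 0 < delta -> 0 < eta ->
    exists (l : seq (set (GGamma R n))) (r : R), [/\ 0 <= r <= delta, (size l)%:R * r `^ s <= eta,
      forall j, (j < size l)%N -> (diameter (quotient_dist rho) (nth set0 l j) <= r%:E)%E &
      piece L m b N0 `<=` [set x | exists2 j, (j < size l)%N & nth set0 l j x]].
Proof.
move=> L0; set A : R := (2 ^ L)%:R; set B : R := (2 ^ (2 * L))%:R.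
have A0 : 0 < A := pow2_gt0 L; have B0 : 0 < B := pow2_gt0 (2 * L).
have B1 : 1 < B by rewrite ltr1n -[X in (X < _)%N](expn0 2) ltn_exp2l//; lia.
set g := growth n L; have g0 : 0 <= g by exact: growth_ge0.
set v := B^-1 `^ s; set q := _ * v => q1 delta eta delta0 eta0.
pose S i := shear (m i)%:~R @` @primitive_vectors R.
have HS i : unimodular_set (S i) by apply: unimodular_image (area_shear _) (@primitive_unimodular R).
pose F := \prod_i height (S i).
have F0 : 0 <= F by apply: prodr_ge0 => i _; apply: le_trans (height_ge1 (HS i)).
pose M : R := b%:R + 1 + \sum_i `|(m i)%:~R|.
have M0 : 0 <= M by rewrite addr_ge0// sumr_ge0.
have mM i : b%:R + 1 + `|(m i)%:~R| <= M.
  by rewrite lerD2l (bigD1 i)//= lerDl sumr_ge0.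
have [K K0 Kdist] := riem_dist_chart Hrho M0.
have v0 : 0 <= v by exact: powR_ge0.
have q0 : 0 <= q.
  have A'0 : 0 <= A^-1 by rewrite invr_ge0 ltW.
  by apply: mulr_ge0 => //; apply: mulr_ge0; [exact: mulr_ge0|apply/exprn_ge0/ltW].
pose C0 := A ^+ N0 * F * (2 * b%:R + 1) ^+ (2 * n) * K `^ s.
have [N N0N [C0q KB]] : exists2 N, (N0 <= N)%N & C0 * q ^+ N <= eta /\ K * B ^- N <= delta.
  by apply: exists_small; rewrite ?q0.
have [l [szl lP]] := cover_count L0 N0 N HS.
pose BN := ((2 ^ (2 * L)) ^ N)%N.
have BNE : BN%:R = B ^+ N :> R by rewrite natrX.
have BN0 : (0 < BN)%N by rewrite expn_gt0 expn_gt0.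
pose G := {ffun 'I_n -> 'I_(2 * b * BN).+1}.
pose box (c : {ffun 'I_n -> R}) (k : G * G) : set (GGamma R n) :=
  [set u | exists x y th : 'I_n -> R, u = coset_pi (chart x y th) /\ forall i,
    [/\ `|x i| <= b%:R /\ `|y i| <= b%:R,
       - b%:R + (k.1 i)%:R / BN%:R <= x i <= - b%:R + (k.1 i)%:R / BN%:R + BN%:R^-1,
       - b%:R + (k.2 i)%:R / BN%:R <= y i <= - b%:R + (k.2 i)%:R / BN%:R + BN%:R^-1,
       c i <= th i - (m i)%:~R <= c i + B ^- N & (m i)%:~R <= th i < (m i)%:~R + 1]].
exists [seq box c k | c <- l, k <- enum {: G * G}], (K * B ^- N).
have BN'0 : 0 <= B ^- N by rewrite invr_ge0 exprn_ge0// ltW.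
split.
- by rewrite KB mulr_ge0// ltW.
- apply: le_trans C0q; rewrite size_allpairs -cardE card_prod card_ffun card_ord.
  rewrite powRM ?(ltW K0)// powR_exprV// -/v.
  rewrite !card_ord -expnD addnn -mul2n natrM natrX.
  have h1 : (size l)%:R <= A ^+ N0 * (g / A) ^+ N * F.
    apply: le_trans szl _; rewrite (minn_idPl N0N) -/g -[in leRHS](subnKC N0N) exprD.
    by rewrite mulrA -exprMn mulrCA mulfV ?gt_eqF// mulr1.
  have h2 : (2 * b * BN).+1%:R ^+ (2 * n) <= ((2 * b%:R + 1) * B ^+ N) ^+ (2 * n) :> R.
    have h3 : (2 * b * BN).+1%:R <= (2 * b%:R + 1) * B ^+ N :> R.
      have -> : (2 * b%:R + 1) * B ^+ N = (2 * b * BN)%:R + BN%:R by rewrite BNE !natrM BNE; ring.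
      by rewrite -natr1 lerD2l ler1n.
    by apply: (lerXn2r _ _ _ h3); rewrite nnegrE ?ler0n//; exact: le_trans (ler0n _ _) h3.
  apply: (@le_trans _ _ (A ^+ N0 * (g / A) ^+ N * F * ((2 * b%:R + 1) * B ^+ N) ^+ (2 * n) * (K `^ s * v ^+ N))).
    apply: ler_wpM2r; first by apply: mulr_ge0; [exact: powR_ge0|exact: exprn_ge0].
    by apply: ler_pM => //; apply: exprn_ge0.
  rewrite /C0 /q !exprMn -!exprM [(N * _)%N]mulnC.
  rewrite le_eqVlt; apply/orP; left; apply/eqP.
  by ring.
- move=> j jl.
  have /allpairsP[[c k] [_ _ ->]] := mem_nth set0 jl.
  apply: ub_ereal_sup => _ [[u u'] [/= [x [y [th [-> h]]]] [x' [y' [th' [-> h']]]]] <-] /=.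
  have inM i (p q' t : R) : `|p| <= b%:R -> `|q'| <= b%:R -> (m i)%:~R <= t < (m i)%:~R + 1 ->
      [/\ `|p| <= M, `|q'| <= M & `|t| <= M].
    have bM := normr_le_unit_interval (ler0n R b) (mM i).
    by move=> pb qb /bM[b_le tM]; split=> //; exact: le_trans b_le.
  apply: le_trans (quotient_dist_pi _ _) _; apply: Kdist => //.
  + by move=> i; have [[b1 b2] _ _ _ b3] := h i; exact: (inM i _ _ _ b1 b2 b3).
  + by move=> i; have [[b1 b2] _ _ _ b3] := h' i; exact: (inM i _ _ _ b1 b2 b3).
  + move=> i; have [_ a1 a2 a3 _] := h i; have [_ b1 b2 b3 _] := h' i.
    rewrite BNE in a1 a2 b1 b2; split; [exact: dist_le_interval a1 b1|exact: dist_le_interval a2 b2|].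
    rewrite (_ : th' i - th i = (th' i - (m i)%:~R) - (th i - (m i)%:~R)); last by ring.
    exact: dist_le_interval a3 b3.
- move=> u [x [y [th [-> xy mth high]]]].
  have [kx kxP] : exists kx : G, forall i, - b%:R + (kx i)%:R / BN%:R <= x i <= - b%:R + (kx i)%:R / BN%:R + BN%:R^-1.
    have /boolp.choice[f fP] i := grid_point BN0 (xy i).1.
    by exists (finfun f) => i; rewrite ffunE.
  have [ky kyP] : exists kx : G, forall i, - b%:R + (kx i)%:R / BN%:R <= y i <= - b%:R + (kx i)%:R / BN%:R + BN%:R^-1.
    have /boolp.choice[f fP] i := grid_point BN0 (xy i).2.
    by exists (finfun f) => i; rewrite ffunE.
  have [|j /andP[N0j _]|c cl cP] := lP (fun i => th i - (m i)%:~R).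
  + by move=> i; have := mth i; lra.
  + have [i hi] := high j N0j; exists i; rewrite /S image_comp orbit_shear.
    by rewrite (_ : th i - _ + _ = th i)//; ring.
  + have ml : box c (kx, ky) \in [seq box c k | c <- l, k <- enum {: G * G}].
      by apply/allpairsP; exists (c, (kx, ky)); rewrite mem_enum.
    exists (index (box c (kx, ky)) [seq box c k | c <- l, k <- enum {: G * G}]); first by rewrite index_mem.
    by rewrite nth_index//; exists x, y, th; split=> // i; split.
Qed.

Lemma quotient_dist_ge0 u u' : (0 <= quotient_dist rho u u')%E.
Proof.
apply: le_ereal_inf_tmp => _ [p _ <-]; apply: le_ereal_inf_tmp => _ [c _ <-].
by apply: integral_ge0 => t _; rewrite lee_fin sqrtr_ge0.
Qed.

Lemma divergent_null : hausdorff_measure (quotient_dist rho) s (divergent_set R n) = 0%E.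
Proof.
have [L L0 small] := step_length.
pose P (k : nat) : set (GGamma R n) :=
  if pickle_inv k : option ({ffun 'I_n -> int} * nat * nat) is Some (m, b, N0)
  then piece L m b N0 else set0.
apply: (hausdorff_null (P := P)).
- by move=> u; exact: quotient_dist_ge0.
- apply: ltW; apply: le_lt_trans s_gt; have : 1 <= (3 * n)%:R :> R by rewrite ler1n; lia.
  lra.
- move=> u divu; pose g := repr u.
  have ug : u = coset_pi g by rewrite /coset_pi reprK.
  have [m m0 rep] := @chart_representative R n (fun i => height (lattice (g i))).
  have [x [y [th [bd ugx]]]] := rep g (fun i => lexx _).
  rewrite ug ugx in divu *.
  have bd2 i : `|x i| <= m /\ `|y i| <= m by have [] := bd i.
  have [N0 hN0] := @divergent_chart_high R n L m x y th L0 bd2 divu.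
  pose fl := [ffun i => Num.floor (th i)].
  exists (pickle (fl, (Num.truncn m).+1, N0)); first by [].
  rewrite /P pickleK_inv.
  exists x, y, th; split=> //.
  + have mb : m <= (Num.truncn m).+1%:R by apply: ltW; exact: truncnS_gt.
    by move=> i; have [h1 h2] := bd2 i; split; apply: le_trans mb.
  + by move=> i; rewrite ffunE; have := floor_itv (th i); rewrite intrD.
- move=> k delta eta delta0 eta0; rewrite /P.
  case: (pickle_inv k) => [[[m b] N0]|]; first exact: piece_cover.
  by exists [::], 0; split=> //=; rewrite ?lexx ?mul0r ltW.
Qed.
End UpperBound.

(** * Alternating excursions into the cusp *)

Section CuspDivergence.
Variables (R : realType) (n : nat).

(** The window of index [j + 1] opens before that of index [j] closes, so that the
    windows cover all large times [Y]. *)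
Lemma cusp_window J (Y : R) : (2 ^ (window_start (odd J) J./2 + J./2))%:R <= Y ->
  exists j, [/\ (J <= j)%N, (2 ^ (window_start (odd j) j./2 + j./2))%:R <= Y &
    Y * (2 ^ j./2)%:R <= (2 ^ window_end (odd j) j./2)%:R].
Proof.
pose lo j := (window_start (odd j) j./2 + j./2)%N; rewrite -/(lo J) => JY.
have jE j : (2 * j./2 + odd j = j)%N by rewrite mul2n addnC odd_double_half.
have loE j : lo j = (16 * j.+1 ^ 3 + j./2)%N by rewrite /lo /window_start jE.
have hiE j : window_end (odd j) j./2 = (16 * j.+2 ^ 3 + 2 * j./2 + 2)%N.
  by rewrite /window_end jE.
have ex : exists j, (J <= j)%N && (Y < (2 ^ lo j.+1)%:R).
  exists (maxn J (Num.truncn Y).+1); rewrite leq_maxl/=.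
  apply: lt_le_trans (truncnS_gt _) _; rewrite ler_nat.
  apply: leq_trans (leq_maxr J _) _; set j := maxn _ _.
  apply: leq_trans (ltnW (ltn_expl j (ltnSn 1))) _; rewrite leq_exp2l// loE !expnS; nia.
case: (ex_minnP ex) => j /andP[Jj Yj] jmin; exists j; split=> //.
  move: Jj; rewrite leq_eqVlt => /orP[/eqP <- //|]; case: j Yj jmin => // j Yj jmin Jj.
  rewrite -/(lo j.+1) leNgt; apply/negP => Yj1; have := jmin j.
  by rewrite -ltnS Jj/= Yj1 ltnn => /(_ isT).
apply: (@le_trans _ _ ((2 ^ lo j.+1)%:R * (2 ^ j./2)%:R)); first by rewrite ler_wpM2r// ltW.
rewrite -natrM -expnD ler_nat leq_exp2l// loE hiE.
have : (uphalf j <= j./2.+1)%N by rewrite uphalf_half; case: odd.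
by rewrite -[j.+1./2]/(uphalf j); move: (16 * _)%N => c; lia.
Qed.

(** The vector [(- P, Q)] of an approximation [P / Q] of the expanding coordinate
    is short between the time [S * kap], when its second coordinate has been
    contracted, and the time [D / kap], when its first one gets large. *)
Lemma short_vector_bound (X Z th Y P Q S D kap : R) : `|X| <= 1 -> `|Z| <= 1 ->
  1 <= S -> 1 <= D -> 0 < kap -> 0 <= Q -> Q <= S -> `|Q * th - P| <= D^-1 -> S * kap <= Y -> Y * kap <= D ->
  norm2 (dilate Y (act (chart_mx X Z th) (- P, Q))) <= 2 * expR 1 / kap.
Proof.
move=> xi yi S1 D1 kap0 Q0 qS qD Ylo Yhi.
pose E : R := expR 1; have E1 : 1 <= E by rewrite -expR0 ler_expR.
have E0 : 0 < E by exact: expR_gt0.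
have D0 : 0 < D by apply: lt_le_trans D1.
have Y_gt0 : 0 < Y by apply: lt_le_trans Ylo; rewrite mulr_gt0//; apply: lt_le_trans S1.
have eX : expR X <= E by rewrite ler_expR; apply: le_trans xi; exact: ler_norm.
have eX' : expR (- X) <= E by rewrite ler_expR; apply: le_trans xi; rewrite -normrN; exact: ler_norm.
have e1 : `|Y * (expR X * (Q * th - P))| <= E / kap.
  rewrite !normrM (gtr0_norm Y_gt0) (gtr0_norm (expR_gt0 _)).
  apply: (@le_trans _ _ (Y * (E * D^-1))).
    by rewrite ler_wpM2l ?(ltW Y_gt0)//; apply: ler_pM => //; exact: expR_ge0.
  by rewrite mulrCA ler_wpM2l ?(ltW E0)// ler_pdivrMr// mulrC ler_pdivlMr.
have e2 : `|(Z * (Q * th - P) + expR (- X) * Q) / Y| <= 2 * E / kap.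
  rewrite normrM normfV (gtr0_norm Y_gt0) ler_pdivrMr// mulrAC ler_pdivlMr//.
  have h : `|Z * (Q * th - P) + expR (- X) * Q| <= 2 * E * S.
    apply: le_trans (ler_normD _ _) _; rewrite !normrM (gtr0_norm (expR_gt0 _)) (ger0_norm Q0).
    have h1 : `|Z| * `|Q * th - P| <= 1 * D^-1 by apply: ler_pM.
    have h2 : expR (- X) * Q <= E * S by apply: ler_pM => //; exact: expR_ge0.
    have h3 : D^-1 <= E * S.
      apply: (@le_trans _ _ 1); first by rewrite invf_le1.
      by have := ler_pM ler01 ler01 E1 S1; rewrite mul1r.
    lra.
  apply: le_trans (ler_wpM2r (ltW kap0) h) _.
  have E2 : 0 <= 2 * E by lra.
  by have := ler_wpM2l E2 Ylo; rewrite mulrA.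
have E' : E / kap <= 2 * E / kap.
  by rewrite ler_pM2r ?invr_gt0//; lra.
rewrite norm2_le /dilate /act /chart_mx /= !mxE/=; apply/andP; split.
  apply: le_trans E'; apply: le_trans e1; rewrite le_eqVlt; apply/orP; left; apply/eqP; congr `|_|; ring.
apply: le_trans e2; rewrite le_eqVlt; apply/orP; left; apply/eqP; congr `|_|; ring.
Qed.

(** With two coordinates whose windows alternate, at each large time one of the
    two lattices has a short vector, namely the one given by the approximation
    of the current window. *)
Lemma cusp_divergent (x y th : 'I_n -> R) (i : nat -> 'I_n) :
  (forall k, `|x k| <= 1 /\ `|y k| <= 1) ->
  (forall a, (a < 2)%N -> cusp_set a (th (i a))) ->
  divergent_set R n (coset_pi (chart x y th)).
Proof.
move=> xy cusp; apply: short_vectors_divergent => eps eps0.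
pose E : R := expR 1; have E1 : 1 <= E by rewrite -expR0 ler_expR.
have E0 : 0 < E by exact: expR_gt0.
pose K := (Num.truncn (2 * E / eps)).+1.
have EK : 2 * E / eps < (2 ^ K)%:R.
  by apply: lt_le_trans (truncnS_gt _) _; rewrite ler_nat ltnW// ltn_expl.
pose J := K.*2.
have [Y0 Y00 Y0E] : exists2 Y0 : R, 0 < Y0 & (2 ^ (window_start (odd J) J./2 + J./2))%:R = Y0.
  by eexists; last reflexivity; exact: pow2_gt0.
exists (2 * ln Y0) => t tT; set Y := expR (t / 2).
have YY : Y0 <= Y by rewrite -[leLHS]lnK ?posrE// ler_expR ler_pdivlMr// mulrC ltW.
have Y_gt0 : 0 < Y by exact: expR_gt0.
rewrite -Y0E in YY; have [j [Jj]] := cusp_window YY; set k := j./2; set a := (odd j : nat) => Ylo Yhi.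
have a2 : (a < 2)%N by rewrite /a; case: odd.
have [_ /(_ k)[p [q [q0 qS qD]]]] := cusp a a2.
exists (i a), (- p%:Z), q%:Z; split; first by rewrite orbC eqz_nat -lt0n q0.
rewrite -[slmx (diag_flow t * _)%g]/(slmx (diag_flow t) *m slmx (chart x y th (i a))) act_mul act_diag_flow -/Y.
rewrite ffunE mulrNz -!pmulrn; apply: (@le_lt_trans _ _ (2 * E / (2 ^ k)%:R)).
  have [xi yi] := xy (i a).
  apply: (short_vector_bound (S := (2 ^ window_start a k)%:R) xi yi _ _ _ _ _ qD _ Yhi).
  - by rewrite ler1n expn_gt0.
  - by rewrite ler1n expn_gt0.
  - by rewrite ltr0n expn_gt0.
  - by rewrite ler0n.
  - by rewrite ler_nat.
  - by rewrite -natrM -expnD.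
rewrite ltr_pdivrMr ?pow2_gt0// -ltr_pdivrMl// mulrC; apply: lt_le_trans EK _.
by rewrite ler_nat leq_exp2l// /k; have := half_leq Jj; rewrite doubleK.
Qed.
End CuspDivergence.

(** * Separation of points of the quotient *)

Section Separation.
Variable R : realType.

Lemma int_norm_lt1 (z : R) : z \is a Num.int -> `|z| < 1 -> z = 0.
Proof. by move=> zi z1; apply/eqP/negPn/negP => /(norm_intr_ge1 zi); rewrite leNgt z1. Qed.

Lemma near1M (u v : R) : `|u - 1| <= 1 / 8 -> `|v - 1| <= 1 / 8 -> `|u * v - 1| <= 1 / 2.
Proof.
move=> hu hv; rewrite (_ : _ - 1 = (u - 1) * (v - 1) + (u - 1) + (v - 1)); last by ring.
have := ler_pM (normr_ge0 _) (normr_ge0 _) hu hv; rewrite -normrM.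
have := ler_normD ((u - 1) * (v - 1) + (u - 1)) (v - 1).
have := ler_normD ((u - 1) * (v - 1)) (u - 1); lra.
Qed.

Lemma near0M (u v : R) : `|u| <= 1 / 8 -> `|v| <= 9 / 8 -> `|u * v| <= 1 / 4.
Proof.
move=> hu hv; have := ler_pM (normr_ge0 _) (normr_ge0 _) hu hv; rewrite -normrM; lra.
Qed.

Definition near_id (eps : R) (A : 'M[R]_2) := forall a b, `|A a b - (a == b)%:R| <= eps.

Lemma near_idE eps A : near_id eps A ->
  [/\ `|A 0 0 - 1| <= eps, `|A 0 1| <= eps, `|A 1 0| <= eps & `|A 1 1 - 1| <= eps].
Proof. by move=> nA; split; [exact: nA 0 0|have := nA 0 1|have := nA 1 0|exact: nA 1 1]; rewrite subr0. Qed.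

(** [d] is near the identity, too, and integral. *)
Lemma near_id_discrete (g P d : 'M[R]_2) : g 0 0 * g 1 1 - g 0 1 * g 1 0 = 1 ->
  near_id (1 / 8) g -> near_id (1 / 8) P -> (forall a b, d a b \is a Num.int) -> g *m d = P -> d = 1%:M.
Proof.
move=> D /near_idE[g00 g01 g10 g11] /near_idE[P00 P01 P10 P11] di gdP.
have eq a b : g a 0 * d 0 b + g a 1 * d 1 b = P a b by rewrite -mulmx22 gdP.
have d0 b : d 0 b = g 1 1 * P 0 b - g 0 1 * P 1 b.
  by rewrite -!eq -[LHS]mul1r -D; ring.
have d1 b : d 1 b = g 0 0 * P 1 b - g 1 0 * P 0 b.
  by rewrite -!eq -[LHS]mul1r -D; ring.
have b9 (u : R) : `|u - 1| <= 1 / 8 -> `|u| <= 9 / 8.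
  by move=> hu; have := ler_normD (u - 1) 1; rewrite normr1 subrK; lra.
have b8 (u : R) : `|u| <= 1 / 8 -> `|u| <= 9 / 8 by move=> hu; lra.
have one (z : R) : z \is a Num.int -> `|z - 1| < 1 -> z = 1.
  by move=> zi z1; apply/eqP; rewrite -subr_eq0; apply/eqP/int_norm_lt1; rewrite ?rpredB ?rpred1.
have e00 : d 0 0 = 1.
  apply: one => //; rewrite d0 addrAC.
  have := near1M g11 P00; have := near0M g01 (b8 _ P10).
  have := ler_normB (g 1 1 * P 0 0 - 1) (g 0 1 * P 1 0); lra.
have e01 : d 0 1 = 0.
  apply: int_norm_lt1 => //; rewrite d0 [g 1 1 * _]mulrC.
  have := near0M P01 (b9 _ g11); have := near0M g01 (b9 _ P11).
  have := ler_normB (P 0 1 * g 1 1) (g 0 1 * P 1 1); lra.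
have e10 : d 1 0 = 0.
  apply: int_norm_lt1 => //; rewrite d1 [g 0 0 * _]mulrC.
  have := near0M P10 (b9 _ g00); have := near0M g10 (b9 _ P00).
  have := ler_normB (P 1 0 * g 0 0) (g 1 0 * P 0 0); lra.
have e11 : d 1 1 = 1.
  apply: one => //; rewrite d1 addrAC.
  have := near1M g00 P11; have := near0M g10 (b8 _ P01).
  have := ler_normB (g 0 0 * P 1 1 - 1) (g 1 0 * P 0 1); lra.
by apply/matrixP => a b; rewrite mxE; have [->|->] := ord2P a; have [->|->] := ord2P b; rewrite ?e00 ?e01 ?e10 ?e11.
Qed.

Lemma near_id_mul (eps : R) (E g : 'M[R]_2) : near_id eps E -> (forall a b, 0 <= g a b) ->
  (forall b, g 0 b + g 1 b <= 2) -> forall a b, `|(E *m g) a b - g a b| <= 2 * eps.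
Proof.
move=> nE g0 g2 a b; have eps0 : 0 <= eps := le_trans (normr_ge0 _) (nE 0 0).
have -> : (E *m g) a b - g a b = (E a 0 - (a == 0)%:R) * g 0 b + (E a 1 - (a == 1)%:R) * g 1 b.
  by rewrite mulmx22; have [->|->] := ord2P a; rewrite /=; ring.
apply: le_trans (ler_normD _ _) _; rewrite !normrM !(ger0_norm (g0 _ _)).
have := ler_wpM2r (g0 0 b) (nE a 0); have := ler_wpM2r (g0 1 b) (nE a 1).
have := ler_wpM2l eps0 (g2 b); lra.
Qed.

Lemma chart_box (x y t : R) :
  0 <= x <= 1 / 16 -> 0 <= y <= 1 / 16 -> 0 <= t <= 1 / 16 ->
  [/\ forall a b, 0 <= chart_mx x y t a b, forall b, chart_mx x y t 0 b + chart_mx x y t 1 b <= 2 &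
     near_id (1 / 15) (chart_mx x y t)].
Proof.
move=> /andP[x0 x1] /andP[y0 y1] /andP[t0 t1].
have h1 : 1 <= expR x by rewrite -expR0 ler_expR.
have h2 : 15 / 16 <= expR (- x) by have := expR_ge1Dx (- x); lra.
have h3 : expR (- x) <= 1 by rewrite -expR0 ler_expR; lra.
have h4 : expR x <= 16 / 15.
  rewrite -[x in expR x]opprK expRN -[leRHS]invrK lef_pV2 ?posrE ?expR_gt0 ?invr_gt0 ?divr_gt0//.
  by rewrite invf_div; lra.
have h5 : 0 <= y * t by exact: mulr_ge0.
have h6 : y * t <= 1 / 16 * (1 / 16) by apply: ler_pM.
have h7 : 0 <= expR x * t by apply: mulr_ge0 => //; exact: expR_ge0.
have h8 : expR x * t <= 16 / 15 * (1 / 16) by apply: ler_pM => //; exact: expR_ge0.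
split=> [a b|b|a b].
- by rewrite mxE; have [->|->] := ord2P a; have [->|->] := ord2P b; rewrite /=; lra.
- by rewrite !mxE; have [->|->] := ord2P b; rewrite /=; lra.
- by rewrite mxE; have [->|->] := ord2P a; have [->|->] := ord2P b; rewrite /= ler_norml; lra.
Qed.

Lemma expR_expand (u v : R) : 0 <= u -> 0 <= v -> `|v - u| <= `|expR v - expR u|.
Proof.
wlog uv : u v / u <= v.
  move=> h u0 v0; have [uv|/ltW vu] := leP u v; first exact: h.
  by rewrite distrC [leRHS]distrC; exact: h.
move=> u0 v0; rewrite !ger0_norm ?subr_ge0 ?ler_expR//.
have -> : expR v = expR u * expR (v - u) by rewrite -expRD addrC subrK.
have h := expR_ge1Dx (v - u); have h' : 1 <= expR u by rewrite -expR0 ler_expR.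
have : 0 <= (expR u - 1) * (expR (v - u) - 1) by apply: mulr_ge0; lra.
lra.
Qed.

(** The integral matrix [d] is the identity as [1 / 16] is small enough. Then the
    entries can be compared; the expanding coordinate is the quotient of the
    entries of the first row. *)
Lemma chart_near (x y t x' y' t' e : R) (E d : 'M[R]_2) :
  0 <= x <= 1 / 16 -> 0 <= y <= 1 / 16 -> 0 <= t <= 1 / 16 ->
  0 <= x' <= 1 / 16 -> 0 <= y' <= 1 / 16 -> 0 <= t' <= 1 / 16 ->
  e <= 1 / 64 -> near_id e E -> (forall a b, d a b \is a Num.int) ->
  chart_mx x' y' t' *m d = E *m chart_mx x y t ->
  [/\ `|x' - x| <= 3 * e, `|y' - y| <= 3 * e & `|t' - t| <= 3 * e].
Proof.
move=> hx hy ht hx' hy' ht' he nE di eqm.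
have e0 : 0 <= e := le_trans (normr_ge0 _) (nE 0 0).
have [g0 g2 ng] := chart_box hx hy ht; have [_ _ ng'] := chart_box hx' hy' ht'.
have EG := near_id_mul nE g0 g2; rewrite -eqm in EG.
have d1 : d = 1%:M.
  apply: (near_id_discrete _ _ _ di eqm).
  - rewrite !mxE/=; have : expR x' * expR (- x') = 1 by rewrite -expRD subrr expR0.
    by clear; move=> h; ring: h.
  - by move=> a b; have := ng' a b; lra.
  - move=> a b; have := ler_distD (chart_mx x y t a b) ((E *m chart_mx x y t) a b) (a == b)%:R.
    have := ng a b; have := EG a b; rewrite -eqm; clear -he; lra.
rewrite d1 mulmx1 in EG.
have h00 := EG 0 0; have h01 := EG 0 1; have h10 := EG 1 0.
rewrite !mxE/= in h00 h01 h10.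
case/andP: hx hx' ht => x0 _ /andP[x'0 _] /andP[t0 t1]; clear -e0 x0 x'0 t0 t1 h00 h01 h10.
split.
- by have := expR_expand x0 x'0; lra.
- by lra.
- have h1 : `|(expR x' - expR x) * t| <= 2 * e * (1 / 16).
    by rewrite normrM; apply: ler_pM => //; rewrite ger0_norm.
  have h2 : `|expR x' * (t' - t)| <= 3 * e.
    rewrite (_ : _ * _ = (expR x' * t' - expR x * t) - (expR x' - expR x) * t); last by ring.
    have := ler_normB (expR x' * t' - expR x * t) ((expR x' - expR x) * t); lra.
  apply: le_trans h2; rewrite normrM ler_peMl// ger0_norm ?expR_ge0//.
  by rewrite -expR0 ler_expR.
Qed.
End Separation.

Section ChartSeparation.
Variable R : realType.
Variables (n : nat) (rho : Gn R n -> ambient R n -> ambient R n -> R).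
Hypothesis Hrho : right_invariant_riemannian rho.

(** On a small box the chart followed by the quotient map is injective, and
    distances bound differences of coordinates: by [curve_short] a short curve
    moves a representative by a matrix close to the identity. *)
Lemma chart_separation : exists2 C : R, 0 < C & exists2 l0, 0 < l0 &
  forall (x y t x' y' t' : 'I_n -> R) l,
  (forall i, [/\ 0 <= x i <= 1 / 16, 0 <= y i <= 1 / 16 & 0 <= t i <= 1 / 16]) ->
  (forall i, [/\ 0 <= x' i <= 1 / 16, 0 <= y' i <= 1 / 16 & 0 <= t' i <= 1 / 16]) ->
  (quotient_dist rho (coset_pi (chart x y t)) (coset_pi (chart x' y' t')) < l%:E)%E -> l <= l0 ->
  forall i, [/\ `|x' i - x i| <= C * l, `|y' i - y i| <= C * l & `|t' i - t i| <= C * l].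
Proof.
have [K K0 KP] := curve_short Hrho.
exists (3 * K); first by rewrite mulr_gt0.
exists (1 / (64 * K)); first by rewrite divr_gt0// mulr_gt0.
move=> x y t x' y' t' l box box' /ereal_inf_lt[_ [[p p'] /= [pg pg'] <-]].
move=> /ereal_inf_lt[_ [c [cC1 c0 c1] <-]] /ltW cl ll i.
have Kl : K * l <= 1 / 64.
  move: ll; rewrite ler_pdivlMr ?mulr_gt0//; lra.
have [k ki kE] := coset_pi_eq (esym pg); have [k' ki' kE'] := coset_pi_eq (esym pg').
have Kl1 : K * l <= 1 by lra.
have hE := KP c l cC1 cl Kl1 i; rewrite c0 c1 in hE.
rewrite -!mulrA; have [bx by_ bt] := box i; have [bx' by' bt'] := box' i.
apply: (chart_near (d := slmx (k' i * (k i)^-1)%g) bx by_ bt bx' by' bt' Kl hE).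
  have [i00 i01 i10 i11] := slmx_inv (k i).
  have intV a b : slmx (k i)^-1%g a b \is a Num.int.
    by have [->|->] := ord2P a; have [->|->] := ord2P b;
      rewrite ?i00 ?i01 ?i10 ?i11 ?rpredN; exact: ki.
  move=> a b; rewrite -[slmx _]/(slmx (k' i) *m slmx (k i)^-1%g) mulmx22.
  by rewrite rpredD// rpredM//; exact: ki'.
rewrite -[slmx _ *m slmx (p i)^-1%g]/(slmx (p' i * (p i)^-1)%g) kE kE' !ffunE.
rewrite -[chart_mx _ _ _]/(slmx (chart_sl2 (x' i) (y' i) (t' i))).
rewrite -[chart_mx (x i) _ _]/(slmx (chart_sl2 (x i) (y i) (t i))).
set g' := chart_sl2 (x' i) (y' i) (t' i); set g := chart_sl2 (x i) (y i) (t i).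
rewrite -[LHS]/(slmx (g' * (k' i * (k i)^-1))%g) -[RHS]/(slmx (g' * k' i * (g * k i)^-1 * g)%g).
by rewrite invgM !mulgA mulgVK.
Qed.
End ChartSeparation.

(** * Frostman sets and their products *)

Section Frostman.
Variable R : realType.

Lemma frostman_segment (a : R) : 0 < a -> frostman `[0, a] 1.
Proof.
move=> a0; exists (2 / a); split=> [|eps eps0]; first by rewrite divr_ge0// ltW.
pose N := (Num.truncn (a / eps)).+1.
have N0 : 0 < N%:R :> R by rewrite ltr0n.
have Neps : a / N%:R <= eps.
  rewrite ler_pdivrMr// mulrC -ler_pdivrMr//; apply: ltW; exact: truncnS_gt.
have d0 : 0 < a / N%:R by rewrite divr_gt0.
exists [seq k%:R * (a / N%:R) | k <- iota 0 N]; split; first by rewrite size_map size_iota.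
  move=> v /mapP[k]; rewrite mem_iota add0n => kN ->; rewrite /= in_itv/= mulr_ge0 ?(ltW d0)//=.
  by rewrite mulrCA ler_piMr ?(ltW a0)// ler_pdivrMr// mul1r ler_nat ltnW.
move=> lo r er; have r0 : 0 < r by apply: lt_le_trans er.
rewrite size_map size_iota powRr1 ?(ltW r0)// count_map.
have cnt : forall (s : seq nat) (c d : R), sorted ltn s -> 
    (forall k, k \in s -> c <= k%:R <= c + d) -> 0 <= d -> (size s)%:R <= d + 1.
  move=> s c d ss sd dd; case: s ss sd => [|k s] /= ss sd; first by rewrite addr_ge0.
  have h : (k + size s <= last k s)%N.
    elim: s k ss {sd} => [|k' s IH] k /=; first by rewrite addn0.
    by move=> /andP[kk' /IH]; lia.
  have h1 := sd k (mem_head _ _); have h2 := sd (last k s) (mem_last _ _).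
  have : (k + size s)%:R <= (last k s)%:R :> R by rewrite ler_nat.
  by rewrite natrD -natr1; lra.
apply: (@le_trans _ _ (r / (a / N%:R) + 1)).
  rewrite -size_filter; apply: (cnt _ (lo / (a / N%:R))).
  - by apply: sorted_filter; [exact: ltn_trans|exact: iota_ltn_sorted].
  - move=> k; rewrite mem_filter/= => /andP[/andP[k1 k2] _].
    by rewrite -mulrDl ler_pdivrMr// k1 ler_pdivlMr.
  - by rewrite divr_ge0// ltW.
have -> : 2 / a * N%:R * r = r / (a / N%:R) + r / (a / N%:R) by field; rewrite !gt_eqF.
by rewrite lerD2l ler_pdivlMr// mul1r; apply: le_trans er.
Qed.

(** For [v] in a bounded set only finitely many [p] and [q] occur in each of the
    conditions. *)
Lemma cusp_set_compact a : compact (cusp_set a : set R).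
Proof.
apply: (subclosed_compact _ (@segment_compact R 0 (1 / 16))); last first.
  by move=> v [v01 _]; rewrite /= in_itv.
have -> : (cusp_set a : set R) = \bigcap_k (`[0, 1 / 16] `&`
    \big[setU/set0]_(q <- iota 1 (2 ^ window_start a k)) \big[setU/set0]_(p <- iota 0 (2 ^ window_start a k).+2)
      [set v | `|q%:R * v - p%:R| <= (2 ^ window_end a k)%:R^-1]).
  apply/seteqP; split=> [v [v01 av] k _|v av].
    split; first by rewrite /= in_itv.
    have [p [q [q0 qS qD]]] := av k; have qi : q \in iota 1 (2 ^ window_start a k) by rewrite mem_iota; lia.
    rewrite -bigcup_seq; exists q => //.
    have h1 : q%:R * v <= (2 ^ window_start a k)%:R.
      by rewrite -[leRHS]mulr1 ler_pM// ?ler_nat//; lra.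
    have h2 : (2 ^ window_end a k)%:R^-1 <= 1 :> R by rewrite invf_le1 ?ltr0n ?ler1n expn_gt0.
    have pS : (p <= (2 ^ window_start a k).+1)%N.
      rewrite -(ler_nat R) -natr1; move: qD; rewrite ler_norml => /andP[h3 _]; lra.
    have pi : p \in iota 0 (2 ^ window_start a k).+2 by rewrite mem_iota add0n ltnS.
    by rewrite -bigcup_seq; exists p.
  split; first by have [] := av 0%N I; rewrite /= in_itv.
  move=> k; have [_] := av k I; rewrite -bigcup_seq => -[q qi]; rewrite -bigcup_seq => -[p _ h].
  by exists p, q; split=> //; have : q \in iota 1 (2 ^ window_start a k) := qi; rewrite mem_iota; lia.
apply: closed_bigI => k _; apply: closedI; first exact: interval_closed.
apply: closed_bigsetU => q _; apply: closed_bigsetU => p _.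
have -> : [set v : R | `|q%:R * v - p%:R| <= (2 ^ window_end a k)%:R^-1] =
    (fun v => `|q%:R * v - p%:R|) @^-1` [set x : R | x <= (2 ^ window_end a k)%:R^-1] by [].
apply: preimage_closed; last exact: closed_le.
move=> v _; apply: cvg_norm; apply: cvgB; last exact: cvg_cst.
by apply: cvgM; [exact: cvg_cst|exact: cvg_id].
Qed.
End Frostman.

HB.instance Definition _ (R : realType) (J : eqType) :=
  isPointed.Build (prod_topology (fun _ : J => R)) (fun=> 0).

Section ProductFrostman.
Variables (R : realType) (J : finType) (A : J -> set R) (e : J -> R).
Hypotheses (cA : forall j, compact (A j)) (fA : forall j, frostman (A j) (e j)).

Lemma box_cover_finite (z : nat -> J -> R) (r : nat -> R) :
  (forall f : J -> R, (forall j, A j (f j)) -> exists i, forall j, `|f j - z i j| < r i) ->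
  exists N, forall f : J -> R, (forall j, A j (f j)) ->
    exists2 i, (i < N)%N & forall j, `|f j - z i j| < r i.
Proof.
move=> cov; pose U i : set (prod_topology (fun _ : J => R)) :=
  [set f | forall j, `|f j - z i j| < r i].
have : @cover_compact (prod_topology (fun _ : J => R)) [set f | forall j, A j (f j)].
  rewrite -[cover_compact _]/(@cover_compact (prod_topology (fun _ : J => R) : ptopologicalType) _).
  by rewrite -compact_cover; exact: (@tychonoff J (fun _ => R) A cA).
move=> /(_ nat setT U)[||D _ DU].
- move=> i _; rewrite openE => f Uf.
  have h j : nbhs f [set g : prod_topology (fun _ : J => R) | `|g j - z i j| < r i].
    have oj : open [set v : R | `|v - z i j| < r i].
      have -> : [set v : R | `|v - z i j| < r i] = ball (z i j) (r i).
        by apply/seteqP; split=> v /=; rewrite /ball/= distrC.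
      exact: ball_open.
    apply: (@proj_continuous J (fun _ => R) j f [set v : R | `|v - z i j| < r i]).
    by move: oj; rewrite openE; apply; exact: Uf.
  exact: (@filter_forall (J -> R) J (fun j g => `|g j - z i j| < r i) (nbhs f) (nbhs_filter f) h).
- by move=> f /cov[i fi]; exists i.
exists (\max_(i <- finmap.enum_fset D) i).+1 => f /DU[i /= iD fi]; exists i => //.
by rewrite ltnS; apply: (@leq_bigmax_seq _ _ xpredT id).
Qed.

Lemma min_radius (r : nat -> R) N : (forall i, 0 < r i) -> exists2 eps, 0 < eps &
  forall i, (i < N)%N -> eps <= r i.
Proof.
move=> r0; elim: N => [|N [eps eps0 IH]]; first by exists 1.
exists (Num.min eps (r N)); first by rewrite lt_min eps0 r0.
move=> i; rewrite ltnS leq_eqVlt => /orP[/eqP ->|iN]; first by rewrite ge_min lexx orbT.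
by rewrite ge_min IH.
Qed.

Lemma sum_ord_count (l : seq R) (P : pred R) M : (size l <= M)%N ->
  \sum_(k < M | (k < size l)%N) (P l`_k)%:R = (count P l)%:R :> R.
Proof.
move=> lM; rewrite -(big_ord_widen M (fun k => (P l`_k)%:R) lM).
rewrite -sum1_count natr_sum (big_nth 0) big_mkcond big_mkord.
by rewrite [RHS]big_mkcond; apply: eq_bigr => k _; case: (P _).
Qed.

(** The mass distribution principle for a product of Frostman sets and covers by
    cubes. By compactness finitely many cubes suffice; at the scale of the
    smallest one, the points of the product of the finite subsets are counted in
    each cube. *)
Lemma product_frostman : exists2 c : R, 0 < c &
  forall (z : nat -> J -> R) (r : nat -> R), (forall i, 0 < r i) ->
  (forall f : J -> R, (forall j, A j (f j)) -> exists i, forall j, `|f j - z i j| < r i) ->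
  exists N, c <= \sum_(i < N) r i `^ (\sum_j e j).
Proof.
have /boolp.choice[C CP] := fA.
pose B := \prod_j ((C j + 1) * 2 `^ e j).
have B0 : 0 < B.
  by apply: prodr_gt0 => j _; rewrite mulr_gt0 ?powR_gt0//; have [] := CP j; lra.
exists B^-1 => [|z r r0 cov]; first by rewrite invr_gt0.
have [N covN] := box_cover_finite cov; have [eps eps0 epsr] := min_radius N r0.
exists N; have /boolp.choice[l lP] j := (CP j).2 eps eps0.
pose M := (\max_j size (l j))%N.
have lM j : (size (l j) <= M)%N by exact: leq_bigmax.
pose Q j (k : 'I_M) := (k < size (l j))%N.
pose F i j (k : 'I_M) : R := ((fun v => z i j - r i <= v <= z i j - r i + 2 * r i)%R (l j)`_k)%:R.
pose T : R := \prod_j (size (l j))%:R.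
have T0 : 0 < T by apply: prodr_gt0 => j _; have [] := lP j; rewrite ltr0n.
have F0 i j k : 0 <= F i j k by [].
have TE : T = \sum_(f in family Q) 1.
  transitivity (\prod_j \sum_(k < M | Q j k) (1 : R)).
    apply: eq_bigr => j _; rewrite -(sum_ord_count xpredT (lM j)) ?count_predT//.
  rewrite bigA_distr_big_dep; apply: eq_bigr => f _; exact: big1.
have le1 (f : {ffun J -> 'I_M}) : f \in family Q -> 1 <= \sum_(i < N) \prod_j F i j (f j).
  move=> /familyP fQ.
  have [j|i iN fi] := covN (fun j => (l j)`_(f j)).
    by have [_ + _] := lP j; apply; apply: mem_nth; exact: fQ.
  rewrite (bigD1 (Ordinal iN))//= big1 => [|j _]; last first.
    by rewrite /F; have := fi j; rewrite ltr_norml => h; rewrite (_ : _ && _ = true)//; lra.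
  by rewrite lerDl; apply: sumr_ge0 => *; exact: prodr_ge0.
have bound (i : 'I_N) j : \sum_(k < M | Q j k) F i j k <= (C j + 1) * 2 `^ e j * ((size (l j))%:R * r i `^ e j).
  rewrite (sum_ord_count (fun v => z i j - r i <= v <= z i j - r i + 2 * r i) (lM j)).
  have [_ _ cnt] := lP j; have ri := r0 i; have ei := epsr i (ltn_ord i).
  apply: (le_trans (cnt (z i j - r i) (2 * r i) _)); first lra.
  rewrite powRM ?(ltW ri)// [leRHS](_ : _ = (C j + 1) * ((size (l j))%:R * (2 `^ e j * r i `^ e j))); last by ring.
  rewrite -mulrA; apply: ler_wpM2r; last by rewrite lerDl.
  by apply: mulr_ge0 => //; apply: mulr_ge0; exact: powR_ge0.
have powS (i : 'I_N) : \prod_j r i `^ e j = r i `^ (\sum_j e j).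
  elim/big_rec2: _ => [|j x y _ ->]; first by rewrite powRr0.
  by rewrite powRD//; apply/implyP => _; rewrite gt_eqF.
have : T <= B * T * \sum_(i < N) r i `^ (\sum_j e j).
  rewrite {1}TE; apply: (@le_trans _ _ (\sum_(f in family Q) \sum_(i < N) \prod_j F i j (f j))).
    by apply: ler_sum => f; exact: le1.
  rewrite exchange_big mulr_sumr; apply: ler_sum => i _.
  rewrite -bigA_distr_big_dep; apply: (@le_trans _ _ (\prod_j ((C j + 1) * 2 `^ e j * ((size (l j))%:R * r i `^ e j)))).
    by apply: ler_prod => j _; rewrite bound andbT; exact: sumr_ge0.
  by rewrite !big_split/= -/B -/T powS mulrA -big_split.
rewrite -mulrA [T * _]mulrC mulrA -{1}[T]mul1r ler_pM2r//.
by rewrite -ler_pdivrMl// mulr1.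
Qed.
End ProductFrostman.

(** * The lower bound *)

Section LowerBound.
Variables (R : realType) (n : nat) (rho : Gn R n -> ambient R n -> ambient R n -> R).
Hypotheses (n2 : (2 <= n)%N) (Hrho : right_invariant_riemannian rho).

Lemma powRD_le (a b s : R) : 0 <= a -> 0 <= b -> 0 <= s -> (a + b) `^ s <= 2 `^ s * (a `^ s + b `^ s).
Proof.
move=> a0 b0 s0; wlog ab : a b a0 b0 / a <= b.
  by move=> h; have [/h|/ltW/h] := lerP a b; last rewrite [b + a]addrC [b `^ s + _]addrC; exact.
apply: (@le_trans _ _ ((2 * b) `^ s)).
  apply: ge0_ler_powR; rewrite ?nnegrE ?addr_ge0 ?mulr_ge0//; lra.
by rewrite powRM// ler_wpM2l ?powR_ge0// lerDr powR_ge0.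
Qed.

Local Notation J := ('I_n * 'I_3)%type.
Let c0 : 'I_3 := inord 0. Let c1 : 'I_3 := inord 1. Let c2 : 'I_3 := inord 2.

Lemma ord3P (k : 'I_3) : [\/ k = c0, k = c1 | k = c2].
Proof.
by case: k => [[|[|[|//]]] ?]; [constructor 1|constructor 2|constructor 3]; apply/val_inj; rewrite /= inordK.
Qed.

Definition chart_of (f : J -> R) : Gn R n :=
  chart (fun i => f (i, c0)) (fun i => f (i, c1)) (fun i => f (i, c2)).

(* the coordinates with index 0 and 1 are those whose cusp windows alternate *)
Definition cusp_index (a : nat) : 'I_n := 
  if a == 0%N then Ordinal (ltnW n2) else Ordinal n2.
Let j0 : J := (cusp_index 0, c2). Let j1 : J := (cusp_index 1, c2).

Definition factor (j : J) : set R :=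
  if j == j0 then cusp_set 0 else if j == j1 then cusp_set 1 else [set` `[0, 1 / 16]].

Lemma j01 : j1 != j0.
Proof. by rewrite xpair_eqE -val_eqE. Qed.

Lemma factor_box j v : factor j v -> 0 <= v <= 1 / 16.
Proof.
by rewrite /factor; case: ifP => _; [case|case: ifP => _; [case|rewrite /= in_itv]].
Qed.

Lemma factor_divergent f : (forall j, factor j (f j)) -> divergent_set R n (coset_pi (chart_of f)).
Proof.
move=> ff; apply: (cusp_divergent (i := cusp_index)) => [k|a a2].
  have := factor_box (ff (k, c0)); have := factor_box (ff (k, c1)).
  by rewrite !ler_norml => ? ?; split; lra.
case: a a2 => [|[|//]] _; first by have := ff j0; rewrite /factor eqxx.
by have := ff j1; rewrite /factor (negPf j01) eqxx.
Qed.

Lemma chart_of_separation : exists2 C : R, 0 < C & exists2 l0, 0 < l0 & forall f g l,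
  (forall j, factor j (f j)) -> (forall j, factor j (g j)) ->
  (quotient_dist rho (coset_pi (chart_of f)) (coset_pi (chart_of g)) < l%:E)%E -> l <= l0 ->
  forall j, `|g j - f j| <= C * l.
Proof.
have [C C0 [l0 l00 sep]] := chart_separation Hrho; exists C => //; exists l0 => // f g l ff fg dl ll [i k].
have box h i' : (forall j, factor j (h j)) ->
    [/\ 0 <= h (i', c0) <= 1 / 16, 0 <= h (i', c1) <= 1 / 16 & 0 <= h (i', c2) <= 1 / 16].
  by move=> fh; split; exact: factor_box (fh _).
have [b0 b1 b2] := sep _ _ _ _ _ _ l (fun i => box f i ff) (fun i => box g i fg) dl ll i.
by have [->|->|->] := ord3P k.
Qed.

(** Two factors of exponent [s1] and [3 n - 2] factors of exponent 1. *)
Lemma factor_product (s : R) : (3 * n)%:R - 1 <= s < (3 * n)%:R - 1 / 2 -> exists2 c : R, 0 < c &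
  forall (z : nat -> J -> R) (r : nat -> R), (forall i, 0 < r i) ->
  (forall f : J -> R, (forall j, factor j (f j)) -> exists i, forall j, `|f j - z i j| < r i) ->
  exists N, c <= \sum_(i < N) r i `^ s.
Proof.
move=> s12; pose s1 := (s - (3 * n)%:R + 2) / 2.
have hs1 : 0 <= s1 < 3 / 4 by rewrite /s1; lra.
pose e (j : J) : R := 1 + (if j == j0 then s1 - 1 else 0) + (if j == j1 then s1 - 1 else 0).
have sumE : \sum_j e j = s.
  rewrite /e !big_split/= -!big_mkcond/= !big_pred1_eq sumr_const card_prod !card_ord mulnC.
  by rewrite /s1 -[1 *+ _]/((3 * n)%:R); field.
have a16 : (0 : R) < 1 / 16 by lra.
have := @product_frostman R J factor e; rewrite sumE; apply => j; rewrite /factor /e.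
  case: ifP => _; first exact: cusp_set_compact.
  by case: ifP => _; [exact: cusp_set_compact|exact: segment_compact].
have [jj0|jj0] := boolP (j == j0).
  by rewrite (eqP jj0) eq_sym (negPf j01) addr0 addrCA subrr addr0; exact: cusp_set_frostman.
have [jj1|jj1] := boolP (j == j1); last by rewrite !addr0; exact: frostman_segment.
by rewrite addr0 addrCA subrr addr0; exact: cusp_set_frostman.
Qed.

(** A cover of the divergent set by sets of small total weight would give a cover
    of the product by cubes of proportional size, by [chart_of_separation]. The
    exponent is first raised to [s'], which is at least [3 n - 1] in order to be
    attained by [factor_product], and at least 1. *)
Lemma divergent_positive (s : R) : 0 <= s < (3 * n)%:R - 1 / 2 ->
  hausdorff_measure (quotient_dist rho) s (divergent_set R n) <> 0%E.
Proof.
move=> /andP[s0 s_lt] Hs0.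
have n3 : 1 <= (3 * n)%:R - 1 :> R.
  have : (3 * 2)%:R <= (3 * n)%:R :> R by rewrite ler_nat leq_mul.
  rewrite (_ : (3 * 2)%N = 6%N)//; lra.
pose s' := Num.max s ((3 * n)%:R - 1).
have ss' : s <= s' by rewrite le_max lexx.
have s'1 : 1 <= s' by rewrite le_max n3 orbT.
have hs' : (3 * n)%:R - 1 <= s' < (3 * n)%:R - 1 / 2.
  by rewrite le_max lexx orbT/= gt_max s_lt/=; lra.
have [c c_gt0 mass] := factor_product hs'.
have [C C0 [l0 l00 sep]] := chart_of_separation.
pose kap := (4 * C) `^ s'.
have kap0 : 0 < kap by apply: powR_gt0; exact: mulr_gt0.
pose eta := Num.min 1 (Num.min (l0 / 2) (c / (4 * kap))).
have eta0 : 0 < eta by rewrite !lt_min ltr01/= divr_gt0//=; apply: divr_gt0 => //; apply: mulr_gt0.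
have eta1 : eta <= 1 by rewrite ge_min lexx.
have etal : eta <= l0 / 2 by rewrite !ge_min lexx orbT.
have etac : 4 * kap * eta <= c.
  by rewrite mulrC -ler_pdivlMr ?mulr_gt0// !ge_min lexx !orbT.
have : (hausdorff_premeasure (quotient_dist rho) s eta (divergent_set R n) < eta%:E)%E.
  by apply: (@le_lt_trans _ _ 0%E); [rewrite -Hs0; apply: ereal_sup_ubound; exists eta|rewrite lte_fin].
move=> /ereal_inf_lt[_ [U [DU dU] <-]] sumU.
pose weight i := hausdorff_weight (quotient_dist rho) s (U i).
(* a point of the product and the diameter as a real number, for each set of the cover *)
have /boolp.choice[dz dzP] : forall i, exists dz : R * (J -> R),
   [/\ 0 <= dz.1 <= eta, ((dz.1 `^ s')%:E <= weight i)%E &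
     forall f eps, (forall j, factor j (f j)) -> U i (coset_pi (chart_of f)) -> 0 < eps ->
       dz.1 + eps <= l0 -> forall j, `|f j - dz.2 j| <= C * (dz.1 + eps)].
  move=> i; have [[g [fg Ug]]|noU] := pselect (exists g, (forall j, factor j (g j)) /\ U i (coset_pi (chart_of g))).
    pose u := coset_pi (chart_of g).
    have diam0 : (0 <= diameter (quotient_dist rho) (U i))%E.
      by apply: le_trans (quotient_dist_ge0 rho u u) _; apply: ereal_sup_ubound; exists (u, u).
    have diamE : diameter (quotient_dist rho) (U i) = (fine (diameter (quotient_dist rho) (U i)))%:E.
      by rewrite fineK// ge0_fin_numE// (le_lt_trans (dU i))// ltry.
    move: diamE diam0; set D := fine _ => diamE; rewrite diamE lee_fin => D0.
    have De : D <= eta by have := dU i; rewrite diamE lee_fin.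
    exists (D, g); split=> /=; first by rewrite D0.
      rewrite /weight /hausdorff_weight; case: ifPn => [/eqP Ui0|_]; first by rewrite Ui0 in Ug.
      rewrite diamE poweR_EFin lee_fin; move: D0; rewrite le_eqVlt => /orP[/eqP <-|D0].
        by rewrite powR0 ?powR_ge0//; lra.
      by apply: ger_powR => //; rewrite D0/=; lra.
    move=> f eps ff Uf eps0 De0; apply: sep => //.
    apply: (@le_lt_trans _ _ D%:E); last by rewrite lte_fin ltrDl.
    by rewrite -diamE; apply: ereal_sup_ubound; exists (u, coset_pi (chart_of f)).
  exists (0, fun=> 0); split=> /=; first by rewrite lexx ltW.
    rewrite powR0; last by lra.
    exact: hausdorff_weight_ge0.
  by move=> f eps ff Uf; case: noU; exists f.
(* summable enlargements, for the sets of diameter 0 *)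
pose eps i : R := eta * 2^-1 ^+ i.+1.
have eps0 i : 0 < eps i by rewrite mulr_gt0// exprn_gt0.
have epsl i : eps i <= eta.
  by apply: ler_piMr; [exact: ltW|apply: exprn_ile1; [|lra]].
pose r i : R := 2 * C * ((dz i).1 + eps i).
have dz0 i : 0 <= (dz i).1 by have [/andP[]] := dzP i.
have dze i : (dz i).1 <= eta by have [/andP[]] := dzP i.
have de0 i : 0 < (dz i).1 + eps i by have := dz0 i; have := eps0 i; lra.
have [i|f ff|N] := mass (fun i => (dz i).2) r.
- by rewrite !mulr_gt0.
- have [i _ Ui] := DU _ (factor_divergent ff); exists i => j.
  have [_ _ close] := dzP i; apply: le_lt_trans (close f (eps i) ff Ui (eps0 i) _ j) _.
    by have := dze i; have := epsl i; lra.
  by rewrite /r -mulrA ltr_pMl ?mulr_gt0//; lra.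
have sumd : \sum_(i < N) (dz i).1 `^ s' <= eta.
  rewrite -lee_fin -sumEFin; apply: le_trans (ltW sumU).
  apply: le_trans (nneseries_lim_ge N _); last by move=> *; exact: hausdorff_weight_ge0.
  by rewrite big_mkord; apply: lee_sum => i _; have [] := dzP i.
have sume : \sum_(i < N) eps i `^ s' <= eta.
  apply: (@le_trans _ _ (\sum_(i < N) eps i)).
    apply: ler_sum => i _; rewrite -[leRHS]powRr1 ?(ltW (eps0 i))//.
    by apply: ger_powR => //; rewrite eps0 (le_trans (epsl i)).
  have -> : \sum_(i < N) eps i = eta * (1 - 2^-1 ^+ N).
    clear sumd; elim: N => [|N IH]; first by rewrite big_ord0 expr0 subrr mulr0.
    by rewrite big_ord_recr/= IH /eps exprS; field.
  by apply: ler_piMr; [exact: ltW|rewrite gerBl exprn_ge0].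
apply/negP; rewrite -ltNge.
apply: (@le_lt_trans _ _ (\sum_(i < N) kap * ((dz i).1 `^ s' + eps i `^ s'))).
  apply: ler_sum => i _; rewrite /r powRM ?(ltW (de0 i)) ?mulr_ge0 ?(ltW C0)//.
  apply: (@le_trans _ _ ((2 * C) `^ s' * (2 `^ s' * ((dz i).1 `^ s' + eps i `^ s')))).
    by rewrite ler_wpM2l ?powR_ge0//; apply: powRD_le => //; [exact: ltW|lra].
  rewrite mulrA -powRM ?mulr_ge0 ?(ltW C0)// (_ : 2 * C * 2 = 4 * C)//; ring.
rewrite -mulr_sumr big_split/=.
apply: (@le_lt_trans _ _ (kap * (eta + eta))); first by rewrite ler_wpM2l ?(ltW kap0)// lerD.
have := mulr_gt0 kap0 eta0; lra.
Qed.
End LowerBound.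

Lemma hausdorff_dim_divergent (R : realType) (n : nat) (rho : Gn R n -> ambient R n -> ambient R n -> R) :
  (2 <= n)%N -> right_invariant_riemannian rho ->
  hausdorff_dim (quotient_dist rho) (divergent_set R n) = ((3 * n)%:R - 1 / 2)%:E.
Proof.
move=> n2 Hrho; have n0 : (0 < n)%N by exact: ltnW.
apply/eqP; rewrite eq_le; apply/andP; split.
  apply/lee_addgt0Pr => e e0; rewrite -EFinD; apply: ereal_inf_lbound.
  exists ((3 * n)%:R - 1 / 2 + e) => //; split.
    have : 1 <= (3 * n)%:R :> R by rewrite ler1n muln_gt0.
    by lra.
  by apply: divergent_null => //; rewrite ltrDl.
apply: le_ereal_inf_tmp => _ [s [s0 Hs] <-]; rewrite lee_fin leNgt; apply/negP => s_lt.
by apply: (divergent_positive n2 Hrho (s := s)); rewrite ?s0.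
Qed.

Theorem theorem1p1 (R : realType) (n : nat)
    (rho : Gn R n -> ambient R n -> ambient R n -> R) :
  (2 <= n)%N -> right_invariant_riemannian rho ->
  hausdorff_dim (quotient_dist rho) (divergent_set R n)
    = ((3 * n)%:R - 1 / 2)%:E.
Proof. exact: hausdorff_dim_divergent. Qed.
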